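(* Let $p$ be an odd prime and $L$ a non-degenerate even lattice of signature $(b^+,b^-)$ such that the discriminant group $L'/L$ is isomorphic to $\mathbb{Z}/p\mathbb{Z}$; identify $L'/L$ with $\mathbb{Z}/p\mathbb{Z}$ so that $Q(\gamma)=\frac{\lambda\gamma^2}{p} \bmod 1$ with $\lambda\in\mathbb{Z}/p\mathbb{Z}$, $\lambda\ne0$. Put $\epsilon=\left(\frac{\lambda}{p}\right)$ and $\delta=\left(\frac{-1}{p}\right)\epsilon$. Let $k$ be an integer with $k\equiv\frac{b^+-b^-}{2}\pmod 2$. Then the map $f\mapsto F=\sum_{\gamma\in\mathbb{Z}/p\mathbb{Z}}F_\gamma\mathfrak{e}_\gamma$ with $$F_\gamma(\tau)=s(\gamma)\sum_{n\in\mathbb{Z},\ n\equiv pQ(\gamma)\ (\mathrm{mod}\ p)}c_f\left(n,\tfrac{y}{p}\right)q^{n/p}$$ defines an isomorphism of $H_k^{\epsilon}(\Gamma_0(p),(\frac{\cdot}{p}))$ onto $H_{k,\rho_L}$, and the map $f\mapsto F$ with $$F_\gamma(\tau)=s(\gamma)\sum_{n\in\mathbb{Z},\ n\equiv -pQ(\gamma)\ (\mathrm{mod}\ p)}c_f\left(n,\tfrac{y}{p}\right)q^{n/p}$$ defines an isomorphism of $H_k^{\delta}(\Gamma_0(p),(\frac{\cdot}{p}))$ onto $H_{k,\bar\rho_L}$.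
   Context: Notation: $\tau=x+iy\in\mathbb{H}$, $e(z)=e^{2\pi iz}$, $q^r=e(r\tau)$ for $r\in\mathbb{Q}$, $\left(\frac{\cdot}{p}\right)$ is the Legendre symbol (zero on multiples of $p$), $\Gamma(a,y)=\int_y^\infty e^{-t}t^{a-1}dt$, and $\Delta_k=-y^2\left(\frac{\partial^2}{\partial x^2}+\frac{\partial^2}{\partial y^2}\right)+iky\left(\frac{\partial}{\partial x}+i\frac{\partial}{\partial y}\right)$. For $l\in\mathbb{Z}$ (or $l\in \mathbb{Z}/p\mathbb{Z}$), $s(l)=2$ if $l\equiv0\bmod p$ and $s(l)=1$ otherwise. Scalar valued forms: $H_k(\Gamma_0(p),(\frac{\cdot}{p}))$ is the space of smooth $f:\mathbb{H}\to\mathbb{C}$ such that (i) $f\left(\frac{a\tau+b}{c\tau+d}\right)=\left(\frac{d}{p}\right)(c\tau+d)^kf(\tau)$ for all $\begin{pmatrix}a&b\\c&d\end{pmatrix}\in\Gamma_0(p)$; (ii) $\Delta_kf=0$; (iii) there is a Fourier polynomial $P_f(\tau)=\sum_{-\infty\ll n\le0}c_f^+(n)q^n$ with $f(\tau)=P_f(\tau)+O(e^{-\varepsilon y})$ as $y\to\infty$ for some $\varepsilon>0$, and analogous conditions hold at all cusps. Such $f$ decomposes uniquely as $f=f^++f^-$ with $f^+=\sum_{n\gg-\infty}c_f^+(n)q^n$ and $f^-=\sum_{n<0}c_f^-(n)\Gamma(1-k,4\pi|n|y)q^n$. Put $c_f(n,y)=c_f^+(n)+c_f^-(n)\Gamma(1-k,4\pi|n|y)$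 (with the second term absent for $n\ge0$). For $\epsilon\in\{\pm1\}$, $H_k^{\epsilon}(\Gamma_0(p),(\frac{\cdot}{p}))$ is the subspace of $f$ with $c_f^\pm(n)=0$ whenever $\left(\frac{n}{p}\right)=-\epsilon$. Lattice and Weil representation: $(V,Q)$ is a non-degenerate rational quadratic space of signature $(b^+,b^-)$ with bilinear form $(X,Y)=Q(X+Y)-Q(X)-Q(Y)$; $L\subset V$ is an even lattice ($Q(L)\subset\mathbb{Z}$) with dual $L'$; $Q$ induces $Q:L'/L\to\mathbb{Q}/\mathbb{Z}$; $\mathbb{C}[L'/L]$ has standard basis $\mathfrak{e}_\gamma$. When $L'/L\cong\mathbb{Z}/p\mathbb{Z}$, $b^+-b^-$ is even and $Q$ is equivalent to a form $\lambda\gamma^2/p$ as in the claim; $pQ(\gamma)$ is a well-defined class mod $p$. $\mathrm{Mp}_2(\mathbb{Z})$ is the group of pairs $(M,\phi)$, $M=\begin{pmatrix}a&b\\c&d\end{pmatrix}\in\mathrm{SL}_2(\mathbb{Z})$, $\phi:\mathbb{H}\to\mathbb{C}$ holomorphic with $\phi(\tau)^2=c\tau+d$, with product $(M,\phi(\tau))(M',\phi'(\tau))=(MM',\phi(M'\tau)\phi'(\tau))$, generated by $T=\left(\begin{pmatrix}1&1\\0&1\end{pmatrix},1\right)$, $S=\left(\begin{pmatrix}0&-1\\1&0\end{pmatrix},\sqrt\tau\right)$. $\rho_L$ is the unitary representation of $\mathrm{Mp}_2(\mathbb{Z})$ on $\mathbb{C}[L'/L]$ with $\rho_L(T)\mathfrak{e}_\gamma=e(Q(\gamma))\mathfrak{e}_\gamma$,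 $\rho_L(S)\mathfrak{e}_\gamma=\frac{e((b^--b^+)/8)}{\sqrt{|L'/L|}}\sum_{\delta\in L'/L}e(-(\gamma,\delta))\mathfrak{e}_\delta$; $\bar\rho_L$ is its dual (complex conjugate matrices in the basis $\mathfrak{e}_\gamma$). Vector valued forms: $H_{k,\rho_L}$ is the space of smooth $f:\mathbb{H}\to\mathbb{C}[L'/L]$ with $f(M\tau)=\phi(\tau)^{2k}\rho_L(M,\phi)f(\tau)$ for all $(M,\phi)\in\mathrm{Mp}_2(\mathbb{Z})$, $\Delta_kf=0$, and for which there is a Fourier polynomial $P_f(\tau)=\sum_\gamma\sum_{n\in\mathbb{Z}+Q(\gamma),\,-\infty\ll n\le0}c_f^+(\gamma,n)e(n\tau)\mathfrak{e}_\gamma$ with $f(\tau)=P_f(\tau)+O(e^{-\varepsilon y})$ as $y\to\infty$ for some $\varepsilon>0$. $H_{k,\bar\rho_L}$ is defined in the same way with $\bar\rho_L$ (exponents in $\mathbb{Z}-Q(\gamma)$). *)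

(* Defs.v *)
From mathcomp Require Import all_boot all_order all_algebra.
From mathcomp Require Import complex.
From mathcomp Require Import all_classical all_reals all_analysis.

Set Implicit Arguments.
Unset Strict Implicit.
Unset Printing Implicit Defensive.

Import Order.TTheory GRing.Theory Num.Theory.
Import numFieldNormedType.Exports.

Local Open Scope classical_set_scope.
Local Open Scope complex_scope.
Local Open Scope ring_scope.

(* Conventions.  The complex numbers over [R : realType] are [R[i]]; the alias
   [R[i]^o] is the same type seen as a normed space over itself, which is where
   the library's limits and derivatives live.  The quotient Z/pZ is ['F_p],
   whose underlying type is an ordinal, so that it indexes the rows of
   matrices directly. *)

Section LinearIso.
Variables (K : pzRingType) (U V : lmodType K).

Definition is_subspace (A : set U) : Prop :=
  A 0 /\ forall (a : K) (f g : U), A f -> A g -> A (a *: f + g).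

End LinearIso.

Definition linear_iso (K : pzRingType) (U V : lmodType K)
    (A : set U) (B : set V) (Phi : U -> V) : Prop :=
  [/\ is_subspace A, is_subspace B,
      forall (a : K) (f g : U), A f -> A g ->
        Phi (a *: f + g) = a *: Phi f + Phi g
    & set_bij A B Phi].

Section LegendreSymbol.
Variable p : nat.

Definition legendre (a : 'F_p) : int :=
  if a == 0 then 0 else if [exists b : 'F_p, b ^+ 2 == a] then 1 else -1.

Definition s_factor (gamma : 'F_p) : nat := if gamma == 0 then 2 else 1.

End LegendreSymbol.

Section UpperHalfPlane.
Variable R : realType.

Definition uhp : Type := {tau : R[i] | 0 < complex.Im tau}.

Definition uhp_i : uhp := exist _ (0 +i* 1) ltr01.

Definition xcoord (tau : uhp) : R := complex.Re (val tau).
Definition ycoord (tau : uhp) : R := complex.Im (val tau).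

(* The point [z], when [z] is in the upper half plane; the default value is
   irrelevant below, since only germs at points of the (open) half plane are
   considered. *)
Definition to_uhp (z : R[i]) : uhp := insubd uhp_i z.

Definition cexp (z : R[i]) : R[i] :=
  (expR (complex.Re z))%:C * (cos (complex.Im z) +i* sin (complex.Im z)).

Definition e2pi (z : R[i]) : R[i] := cexp ((0 +i* (2 * pi)) * z).

Definition SL2Z : set 'M[int]_2 := [set M | \det M = 1].

Definition autfac (M : 'M[int]_2) (tau : uhp) : R[i] :=
  (M 1 0)%:~R * val tau + (M 1 1)%:~R.

(* For [M] in [SL2Z] the quotient is in the upper half plane, and the default
   value of [insubd] is not used. *)
Definition mobius (M : 'M[int]_2) (tau : uhp) : uhp :=
  insubd tau (((M 0 0)%:~R * val tau + (M 0 1)%:~R) / autfac M tau).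

Definition slash (k : int) (M : 'M[int]_2) (f : uhp -> R[i]) (tau : uhp) :
  R[i] := autfac M tau ^ (- k) * f (mobius M tau).

(* Real partial derivatives, taken on real and imaginary parts. *)

Definition at_xy (f : uhp -> R[i]) (x y : R) : R[i] := f (to_uhp (x +i* y)).

Definition derivable_x (f : uhp -> R[i]) (tau : uhp) : Prop :=
  derivable (fun x => complex.Re (at_xy f x (ycoord tau))) (xcoord tau) 1 /\
  derivable (fun x => complex.Im (at_xy f x (ycoord tau))) (xcoord tau) 1.

Definition derivable_y (f : uhp -> R[i]) (tau : uhp) : Prop :=
  derivable (fun y => complex.Re (at_xy f (xcoord tau) y)) (ycoord tau) 1 /\
  derivable (fun y => complex.Im (at_xy f (xcoord tau) y)) (ycoord tau) 1.

Definition dx (f : uhp -> R[i]) (tau : uhp) : R[i] :=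
  derive1 (fun x => complex.Re (at_xy f x (ycoord tau))) (xcoord tau) +i*
  derive1 (fun x => complex.Im (at_xy f x (ycoord tau))) (xcoord tau).

Definition dy (f : uhp -> R[i]) (tau : uhp) : R[i] :=
  derive1 (fun y => complex.Re (at_xy f (xcoord tau) y)) (ycoord tau) +i*
  derive1 (fun y => complex.Im (at_xy f (xcoord tau) y)) (ycoord tau).

Definition continuous_uhp (f : uhp -> R[i]) : Prop :=
  forall tau : uhp,
    {for (xcoord tau, ycoord tau),
      continuous (fun z : R * R => complex.Re (at_xy f z.1 z.2))} /\
    {for (xcoord tau, ycoord tau),
      continuous (fun z : R * R => complex.Im (at_xy f z.1 z.2))}.

Fixpoint Cn (n : nat) (f : uhp -> R[i]) : Prop :=
  continuous_uhp f /\
  if n is m.+1 then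
    [/\ forall tau, derivable_x f tau, forall tau, derivable_y f tau,
        Cn m (dx f) & Cn m (dy f)]
  else True.

Definition smooth (f : uhp -> R[i]) : Prop := forall n, Cn n f.

Definition Delta (k : int) (f : uhp -> R[i]) (tau : uhp) : R[i] :=
  - ((ycoord tau) ^+ 2)%:C * (dx (dx f) tau + dy (dy f) tau)
  + 'i * k%:~R * (ycoord tau)%:C * (dx f tau + 'i * dy f tau).

Definition holomorphic (f : uhp -> R[i]) : Prop :=
  forall tau : uhp,
    derivable ((f \o to_uhp) : R[i]^o -> R[i]^o) (val tau : R[i]^o) 1.

(* [g = P + O(e^(- eps y))] as y tends to infinity, for some [eps > 0] and some
   Fourier polynomial [P = \sum c(r) e(r tau)] over finitely many rational
   exponents [r <= 0] in [E]. *)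
Definition has_principal_part (E : set rat) (g : uhp -> R[i]) : Prop :=
  exists P : seq (rat * R[i]),
    (forall rc, rc \in P -> rc.1 <= 0 /\ E rc.1) /\
    exists eps B y0 : R, 0 < eps /\
      forall tau : uhp, y0 <= ycoord tau ->
        `|g tau - \sum_(rc <- P) rc.2 * e2pi (ratr rc.1 * val tau)|
          <= (B * expR (- eps * ycoord tau))%:C.

(* [\Gamma(a, y)] *)
Definition upper_gamma (a y : R) : R :=
  \int[lebesgue_measure]_(t in `[y, +oo[%classic)
     (expR (- t) * t `^ (a - 1)).

(* Partial sums of a series over Z, summed symmetrically; the series occurring
   below are absolutely convergent. *)
Definition zseries (u : int -> R[i]) : nat -> R[i]^o :=
  series (fun n : nat => (u n%:Z + u (- n.+1%:Z) : R[i]^o)).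

Definition zsum (u : int -> R[i]) : R[i] := limn (zseries u).

(* [H_k(\Gamma_0(p), (./p))].  All cusps are images of infinity under [SL2Z],
   and their widths divide [p], hence the exponents in (1/p)Z. *)
Definition harmonic_forms (p : nat) (k : int) : set (uhp -> R[i]^o) :=
  [set f |
    [/\ smooth f,
        forall M : 'M[int]_2, SL2Z M -> (p %| M 1%R 0%R)%Z ->
          forall tau : uhp,
          f (mobius M tau) =
            (legendre ((M 1 1)%:~R : 'F_p))%:~R * autfac M tau ^ k * f tau,
        forall tau : uhp, Delta k f tau = 0,
        has_principal_part [set r | r \is a Num.int] f
      & forall M : 'M[int]_2, SL2Z M ->
          has_principal_part [set r | p%:R * r \is a Num.int] (slash k M f)]].

(* [c.1] and [c.2] are the coefficients [c_f^+] and [c_f^-]. *)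
Definition is_expansion (k : int) (f : uhp -> R[i])
    (c : (int -> R[i]) * (int -> R[i])) : Prop :=
  let fplus (tau : uhp) (n : int) : R[i] := c.1 n * e2pi (n%:~R * val tau) in
  let fminus (tau : uhp) (n : int) : R[i] :=
    c.2 n * (upper_gamma (1 - k%:~R) (4 * pi * `|n|%:~R * ycoord tau))%:C
    * e2pi (n%:~R * val tau) in
  [/\ exists N : int, forall n : int, n < N -> c.1 n = 0,
      forall n : int, 0 <= n -> c.2 n = 0
    & forall tau : uhp,
        [/\ cvgn (zseries (fplus tau)), cvgn (zseries (fminus tau))
          & f tau = zsum (fplus tau) + zsum (fminus tau)]].

(* The coefficients of the (unique) expansion of [f]. *)
Definition coefs (k : int) (f : uhp -> R[i]) :
    (int -> R[i]) * (int -> R[i]) :=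
  xget (fun=> 0, fun=> 0) [set c | is_expansion k f c].

Definition coef (k : int) (f : uhp -> R[i]) (n : int) (y : R) : R[i] :=
  (coefs k f).1 n
  + (coefs k f).2 n * (upper_gamma (1 - k%:~R) (4 * pi * `|n|%:~R * y))%:C.

Definition harmonic_forms_eps (p : nat) (k eps : int) :
    set (uhp -> R[i]^o) :=
  [set f | harmonic_forms p k f /\
    forall n : int, legendre (n%:~R : 'F_p) = - eps ->
      (coefs k f).1 n = 0 /\ (coefs k f).2 n = 0].

(* Pairs [(M, phi)]; [Mp2Z] singles out the elements of the metaplectic
   group. *)
Definition mp2 : Type := ('M[int]_2 * (uhp -> R[i]))%type.

Definition Mp2Z : set mp2 :=
  [set g | [/\ SL2Z g.1, holomorphic g.2
             & forall tau, g.2 tau ^+ 2 = autfac g.1 tau]].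

Definition mp2_one : mp2 := (1%:M, fun=> 1).

Definition mp2_mul (g h : mp2) : mp2 :=
  (g.1 *m h.1, fun tau => g.2 (mobius h.1 tau) * h.2 tau).

Definition mx2 (a b c d : int) : 'M[int]_2 :=
  \matrix_(i < 2, j < 2)
    if i == 0 then (if j == 0 then a else b) else (if j == 0 then c else d).

Definition mp2_T : mp2 := (mx2 1 1 0 1, fun=> 1).

(* [sqrtc] is the root with nonnegative real part, i.e. the principal one. *)
Definition mp2_S : mp2 := (mx2 0 (-1) 1 0, fun tau => sqrtc (val tau)).

Definition is_mp2_rep (n : nat) (rho : mp2 -> 'M[R[i]]_n) : Prop :=
  rho mp2_one = 1%:M /\
  forall g h : mp2, Mp2Z g -> Mp2Z h -> rho (mp2_mul g h) = rho g *m rho h.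

Definition conj_rep (n : nat) (rho : mp2 -> 'M[R[i]]_n) (g : mp2) :
  'M[R[i]]_n := map_mx (@conjc R) (rho g).

(* [E i] is the set of exponents allowed in the [i]-th component. *)
Definition vector_harmonic_forms (n : nat) (k : int)
    (rho : mp2 -> 'M[R[i]]_n) (E : 'I_n -> set rat) :
    set (uhp -> 'cV[R[i]]_n) :=
  [set F : uhp -> 'cV[R[i]]_n |
    [/\ forall i, smooth (fun tau => F tau i 0),
        forall g : mp2, Mp2Z g -> forall tau : uhp,
          F (mobius g.1 tau) = g.2 tau ^ (2 * k) *: (rho g *m F tau),
        forall i tau, Delta k (fun tau => F tau i 0) tau = 0
      & forall i, has_principal_part (E i) (fun tau => F tau i 0)]].

(* [r gamma] is the class mod p prescribed for the index [n] in the component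
   [F_gamma]. *)
Definition lift_form (p : nat) (k : int) (r : 'F_p -> 'F_p)
    (f : uhp -> R[i]^o) : uhp -> 'cV[R[i]]_((Zp_trunc (pdiv p)).+2) :=
  fun tau => \col_(gamma < (Zp_trunc (pdiv p)).+2)
    ((s_factor (gamma : 'F_p))%:R *
     zsum (fun n : int =>
       if n%:~R == r gamma then
         coef k f n (ycoord tau / p%:R) * e2pi (n%:~R / p%:R * val tau)
       else 0)).

End UpperHalfPlane.

Section Lattices.
Variables (V : vectType rat) (Q : V -> rat).

Definition bil (x y : V) : rat := Q (x + y) - Q x - Q y.

Definition quadratic_form : Prop :=
  [/\ forall (a : rat) (x : V), Q (a *: x) = a ^+ 2 * Q x,
      forall x y z : V, bil (x + y) z = bil x z + bil y z
    & forall (a : rat) (x y : V), bil (a *: x) y = a * bil x y].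

Definition nondegenerate_form : Prop :=
  forall x : V, (forall y : V, bil x y = 0) -> x = 0.

Definition has_signature (bp bm : nat) : Prop :=
  exists b : (\dim {:V}).-tuple V,
    [/\ basis_of {:V} b,
        forall i j : 'I_(\dim {:V}), i != j -> bil (tnth b i) (tnth b j) = 0,
        count (fun x => 0 < Q x) b = bp
      & count (fun x => Q x < 0) b = bm].

Definition is_lattice (L : set V) : Prop :=
  exists2 b : (\dim {:V}).-tuple V, basis_of {:V} b
    & forall x : V, L x <-> inIntSpan b x.

Definition even_lattice (L : set V) : Prop :=
  is_lattice L /\ forall x : V, L x -> Q x \is a Num.int.

Definition dual_lattice (L : set V) : set V :=
  [set x | forall y : V, L y -> bil x y \is a Num.int].

(* [iota] induces an isomorphism of L'/L onto Z/pZ; its values outside L' are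
   irrelevant. *)
Definition discriminant_iso (L : set V) (p : nat) (iota : V -> 'F_p) : Prop :=
  [/\ forall x y : V, dual_lattice L x -> dual_lattice L y ->
        iota (x + y) = iota x + iota y,
      forall x : V, dual_lattice L x -> (iota x = 0 <-> L x)
    & forall gamma : 'F_p, exists2 x : V, dual_lattice L x & iota x = gamma].

(* The exponent sets Z + Q(gamma) and Z - Q(gamma), for [gamma] in
   L'/L = Z/pZ. *)
Definition exponents (L : set V) (p : nat) (iota : V -> 'F_p)
    (gamma : 'F_p) : set rat :=
  [set r | exists x : V, [/\ dual_lattice L x, iota x = gamma
                           & r - Q x \is a Num.int]].

Definition dual_exponents (L : set V) (p : nat) (iota : V -> 'F_p)
    (gamma : 'F_p) : set rat :=
  [set r | exists x : V, [/\ dual_lattice L x, iota x = gamma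
                           & r + Q x \is a Num.int]].

(* [rho] is the Weil representation of L on C[L'/L], in the basis
   [delta_mx gamma 0] indexed by L'/L = Z/pZ through [iota]; these conditions
   determine [rho] on [Mp2Z], which is generated by T and S. *)
Definition is_weil_rep (R : realType) (L : set V) (bp bm p : nat)
    (iota : V -> 'F_p) (rho : mp2 R -> 'M[R[i]]_((Zp_trunc (pdiv p)).+2)) :
    Prop :=
  [/\ is_mp2_rep rho,
      forall x : V, dual_lattice L x ->
        rho (mp2_T R) *m delta_mx (iota x) (0 : 'I_1) =
          e2pi (ratr (Q x)) *: delta_mx (iota x) 0
    & forall x y : V, dual_lattice L x -> dual_lattice L y ->
        (rho (mp2_S R) *m delta_mx (iota x) (0 : 'I_1)) (iota y) 0 =
          e2pi ((bm%:R - bp%:R) / 8) / (Num.sqrt (p%:R : R))%:C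
          * e2pi (ratr (- bil x y))].

End Lattices.

(* Main.v *)
Require Import Defs.
From mathcomp Require Import all_boot all_order all_algebra.
From mathcomp Require Import complex.
From mathcomp Require Import all_classical all_reals all_analysis.
From mathcomp Require Import measurable_realfun.
From mathcomp Require Import ring lra zify.

(** The isomorphism is a finite Fourier transform. Averaging the translates
    [f ((tau + j) / p)] with the weights [e(- r j / p)] extracts the part of
    [f (tau / p)] whose exponents lie in the class [r] modulo [p]
    ([expansion_class]). The lift, which is defined by a series, is therefore a
    finite linear combination of translates of [f] ([lift_formE]); conversely
    [f (tau / p)] is half of the sum of the components of [F] ([descent]). Among
    the classes, those with [chi r = chi lambda] are represented twice by
    [lambda g ^ 2], the class [0] once and the others never, so that the factor
    [s] and the condition on the coefficients make the two constructions inverse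
    to each other ([descent_finite_lift], [finite_lift_descent]).

    Modularity rests on the functionals [theta_j v = \sum_g e(j Q(g)) v_g]. The
    matrices of [T] and [S] permute them, together with the coordinate [v_0] and
    up to scalars, like the points [j] and infinity of the projective line over
    [Z/pZ] ([theta_T], [theta_S], [theta_S0], [coord0_S]). The scalars are Gauss
    sums, known from two relations: [sigma * gauss = 1], a consequence of
    [T S T S T = S] in the metaplectic group ([sigma_gauss]), and
    [sigma ^ 2 * p = (- 1) ^ k], which expresses the congruence between weight
    and signature. It follows that the descent of [F] is modular on [Gamma_0(p)]
    ([descent_Gamma0]) and that at the cusps not equivalent to infinity it is a
    multiple of a translate of [F_0] ([descent_slash]). For the lift of [f], the
    law for [T] is clear; the defect of the law for [S] is killed by [theta_j]
    for [j != 0], and since it is even and some class is not represented, it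
    vanishes ([finite_lift_S]). The laws for [T] and [S] imply the law for the
    whole metaplectic group ([mp2_law_all]).

    Smoothness, the equation [Delta k f = 0] and principal parts pass to linear
    combinations of translates. What remains is that the coefficients of [f]
    exist and are determined by [f]. For the existence ([harmonic_expansion]),
    the Fourier coefficients of [f] along horizontal lines satisfy a second order
    differential equation with an explicit first integral ([line_coef_ode],
    [ode_first_integral]), and the growth of [f] selects the solutions that may
    occur ([line_coef_shape]); the Fourier series of a differentiable periodic
    function converges to it by an elementary telescoping argument
    ([fourier_pointwise]). For the uniqueness ([class_proj0_coef]), convergence
    at one height forces geometric decay of the terms higher up
    ([expansion_bound]), so that a vanishing series has vanishing terms
    ([trig_series_eq0]), and the incomplete Gamma function is not constant. *)

Import Order.TTheory GRing.Theory Num.Theory.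
Import numFieldNormedType.Exports.
Local Open Scope classical_set_scope.
Local Open Scope complex_scope.
Local Open Scope ring_scope.
Set Implicit Arguments.
Unset Strict Implicit.
Unset Printing Implicit Defensive.

(** * The complex exponential and the upper half plane *)


Section ComplexExp.
Variable R : realType.
Implicit Types (z w : R[i]) (tau : uhp R).

Lemma complex_eqP z w :
  complex.Re z = complex.Re w -> complex.Im z = complex.Im w -> z = w.
Proof. by case: z w => [a b] [c d] /= -> ->. Qed.

Lemma ReDc z w : complex.Re (z + w) = complex.Re z + complex.Re w.
Proof. by case: z w => [a b] [c d]. Qed.
Lemma ImDc z w : complex.Im (z + w) = complex.Im z + complex.Im w.
Proof. by case: z w => [a b] [c d]. Qed.
Lemma ReNc z : complex.Re (- z) = - complex.Re z.
Proof. by case: z => [a b]. Qed.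
Lemma ImNc z : complex.Im (- z) = - complex.Im z.
Proof. by case: z => [a b]. Qed.
Lemma ReMc z w : complex.Re (z * w) =
  complex.Re z * complex.Re w - complex.Im z * complex.Im w.
Proof. by case: z w => [a b] [c d]. Qed.
Lemma ImMc z w : complex.Im (z * w) =
  complex.Re z * complex.Im w + complex.Im z * complex.Re w.
Proof. by case: z w => [a b] [c d]. Qed.

Lemma cRe_conj z : complex.Re (conjc z) = complex.Re z.
Proof. by case: z. Qed.
Lemma cIm_conj z : complex.Im (conjc z) = - complex.Im z.
Proof. by case: z. Qed.
Lemma ReC (x y : R) : complex.Re (x +i* y) = x. Proof. by []. Qed.
Lemma ImC (x y : R) : complex.Im (x +i* y) = y. Proof. by []. Qed.
Lemma ReR (x : R) : complex.Re x%:C = x. Proof. by []. Qed.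
Lemma ImR (x : R) : complex.Im x%:C = 0. Proof. by []. Qed.
Lemma Renat (n : nat) : complex.Re (n%:R : R[i]) = n%:R.
Proof. by rewrite -(rmorph_nat (real_complex R)). Qed.
Lemma Imnat (n : nat) : complex.Im (n%:R : R[i]) = 0.
Proof. by rewrite -(rmorph_nat (real_complex R)). Qed.
Lemma Reint (n : int) : complex.Re (n%:~R : R[i]) = n%:~R.
Proof. by rewrite -(rmorph_int (real_complex R)). Qed.
Lemma Imint (n : int) : complex.Im (n%:~R : R[i]) = 0.
Proof. by rewrite -(rmorph_int (real_complex R)). Qed.

Definition reimE := (cRe_conj, cIm_conj, ReDc, ImDc, ReNc, ImNc, ReMc, ImMc,
  Renat, Imnat, Reint, Imint, ReR, ImR, ReC, ImC).

Lemma cexpD z w : cexp (z + w) = cexp z * cexp w.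
Proof.
rewrite /cexp !reimE expRD cosD sinD.
by apply: complex_eqP; rewrite !reimE; ring.
Qed.

Lemma cexp0 : cexp (0 : R[i]) = 1.
Proof. by rewrite /cexp /= expR0 cos0 sin0; apply: complex_eqP; rewrite !reimE; ring. Qed.

Lemma norm_cexp z : `|cexp z| = (expR (complex.Re z))%:C.
Proof.
rewrite /cexp normc_def !reimE !mul0r subr0 addr0 !exprMn -mulrDr cos2Dsin2 mulr1.
by rewrite sqrtr_sqr ger0_norm ?expR_ge0.
Qed.

Lemma e2piD z w : e2pi (z + w) = e2pi z * e2pi w.
Proof. by rewrite /e2pi mulrDr cexpD. Qed.

Lemma e2pi0 : e2pi (0 : R[i]) = 1.
Proof. by rewrite /e2pi mulr0 cexp0. Qed.

Lemma e2pi1 : e2pi (1 : R[i]) = 1.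
Proof.
rewrite /e2pi mulr1 /cexp /= expR0.
by rewrite mulr_natl cos2pi sin2pi; apply: complex_eqP; rewrite !reimE; ring.
Qed.

Lemma norm_e2pi z : `|e2pi z| = (expR (- (2 * pi * complex.Im z)))%:C.
Proof. by rewrite /e2pi norm_cexp reimE /= mul0r sub0r. Qed.

Lemma e2pi_neq0 z : e2pi z != 0.
Proof. by rewrite -normr_eq0 norm_e2pi fmorph_eq0 gt_eqF ?expR_gt0. Qed.

Lemma e2piN z : e2pi (- z) = (e2pi z)^-1.
Proof.
by apply: (mulIf (e2pi_neq0 z)); rewrite -e2piD addNr e2pi0 mulVf ?e2pi_neq0.
Qed.

Lemma e2piMn z n : e2pi (n%:R * z) = e2pi z ^+ n.
Proof.
elim: n => [|n IH]; first by rewrite mul0r e2pi0.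
by rewrite -addn1 natrD mulrDl mul1r e2piD IH addn1 exprSr.
Qed.

Lemma e2piMz z (n : int) : e2pi (n%:~R * z) = e2pi z ^ n.
Proof.
case: n => n; first by rewrite -exprnP -e2piMn.
by rewrite NegzE mulrNz mulNr e2piN -exprnN -e2piMn.
Qed.

Lemma e2pi_int (n : int) : e2pi (n%:~R : R[i]) = 1.
Proof. by rewrite -[_%:~R]mulr1 e2piMz e2pi1 exp1rz. Qed.

Lemma e2pi_ratint (x : rat) : x \is a Num.int -> e2pi (ratr x : R[i]) = 1.
Proof. by move=> /intrP [n ->]; rewrite ratr_int e2pi_int. Qed.

Lemma e2pi_conj z : conjc (e2pi z) = e2pi (- conjc z).
Proof.
rewrite /e2pi /cexp; apply: complex_eqP; rewrite !reimE ?mul0r ?sub0r ?subr0;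
  rewrite ?add0r ?addr0 ?mulrN ?opprK ?cosN ?sinN.
  by [].
by rewrite mulrN.
Qed.

Lemma e2pi_real (x : R) :
  e2pi x%:C = cos (2 * pi * x) +i* sin (2 * pi * x).
Proof.
rewrite /e2pi /cexp !reimE mulr0 !mul0r subr0 add0r expR0.
by rewrite mul1r.
Qed.

End ComplexExp.

Section UpperHalfPlaneGeometry.
Variable R : realType.
Implicit Types (tau : uhp R) (M N : 'M[int]_2) (z : R[i]).

Lemma uhpP tau tau' : val tau = val tau' -> tau = tau'.
Proof. exact: val_inj. Qed.

Lemma ycoord_gt0 tau : 0 < ycoord tau. Proof. exact: (valP tau). Qed.

Lemma val_uhp tau : val tau = xcoord tau +i* ycoord tau.
Proof. by apply: complex_eqP. Qed.

Lemma to_uhpK z : 0 < complex.Im z -> val (to_uhp z) = z.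
Proof. by move=> z0; rewrite /to_uhp insubdK. Qed.

Lemma uhp_neq0 tau : val tau != 0.
Proof.
apply/eqP => e; have := ycoord_gt0 tau.
by rewrite /ycoord e ltxx.
Qed.

Definition uaff (a b : R) tau : uhp R := to_uhp (a%:C * val tau + b%:C).

Lemma val_uaff a b tau : 0 < a -> val (uaff a b tau) = a%:C * val tau + b%:C.
Proof.
move=> a0; apply: to_uhpK; rewrite !reimE mul0r addr0.
by rewrite addr0 mulr_gt0 // ycoord_gt0.
Qed.

Lemma xcoord_uaff a b tau : 0 < a -> xcoord (uaff a b tau) = a * xcoord tau + b.
Proof. by move=> a0; rewrite /xcoord val_uaff // !reimE mul0r subr0. Qed.

Lemma ycoord_uaff a b tau : 0 < a -> ycoord (uaff a b tau) = a * ycoord tau.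
Proof. by move=> a0; rewrite /ycoord val_uaff // !reimE mul0r !addr0. Qed.

Lemma uaff_comp a b c d tau : 0 < a -> 0 < c ->
  uaff a b (uaff c d tau) = uaff (a * c) (a * d + b) tau.
Proof.
move=> a0 c0; apply: uhpP; rewrite !val_uaff ?mulr_gt0 //.
by rewrite rmorphD !rmorphM /=; ring.
Qed.

Lemma uaff10 tau : uaff 1 0 tau = tau.
Proof. by apply: uhpP; rewrite val_uaff ?ltr01 // mul1r addr0. Qed.

Lemma det2 M : \det M = M 0 0 * M 1 1 - M 0 1 * M 1 0.
Proof.
rewrite (expand_det_row _ 0) !big_ord_recl big_ord0 addr0.
rewrite /cofactor !det_mx11 !mxE /= expr0 mul1r expr1 mulN1r mulrN.
by congr (M _ _ * M _ _ - M _ _ * M _ _); exact/val_inj.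
Qed.

Lemma mulmx2 M N i j : (M *m N) i j = M i 0 * N 0 j + M i 1 * N 1 j.
Proof.
rewrite mxE !big_ord_recl big_ord0 addr0.
by congr (_ + M i _ * N _ j); exact/val_inj.
Qed.

Lemma eq_mx2 M N : M 0 0 = N 0 0 -> M 0 1 = N 0 1 -> M 1 0 = N 1 0 ->
  M 1 1 = N 1 1 -> M = N.
Proof.
move=> h00 h01 h10 h11; apply/matrixP => i j.
have o (l : 'I_2) : l = 0 \/ l = 1.
  by case: l => -[|[|//]] h; [left|right]; exact/val_inj.
by case: (o i) => ->; case: (o j) => ->.
Qed.

Lemma mx2E a b c d : (mx2 a b c d 0 0 = a) * (mx2 a b c d 0 1 = b) *
  (mx2 a b c d 1 0 = c) * (mx2 a b c d 1 1 = d).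
Proof. by do !split; rewrite mxE. Qed.

Lemma Im_autfac M tau : complex.Im (autfac M tau) = (M 1 0)%:~R * ycoord tau.
Proof. by rewrite /autfac !reimE mul0r addr0 addr0. Qed.

Lemma Re_autfac M tau :
  complex.Re (autfac M tau) = (M 1 0)%:~R * xcoord tau + (M 1 1)%:~R.
Proof. by rewrite /autfac !reimE mul0r subr0. Qed.

Lemma autfac_neq0 M tau : SL2Z M -> autfac M tau != 0.
Proof.
move=> hM; apply/eqP => e.
have /eqP := congr1 (@complex.Im R) e; rewrite Im_autfac /= mulf_eq0.
rewrite (gt_eqF (ycoord_gt0 tau)) orbF intr_eq0 => /eqP c0.
have := congr1 (@complex.Re R) e; rewrite Re_autfac c0 mul0r add0r /=.
move=> /eqP; rewrite intr_eq0 => /eqP d0.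
by move: hM; rewrite /SL2Z /= det2 c0 d0 !mulr0 subr0.
Qed.

Lemma val_mobius M tau : SL2Z M -> val (mobius M tau) =
  ((M 0 0)%:~R * val tau + (M 0 1)%:~R) / autfac M tau.
Proof.
move=> hM; rewrite /mobius insubdK // -topredE /=.
set A := _ + _; set B := autfac M tau.
have B0 : B != 0 by exact: autfac_neq0.
have n0 : 0 < complex.Re B ^+ 2 + complex.Im B ^+ 2.
  rewrite lt_neqAle eq_sym addr_ge0 ?sqr_ge0 // andbT.
  apply: contraNneq B0 => /eqP; rewrite paddr_eq0 ?sqr_ge0 // !sqrf_eq0.
  by move=> /andP [/eqP h1 /eqP h2]; apply/eqP/complex_eqP.
have -> : B^-1 = (complex.Re B / (complex.Re B ^+ 2 + complex.Im B ^+ 2)) -i*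
    (complex.Im B / (complex.Re B ^+ 2 + complex.Im B ^+ 2)) by case: (B).
rewrite ImMc ReC ImC mulrN addrC mulrA mulrA -mulrBl divr_gt0 //.
(* The numerator of the imaginary part is [y] times the determinant. *)
rewrite Re_autfac Im_autfac /A !reimE !mul0r !addr0 subr0.
move: hM; rewrite /SL2Z /= det2 => /(congr1 (fun n : int => n%:~R : R)).
rewrite rmorphB !rmorphM /= => hM.
have y0 := ycoord_gt0 tau; rewrite -/(xcoord tau) -/(ycoord tau).
set x := xcoord tau in hM *; set y := ycoord tau in hM y0 *.
rewrite (_ : _ - _ = y); first exact: y0.
transitivity (y * 1%:~R); last by rewrite mulr1.
by rewrite -hM; ring.
Qed.

Lemma SL2ZM M N : SL2Z M -> SL2Z N -> SL2Z (M *m N).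
Proof. by rewrite /SL2Z /= det_mulmx => -> ->. Qed.

Lemma autfacM M N tau : SL2Z M -> SL2Z N ->
  autfac (M *m N) tau = autfac M (mobius N tau) * autfac N tau.
Proof.
move=> hM hN; rewrite {2}/autfac val_mobius // mulrDl mulrA divfK ?autfac_neq0 //.
by rewrite /autfac !mulmx2 !rmorphD !rmorphM /=; ring.
Qed.

Lemma mobiusM M N tau : SL2Z M -> SL2Z N ->
  mobius (M *m N) tau = mobius M (mobius N tau).
Proof.
move=> hM hN; apply: uhpP; rewrite !val_mobius //; last exact: SL2ZM.
have nN := autfac_neq0 tau hN; have nM := autfac_neq0 (mobius N tau) hM.
have -> : ((M *m N) 0 0)%:~R * \val tau + ((M *m N) 0 1)%:~R =
  (M 0 0)%:~R * ((N 0 0)%:~R * \val tau + (N 0 1)%:~R) +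
  (M 0 1)%:~R * autfac N tau.
  by rewrite /autfac !mulmx2 !rmorphD !rmorphM /=; ring.
by rewrite autfacM //; field; rewrite nN nM.
Qed.

Lemma SL2Z1 : SL2Z 1%:M. Proof. by rewrite /SL2Z /= det1. Qed.

Lemma autfac1 tau : autfac 1%:M tau = 1.
Proof. by rewrite /autfac !mxE /= mul0r add0r. Qed.

Lemma mobius1 tau : mobius 1%:M tau = tau.
Proof.
apply: uhpP; rewrite val_mobius; last exact: SL2Z1.
by rewrite autfac1 !mxE mul1r addr0 divr1.
Qed.

Definition mT : 'M[int]_2 := mx2 1 1 0 1.
Definition mS : 'M[int]_2 := mx2 0 (-1) 1 0.
Definition mTi : 'M[int]_2 := mx2 1 (-1) 0 1.

Lemma SL2Z_T : SL2Z mT. Proof. by rewrite /SL2Z /= det2 !mx2E. Qed.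
Lemma SL2Z_S : SL2Z mS. Proof. by rewrite /SL2Z /= det2 !mx2E. Qed.
Lemma SL2Z_Ti : SL2Z mTi. Proof. by rewrite /SL2Z /= det2 !mx2E. Qed.

Lemma autfac_T tau : autfac mT tau = 1.
Proof. by rewrite /autfac !mx2E mul0r add0r. Qed.
Lemma autfac_S tau : autfac mS tau = val tau.
Proof. by rewrite /autfac !mx2E mul1r addr0. Qed.

Lemma mobius_T tau : mobius mT tau = uaff 1 1 tau.
Proof.
apply: uhpP; rewrite val_mobius; last exact: SL2Z_T.
rewrite autfac_T val_uaff ?ltr01 //.
by rewrite !mx2E divr1.
Qed.

Lemma val_mobius_S tau : val (mobius mS tau) = - (val tau)^-1.
Proof.
by rewrite val_mobius; [rewrite autfac_S !mx2E mul0r add0r mulN1r|exact: SL2Z_S].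
Qed.

End UpperHalfPlaneGeometry.

(** * The modular group and the metaplectic group *)


Section ComplexLimits.
Variable R : realType.
Implicit Types z w : R[i].

Lemma normc_ge_Im z : `|complex.Im z|%:C <= `|z|.
Proof.
have := normc_ge_Re (z * 'i); rewrite ReiNIm normrN normrM.
by rewrite [`|'i%C|]normc_def /= expr0n /= add0r expr1n sqrtr1 mulr1.
Qed.

Lemma normc_le_ReIm z : `|z| <= (`|complex.Re z| + `|complex.Im z|)%:C.
Proof.
rewrite [z in leLHS]complexE rmorphD /=; apply: (le_trans (ler_normD _ _)).
rewrite normrM [`|'i%C|]normc_def /= expr0n /= add0r expr1n sqrtr1 mul1r.
by rewrite !normc_def /= !expr0n /= !addr0 !sqrtr_sqr.
Qed.

Lemma gt0_complexP (e : R[i]) : 0 < e -> exists2 r : R, 0 < r & e = r%:C.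
Proof.
case: e => a b; rewrite ltcE /= => /andP [/eqP -> a0].
by exists a.
Qed.

Lemma cvgC_ReIm (T : Type) (F : set_system T) {FF : Filter F}
    (f : T -> R[i]^o) (l : R[i]^o) :
  (fun t => complex.Re (f t)) @ F --> complex.Re l ->
  (fun t => complex.Im (f t)) @ F --> complex.Im l -> f @ F --> l.
Proof.
move=> hr hi; apply/cvgrPdist_lt => e /gt0_complexP [r r0 ->].
have r2 : 0 < r / 2 by rewrite divr_gt0.
move/cvgrPdist_lt/(_ _ r2) : hr => hr.
move/cvgrPdist_lt/(_ _ r2) : hi => hi.
near=> t; apply: (le_lt_trans (normc_le_ReIm _)).
rewrite ltcR [ltRHS]splitr !reimE.
by apply: ltrD; [near: t; exact: hr|near: t; exact: hi].
Unshelve. all: by end_near. Qed.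

Lemma cvgC_Re (T : Type) (F : set_system T) {FF : Filter F}
    (f : T -> R[i]^o) (l : R[i]^o) :
  f @ F --> l -> (fun t => complex.Re (f t)) @ F --> complex.Re l.
Proof.
move=> h; apply/cvgrPdist_lt => e e0.
move/cvgrPdist_lt/(_ e%:C) : h; rewrite ltcR => /(_ e0) h.
near=> t; rewrite -ltcR -ReNc -ReDc; apply: (le_lt_trans (normc_ge_Re _)).
by near: t; exact: h.
Unshelve. all: by end_near. Qed.

Lemma cvgC_Im (T : Type) (F : set_system T) {FF : Filter F}
    (f : T -> R[i]^o) (l : R[i]^o) :
  f @ F --> l -> (fun t => complex.Im (f t)) @ F --> complex.Im l.
Proof.
move=> h; apply/cvgrPdist_lt => e e0.
move/cvgrPdist_lt/(_ e%:C) : h; rewrite ltcR => /(_ e0) h.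
near=> t; rewrite -ltcR -ImNc -ImDc; apply: (le_lt_trans (normc_ge_Im _)).
by near: t; exact: h.
Unshelve. all: by end_near. Qed.

Lemma near_uhp (tau : uhp R) :
  \forall z \near (val tau : R[i]^o), 0 < complex.Im (z : R[i]).
Proof.
have h0 : Filter (nbhs (val tau : R[i]^o)) by exact: nbhs_filter.
have := cvgC_Im (FF := h0) (@cvg_id _ (nbhs (val tau : R[i]^o))).
move/cvgrPdist_lt/(_ _ (ycoord_gt0 tau)).
apply: filterS => z; rewrite -/(ycoord tau) => h.
by have := le_lt_trans (ler_norm _) h; rewrite ltrBlDr ltrDl.
Qed.

End ComplexLimits.

Section Generation.

(** Euclid's algorithm on the first column: [S T^(-q)] replaces [|c|] by the
    remainder of [a] modulo [c]. *)
Lemma SL2Z_ind (P : 'M[int]_2 -> Prop) :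
  P mT -> P mTi -> P mS ->
  (forall M N, SL2Z M -> SL2Z N -> P M -> P N -> P (M *m N)) ->
  forall M, SL2Z M -> P M.
Proof.
move=> PT PTi PS PM.
pose Tn (n : int) : 'M[int]_2 := mx2 1 n 0 1.
have sTn n : SL2Z (Tn n) by rewrite /SL2Z /= det2 !mx2E mulr0 subr0.
have sS := SL2Z_S.
have SS : mS *m mS = mx2 (-1) 0 0 (-1).
  by apply: eq_mx2; rewrite !mulmx2 !mx2E.
have sSS : SL2Z (mS *m mS) by exact: SL2ZM.
have PSS : P (mS *m mS) by exact: PM.
have PSSS : P (mS *m mS *m mS) by exact: PM.
have P1 : P (Tn 0).
  have -> : Tn 0 = mS *m mS *m (mS *m mS).
    by rewrite SS; apply: eq_mx2; rewrite !mulmx2 !mx2E.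
  exact: PM.
have PTn n : P (Tn n).
  case: n => n.
    elim: n => [//|n IH].
    have -> : Tn n.+1 = mT *m Tn n.
      by apply: eq_mx2; rewrite !mulmx2 !mx2E; lia.
    by apply: PM => //; exact: SL2Z_T.
  elim: n => [|n IH]; first exact: PTi.
  have -> : Tn (Negz n.+1) = mTi *m Tn (Negz n).
    by apply: eq_mx2; rewrite !mulmx2 !mx2E; lia.
  by apply: PM => //; exact: SL2Z_Ti.
move=> M; have [n] := ubnP `|M 1%R 0%R|%N; elim: n M => // n IH M Mn sM.
have dM : M 0 0 * M 1 1 - M 0 1 * M 1 0 = 1 by rewrite -det2.
case: (eqVneq (M 1 0) 0) => [c0|c0].
  move: dM; rewrite c0 mulr0 subr0 => ad.
  have [[a1 d1]|[a1 d1]] : (M 0 0 = 1 /\ M 1 1 = 1) \/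
      (M 0 0 = -1 /\ M 1 1 = -1).
  - have : (`|M 0%R 0%R| * `|M 1%R 1%R|)%N = 1%N by rewrite -abszM ad.
    by move/eqP; rewrite muln_eq1 => /andP [/eqP h1 /eqP h2]; nia.
  - rewrite (_ : M = Tn (M 0 1)) //.
    by apply: eq_mx2; rewrite !mx2E.
  rewrite (_ : M = mS *m mS *m Tn (- M 0 1)); first exact: PM.
  by rewrite SS; apply: eq_mx2; rewrite !mulmx2 !mx2E ?a1 ?d1 ?c0; lia.
pose q := (M 0%R 0%R %/ M 1%R 0%R)%Z; pose r := (M 0%R 0%R %% M 1%R 0%R)%Z.
have aqr : M 0 0 = q * M 1 0 + r by exact: divz_eq.
have r0 : 0 <= r by exact: modz_ge0.
have rc : (`|r| < `|M 1%R 0%R|)%N.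
  have := @ltz_mod (M 0 0) _ c0; rewrite -/r; lia.
pose N := mS *m (Tn (- q) *m M).
have sN : SL2Z N by apply: SL2ZM => //; exact: SL2ZM.
have N10 : N 1 0 = r by rewrite /N !mulmx2 !mx2E aqr; ring.
have PN : P N by apply: IH => //; rewrite N10; lia.
have -> : M = Tn q *m (mS *m mS *m mS *m N).
  rewrite /N mulmxA !mulmxA.
  have -> : Tn q *m mS *m mS *m mS *m mS *m Tn (- q) = 1%:M.
    by apply: eq_mx2; rewrite !mulmx2 !mx2E !mxE //=; ring.
  by rewrite mul1mx.
by apply: (PM) => //; [do 2!apply: SL2ZM => //|apply: PM => //; exact: SL2ZM].
Qed.

End Generation.

Section DerivableRoot.
Variable K : numFieldType.

(** Caratheodory's criterion, applied to the quotient
    [(s z - s a) / (z - a) = 1 / (s z + s a)]. *)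
Lemma derivable_sqrt (s : K^o -> K^o) (a : K^o) :
  {for a, continuous s} -> s a + s a != 0 ->
  (\forall z \near a, s z ^+ 2 = z) -> derivable s a 1.
Proof.
move=> sc s2 hs; apply/cvg_ex; exists ((s a + s a)^-1 : K^o).
have sa : s a ^+ 2 = a by exact: nbhs_singleton hs.
have sh : (h + a : K^o) @[h --> (0 : K^o)] --> a.
  have := cvgD (@cvg_id _ (nbhs (0 : K^o))) (@cvg_cst _ a _ (nbhs (0 : K^o)) _).
  by rewrite add0r; exact.
have lim0 : (s (h + a) + s a : K^o) @[h --> (0 : K^o)^'] --> (s a + s a : K^o).
  apply: cvgD; last exact: cvg_cst.
  have h := cvg_comp _ _ sh sc.
  exact: (cvg_trans (cvg_fmap2 (@cvg_within _ _ _ _)) h).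
have lim : ((s (h + a) + s a)^-1 : K^o) @[h --> (0 : K^o)^'] --> ((s a + s a)^-1 : K^o).
  exact: cvgV.
apply: cvg_trans lim; apply: near_eq_cvg.
have n1 : \forall h \near (0 : K^o)^', s (h + a) ^+ 2 = h + a.
  by apply: cvg_within; exact: (sh _ hs).
have n2 : \forall h \near (0 : K^o)^', h != 0 by exact: nbhs_dnbhs_neq.
have n3 : \forall h \near (0 : K^o)^', s (h + a) + s a != 0.
  exact: (cvgr_neq0 _ lim0 s2).
near=> h.
have h1 : s (h + a) ^+ 2 = h + a by near: h.
have h2 : h != 0 by near: h.
have h3 : s (h + a) + s a != 0 by near: h.
rewrite /= [h%:A](_ : _ = h); last by rewrite -mulr_algl mulr1 scaler1.
apply: (mulfI h3); rewrite mulfV // -scalerAr mulrC -subr_sqr h1 sa addrK.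
by rewrite [RHS]mulVf.
Unshelve. all: by end_near. Qed.

Lemma derivable_homography (phi : K^o -> K^o) (a b c d w : K) :
  c * w + d != 0 -> derivable phi ((a * w + b) / (c * w + d) : K^o) 1 ->
  derivable (fun z : K^o => phi ((a * z + b) / (c * z + d))) (w : K^o) 1.
Proof.
move=> cd dphi.
have dlin (u v : K^o) : derivable (fun z : K^o => u * z + v : K^o) (w : K^o) 1.
  by apply: derivableD => //; apply: derivableM.
have dm : derivable (fun z : K^o => (a * z + b) / (c * z + d) : K^o) (w : K^o) 1.
  apply: derivableM; first exact: dlin.
  by apply: derivableV; [exact: cd|exact: dlin].
apply/derivable1_diffP/(@differentiable_comp _ _ _ _ _ phi).
  exact/derivable1_diffP.
by apply/derivable1_diffP.
Qed.

Lemma derivable_prod (f g : K^o -> K^o) (a : K^o) :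
  derivable f a 1 -> derivable g a 1 -> derivable (fun z => f z * g z : K^o) a 1.
Proof. exact: derivableM. Qed.

Lemma derivable_continuous (f : K^o -> K^o) (a : K^o) :
  derivable f a 1 -> {for a, continuous f}.
Proof. by move=> /derivable1_diffP /differentiable_continuous. Qed.

Lemma cvg_quot (T : Type) (F : set_system T) {FF : Filter F} (f g : K^o -> K^o)
    (u : T -> K^o) (a : K^o) : u @ F --> a -> derivable f a 1 ->
  derivable g a 1 -> g a != 0 -> (f (u t) / g (u t) : K^o) @[t --> F] --> (f a / g a : K^o).
Proof.
move=> ua /derivable_continuous fa /derivable_continuous ga g0.
apply: cvgM; first exact: (cvg_comp _ _ ua fa).
by apply: cvgV => //; exact: (cvg_comp _ _ ua ga).
Qed.

End DerivableRoot.

Section Metaplectic.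
Variable R : realType.
Implicit Types (tau : uhp R) (M N : 'M[int]_2) (z w : R[i]).

Lemma sqrtc_uhp z : 0 < complex.Im z ->
  0 < complex.Re (sqrtc z) /\ 0 < complex.Im (sqrtc z).
Proof.
move=> z0; have := congr1 (@complex.Im R) (sqr_sqrtc z).
have : 0 <= complex.Re (sqrtc z) by case: (z) => a b; rewrite /sqrtc /= sqrtr_ge0.
rewrite expr2 ImMc; set a := complex.Re _; set b := complex.Im (sqrtc z).
rewrite [b * a]mulrC => a0 e.
have ab : 0 < a * b by rewrite -e in z0; lra.
have a1 : 0 < a.
  by rewrite lt_neqAle a0 andbT; apply: contraTneq ab => <-; rewrite mul0r ltxx.
by split => //; rewrite -(pmulr_rgt0 _ a1).
Qed.

(** Of the two square roots of a number, at most one lies in the open upper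
    half plane; this fixes the signs in the relations between the
    generators. *)
Lemma sqr_uhp_inj z w : 0 < complex.Im z -> 0 < complex.Im w ->
  z ^+ 2 = w ^+ 2 -> z = w.
Proof.
move=> z0 w0 /eqP; rewrite eqf_sqr => /orP [/eqP //|/eqP e].
by move: z0; rewrite e ImNc oppr_gt0 ltNge (ltW w0).
Qed.

Lemma sqrtcM_uhp z w : 0 < complex.Im z -> 0 < complex.Im w ->
  0 < complex.Im (sqrtc z * sqrtc w).
Proof.
move=> /sqrtc_uhp [a0 b0] /sqrtc_uhp [c0 d0].
by rewrite ImMc addr_gt0 // mulr_gt0.
Qed.

(** From [(s + sqrt z) (s - sqrt z) = tau - z], with [s = sqrt tau] and
    [Im s <= |s + sqrt z|]. *)
Lemma continuous_sqrtc tau :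
  (fun z : R[i]^o => sqrtc z : R[i]^o) @ (val tau : R[i]^o) --> (sqrtc (val tau) : R[i]^o).
Proof.
have FF : Filter (nbhs (val tau : R[i]^o)) by exact: nbhs_filter.
have [_ m0] := sqrtc_uhp (valP tau); set s := sqrtc (val tau) in m0.
apply/cvgrPdist_lt => e e0.
have me0 : 0 < (complex.Im s)%:C * e by rewrite mulr_gt0 // ltcR.
have : \forall z \near (val tau : R[i]^o), `|(val tau : R[i]^o) - z| < (complex.Im s)%:C * e.
  by move/cvgrPdist_lt : (@cvg_id _ (nbhs (val tau : R[i]^o))); exact.
have := near_uhp tau; apply: filterS2 => z hz h.
have [_ n0] := sqrtc_uhp hz.
have hs : (complex.Im s)%:C <= `|s + sqrtc z|.
  apply: le_trans (normc_ge_Im _); rewrite lecR ImDc.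
  by rewrite gtr0_norm ?addr_gt0 // lerDl ltW.
have sp : 0 < `|s + sqrtc z| by apply: lt_le_trans hs; rewrite ltcR.
rewrite -(ltr_pM2l sp) -normrM mulrC -subr_sqr !sqr_sqrtc.
by apply: (lt_le_trans h); rewrite ler_wpM2r // ltW.
Qed.

Lemma holomorphic_sqrtc : holomorphic (fun tau : uhp R => sqrtc (val tau)).
Proof.
move=> tau; have := near_uhp tau => hn.
have e : forall z : R[i], 0 < complex.Im z ->
    ((fun tau : uhp R => sqrtc (val tau)) \o @to_uhp R) z = sqrtc z.
  by move=> z z0 /=; rewrite to_uhpK.
have [_ m0] := sqrtc_uhp (valP tau).
apply: (@near_eq_derivable R[i] R[i]^o R[i]^o (fun z => sqrtc z)).
  by apply: filterS hn => z /e ->.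
apply: derivable_sqrt; first exact: continuous_sqrtc.
  by apply/eqP => /(congr1 (@complex.Im R)); rewrite ImDc /=; lra.
by apply: filterS hn => z _; rewrite sqr_sqrtc.
Qed.

Lemma Mp2Z_S : Mp2Z (mp2_S R).
Proof.
split; first exact: SL2Z_S; first exact: holomorphic_sqrtc.
by move=> tau; rewrite sqr_sqrtc autfac_S.
Qed.

Lemma holomorphic_cst (c : R[i]) : holomorphic (fun _ : uhp R => c).
Proof. by move=> tau; exact: derivable_cst. Qed.

Lemma Mp2Z_T : Mp2Z (mp2_T R).
Proof.
split; first exact: SL2Z_T; first exact: holomorphic_cst.
by move=> tau; rewrite expr1n autfac_T.
Qed.

Definition mp2_Ti : mp2 R := (mTi, fun=> 1).

Lemma Mp2Z_Ti : Mp2Z mp2_Ti.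
Proof.
split; first exact: SL2Z_Ti; first exact: holomorphic_cst.
by move=> tau; rewrite expr1n /autfac !mx2E mul0r add0r.
Qed.

Lemma holomorphic_mobius M (phi : uhp R -> R[i]) : SL2Z M ->
  holomorphic phi -> holomorphic (phi \o mobius M).
Proof.
move=> sM hphi tau; have hn := near_uhp tau.
apply: (@near_eq_derivable R[i] R[i]^o R[i]^o (fun z => phi (to_uhp
  (((M 0 0)%:~R * z + (M 0 1)%:~R) / ((M 1 0)%:~R * z + (M 1 1)%:~R))))).
  apply: filterS hn => z hz /=.
  congr (phi _); apply: uhpP; rewrite val_mobius // /autfac to_uhpK //.
  rewrite to_uhpK //.
  have := ycoord_gt0 (mobius M (to_uhp z)).
  by rewrite /ycoord (val_mobius (to_uhp z) sM) /autfac to_uhpK.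
apply: (@derivable_homography R[i] (phi \o @to_uhp R)); first exact: autfac_neq0.
by rewrite -[_ / _](val_mobius tau sM); exact: hphi.
Qed.

Lemma mp2_mulZ (g h : mp2 R) : Mp2Z g -> Mp2Z h -> Mp2Z (mp2_mul g h).
Proof.
case: g h => [M phi] [N psi] [/= sM hphi ephi] [/= sN hpsi epsi]; split => /=.
- exact: SL2ZM.
- move=> tau; apply: (@derivable_prod R[i] ((phi \o mobius N) \o @to_uhp R) (psi \o @to_uhp R)); last exact: hpsi.
  exact (@holomorphic_mobius N phi sN hphi tau).
- by move=> tau; rewrite exprMn ephi epsi autfacM.
Qed.

(** Two square roots of a nowhere vanishing function differ by a continuous
    function to [{1, -1}], hence by a constant sign: it cannot change along a
    segment, by the intermediate value theorem. *)
Lemma Mp2Z_sign M (phi psi : uhp R -> R[i]) :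
  Mp2Z (M, phi) -> Mp2Z (M, psi) -> psi = phi \/ psi = (fun tau => - phi tau).
Proof.
move=> [/= sM hphi ephi] [/= _ hpsi epsi].
have phi0 tau : phi tau != 0.
  by rewrite -sqrf_eq0 ephi autfac_neq0.
have q2 tau : psi tau = phi tau \/ psi tau = - phi tau.
  have /eqP : psi tau ^+ 2 = phi tau ^+ 2 by rewrite ephi epsi.
  by rewrite eqf_sqr => /orP [/eqP|/eqP]; [left|right].
have cst tau tau' : psi tau = phi tau -> psi tau' = phi tau'.
  move=> h; case: (q2 tau') => // h'; exfalso.
  pose g (t : R) : R[i]^o := val tau + t%:C * (val tau' - val tau).
  have g_im t : 0 <= t <= 1 -> 0 < complex.Im (g t).
    move=> /andP [t0 t1]; rewrite /g !reimE mul0r addr0.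
    rewrite -/(ycoord tau) -/(ycoord tau').
    have := ycoord_gt0 tau; have := ycoord_gt0 tau'; nra.
  pose u (t : R) : R := complex.Re (psi (to_uhp (g t)) / phi (to_uhp (g t))).
  have gc (t : R) : (g x : R[i]^o) @[x --> t] --> (g t : R[i]^o).
    apply: cvgC_ReIm.
      have -> : (fun x => complex.Re (g x)) = (fun x => complex.Re (val tau) +
        x * complex.Re (val tau' - val tau)).
        by apply/funext => x; rewrite /g !reimE mul0r subr0.
      rewrite (_ : complex.Re (g t) = complex.Re (val tau) +
        t * complex.Re (val tau' - val tau)); last by rewrite /g !reimE mul0r subr0.
      by apply: cvgD; [exact: cvg_cst|apply: cvgM; [exact: cvg_id|exact: cvg_cst]].
    have -> : (fun x => complex.Im (g x)) = (fun x => complex.Im (val tau) +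
      x * complex.Im (val tau' - val tau)).
      by apply/funext => x; rewrite /g !reimE mul0r addr0.
    rewrite (_ : complex.Im (g t) = complex.Im (val tau) +
      t * complex.Im (val tau' - val tau)); last by rewrite /g !reimE mul0r addr0.
    by apply: cvgD; [exact: cvg_cst|apply: cvgM; [exact: cvg_id|exact: cvg_cst]].
  have uc : {within `[0, 1], continuous u}.
    apply: continuous_in_subspaceT => t; rewrite inE /= in_itv /= => t01.
    have hg := g_im _ t01.
    apply: cvgC_Re.
    have d1 := hpsi (to_uhp (g t)); have d2 := hphi (to_uhp (g t)).
    rewrite (to_uhpK hg) in d1; rewrite (to_uhpK hg) in d2.
    have F : Filter (nbhs t) by exact: nbhs_filter.
    exact (@cvg_quot R[i] R (nbhs t) F _ _ g (g t) (gc t) d1 d2 (phi0 _)).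
  have u0 : u 0 = 1.
    rewrite /u /g mul0r addr0 (_ : to_uhp _ = tau); last first.
      by apply: uhpP; rewrite to_uhpK // ycoord_gt0.
    by rewrite h divff.
  have u1 : u 1 = -1.
    rewrite /u /g mul1r addrC subrK (_ : to_uhp _ = tau'); last first.
      by apply: uhpP; rewrite to_uhpK // ycoord_gt0.
    by rewrite h' mulNr divff // ReNc.
  have [|c] := @IVT R u 0 1 0 (@ler01 R) uc.
    by rewrite u0 u1; apply/andP; split; [rewrite ge_min; apply/orP; right|rewrite le_max]; lra.
  rewrite in_itv /= => c01.
  rewrite /u; case: (q2 (to_uhp (g c))) => ->.
    by rewrite divff // /= => /eqP; rewrite oner_eq0.
  by rewrite mulNr divff // ReNc => /eqP; rewrite oppr_eq0 oner_eq0.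
case: (q2 (uhp_i R)) => h0; [left|right]; apply/funext => tau.
  exact: cst h0.
case: (q2 tau) => // h; move: (cst _ (uhp_i R) h) => h1.
case/negP: (phi0 (uhp_i R)); have := h0; rewrite h1 => /eqP.
by rewrite -addr_eq0 -mulr2n mulrn_eq0.
Qed.

Section TransformationLaw.
Variables (n : nat) (k : int) (rho : mp2 R -> 'M[R[i]]_n).
Variable F : uhp R -> 'cV[R[i]]_n.
Hypothesis rho_rep : is_mp2_rep rho.

Definition mp2_law (g : mp2 R) := forall tau : uhp R,
  F (mobius g.1 tau) = g.2 tau ^ (2 * k) *: (rho g *m F tau).

Lemma mp2_lawM g h : Mp2Z g -> Mp2Z h -> mp2_law g -> mp2_law h ->
  mp2_law (mp2_mul g h).
Proof.
case: rho_rep => _ rhoM Zg Zh lg lh tau /=.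
have [sg _ _] := Zg; have [sh _ _] := Zh.
rewrite mobiusM // lg lh -scalemxAr scalerA mulmxA -rhoM //.
by rewrite expfzMl.
Qed.

Lemma mp2_mul_TTi : mp2_mul mp2_Ti (mp2_T R) = mp2_one R.
Proof.
congr pair; first by apply: eq_mx2; rewrite !mulmx2 !mx2E !mxE.
by apply/funext => tau /=; rewrite mulr1.
Qed.

Lemma mp2_mul_TiT : mp2_mul (mp2_T R) mp2_Ti = mp2_one R.
Proof.
congr pair; first by apply: eq_mx2; rewrite !mulmx2 !mx2E !mxE.
by apply/funext => tau /=; rewrite mulr1.
Qed.

Lemma mp2_law_Ti : mp2_law (mp2_T R) -> mp2_law mp2_Ti.
Proof.
case: rho_rep => rho1 rhoM lT tau /=.
have e : F tau = rho (mp2_T R) *m F (mobius mTi tau).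
  have := lT (mobius mTi tau); rewrite /= exp1rz scale1r => <-.
  rewrite -mobiusM; [|exact: SL2Z_T|exact: SL2Z_Ti].
  have -> : mx2 1 1 0 1 *m mTi = 1%:M by exact: (congr1 fst mp2_mul_TiT).
  by rewrite mobius1.
rewrite exp1rz scale1r e mulmxA -rhoM; [|exact: Mp2Z_Ti|exact: Mp2Z_T].
by rewrite mp2_mul_TTi rho1 mul1mx.
Qed.

(** The factor [sqrt (- 1 / tau) * sqrt tau] is the square root of [- 1] which lies
    in the upper half plane. *)
Lemma mp2_SS : mp2_mul (mp2_S R) (mp2_S R) = (mx2 (-1) 0 0 (-1), fun=> 'i).
Proof.
congr pair; first by apply: eq_mx2; rewrite !mulmx2 !mx2E.
apply/funext => tau /=; apply: sqr_uhp_inj.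
- exact: (sqrtcM_uhp (ycoord_gt0 (mobius _ tau)) (ycoord_gt0 tau)).
- exact: ltr01.
- rewrite exprMn !sqr_sqrtc -[mx2 _ _ _ _]/mS val_mobius_S sqr_i.
  by rewrite mulNr mulVf // uhp_neq0.
Qed.

(** The relation [T S T S T = S], the source of the evaluation of the Gauss
    sum, with the sign of its automorphy factor. *)
Lemma mp2_TSTST : mp2_mul (mp2_T R) (mp2_mul (mp2_S R) (mp2_mul (mp2_T R)
  (mp2_mul (mp2_S R) (mp2_T R)))) = mp2_S R.
Proof.
congr pair; first by apply: eq_mx2; rewrite !mulmx2 !mx2E.
apply/funext => tau /=; rewrite !mul1r mulr1; apply: sqr_uhp_inj.
- exact: (sqrtcM_uhp (ycoord_gt0 (mobius _ _)) (ycoord_gt0 (mobius _ _))).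
- by have [] := sqrtc_uhp (ycoord_gt0 tau).
rewrite exprMn !sqr_sqrtc -[mx2 1 1 0 1]/mT -[mx2 _ _ _ _]/mS.
have sST : SL2Z (mS *m mT) by apply: SL2ZM; [exact: SL2Z_S|exact: SL2Z_T].
rewrite (val_mobius tau (SL2ZM SL2Z_T sST)).
rewrite !autfacM ?autfac_S; [|exact: SL2Z_S|exact: SL2Z_T|exact: SL2Z_T|exact: sST].
rewrite !autfac_T mul1r mulr1 !mulmx2 !mx2E.
rewrite divfK ?uhp_neq0 //.
by rewrite ?mul0r ?mulr0 ?mul1r ?mulr1 ?mulN1r ?add0r ?addr0 //=; ring.
Qed.

(** Products of the generators give the law for one of the two elements over
    each matrix; the other one differs from it by [S ^ 4 = (1, -1)]. *)
Lemma mp2_law_all : mp2_law (mp2_T R) -> mp2_law (mp2_S R) ->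
  forall g, Mp2Z g -> mp2_law g.
Proof.
move=> lT lS; have zS := Mp2Z_S; have zT := Mp2Z_T; have zTi := Mp2Z_Ti.
have good M : SL2Z M -> exists phi, Mp2Z (M, phi) /\ mp2_law (M, phi).
  elim/SL2Z_ind.
  - by exists (mp2_T R).2.
  - by exists mp2_Ti.2; split => //; exact: mp2_law_Ti.
  - by exists (mp2_S R).2.
  - move=> M1 M2 _ _ [phi [z1 l1]] [psi [z2 l2]].
    exists (mp2_mul (M1, phi) (M2, psi)).2; split; first exact: (mp2_mulZ z1 z2).
    exact: (mp2_lawM z1 z2).
have zSS := mp2_mulZ zS zS; have lSS := mp2_lawM zS zS lS lS.
have zS4 := mp2_mulZ zSS zSS; have lS4 := mp2_lawM zSS zSS lSS lSS.
move=> [M phi] z; have [sM _ _] := z.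
have [psi [zpsi lpsi]] := good M sM.
have [<- //|epsi] := Mp2Z_sign z zpsi.
have -> : (M, phi) = mp2_mul (mp2_mul (mp2_mul (mp2_S R) (mp2_S R))
    (mp2_mul (mp2_S R) (mp2_S R))) (M, psi).
  rewrite mp2_SS; congr pair => /=; last first.
    by apply/funext => tau; rewrite -expr2 sqr_i epsi mulrN mulN1r opprK.
  rewrite (_ : _ *m mx2 _ _ _ _ = 1%:M) ?mul1mx //.
  by apply: eq_mx2; rewrite !mulmx2 !mx2E !mxE.
exact: mp2_lawM.
Qed.

End TransformationLaw.

End Metaplectic.

(** * Legendre symbols and finite Fourier analysis *)


Section LegendreSums.
Variables (p : nat).
Hypotheses (p_prime : prime p) (p_odd : odd p).
Local Notation chi := (@legendre p).
Implicit Types a b r : 'F_p.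

Lemma two_neq0_Fp : (2%:R : 'F_p) != 0.
Proof.
rewrite -(dvdn_pcharf (pchar_Fp p_prime)) dvdn_prime2 //.
by apply: contraL p_odd => /eqP ->.
Qed.

Lemma opp_neq_Fp a : a != 0 -> - a != a.
Proof.
apply: contra => /eqP e.
have : (2%:R : 'F_p) * a == 0 by rewrite mulr_natl mulr2n -{1}e addNr.
by rewrite mulf_eq0 (negPf two_neq0_Fp).
Qed.

Lemma legendre0 : chi 0 = 0. Proof. by rewrite /legendre eqxx. Qed.

Lemma legendre_sqr a : a != 0 -> chi (a ^+ 2) = 1.
Proof.
move=> a0; rewrite /legendre expf_eq0 /= (negPf a0).
by case: existsP => // -[]; exists a.
Qed.

Lemma legendre1 : chi 1 = 1.
Proof. by rewrite -(expr1n _ 2%N) legendre_sqr // oner_neq0. Qed.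

Lemma legendreP a : a != 0 -> chi a = 1 \/ chi a = -1.
Proof. by rewrite /legendre => /negPf ->; case: [exists b : 'F_p, b ^+ 2 == a]; [left|right]. Qed.

Lemma legendre_eq1 a : chi a = 1 -> exists2 b, b != 0 & a = b ^+ 2.
Proof.
rewrite /legendre; case: eqVneq => // a0; case: existsP => // -[b /eqP ba] _.
by exists b => //; apply: contraNneq a0 => b0; rewrite -ba b0 expr0n.
Qed.

(** The number of square roots of [r] is [1 + chi r]. *)
Lemma sum_sqr (K : pzRingType) (f : 'F_p -> K) :
  \sum_(x : 'F_p) f (x ^+ 2) = \sum_(r : 'F_p) (1 + chi r)%:~R * f r.
Proof.
rewrite (partition_big (fun x : 'F_p => x ^+ 2) predT) //.
apply: eq_bigr => r _; rewrite (eq_bigr (fun=> f r)); last by move=> x /andP [_ /eqP ->].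
rewrite sumr_const; congr (_ : K); rewrite -mulr_natl; congr (_ * _).
rewrite pmulrn; congr (_%:~R).
have [->|r0] := eqVneq r 0.
  rewrite legendre0 addr0 (eq_card (B := pred1 0)) ?card1 // => x.
  by change ((x ^+ 2 == 0) = (x == 0)); rewrite expf_eq0.
have [r1|r1] := legendreP r0.
  have [b b0 ->] := legendre_eq1 r1; rewrite legendre_sqr //.
  rewrite (eq_card (B := pred2 b (- b))); last first.
    by move=> x; rewrite inE -eqf_sqr.
  by rewrite card2 eq_sym opp_neq_Fp.
rewrite r1 addrN eq_card0 // => x.
change ((x ^+ 2 == r) = false); apply/negP => /eqP e.
have x0 : x != 0 by apply: contraNneq r0 => x0; rewrite -e x0 expr0n.
by move: r1; rewrite -e legendre_sqr.
Qed.

Lemma sum_legendre : \sum_(r : 'F_p) chi r = 0.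
Proof.
have := sum_sqr (fun _ => 1 : int).
under [RHS]eq_bigr do rewrite mulr1 intz.
by rewrite big_split /= => /eqP; rewrite addrC -subr_eq subrr eq_sym => /eqP.
Qed.

(** For two nonresidues [a] and [b]: the sums [chi (a r) + chi r] are never
    positive, and they add up to zero over all [r], so each of them is zero. *)
Lemma legendreM a b : chi (a * b) = chi a * chi b.
Proof.
have [->|a0] := eqVneq a 0; first by rewrite mul0r legendre0 mul0r.
have [->|b0] := eqVneq b 0; first by rewrite mulr0 legendre0 mulr0.
have sq x y : x != 0 -> chi (x ^+ 2 * y) = chi y.
  move=> x0; rewrite /legendre mulf_eq0 expf_eq0 /= (negPf x0) /=.
  case: (y == 0) => //; congr (if _ then _ else _).
  apply/existsP/existsP => -[z /eqP e].
    exists (z / x); rewrite exprMn e exprVn mulrAC mulfV ?mul1r //.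
    by rewrite expf_neq0.
  by exists (x * z); rewrite exprMn e.
have [a1|a1] := legendreP a0.
  by have [x x0 ->] := legendre_eq1 a1; rewrite sq // legendre_sqr // mul1r.
have [b1|b1] := legendreP b0.
  have [x x0 ->] := legendre_eq1 b1.
  by rewrite mulrC sq // legendre_sqr // mulr1.
have nonpos r : chi (a * r) + chi r <= 0.
  have [->|r0] := eqVneq r 0; first by rewrite mulr0 legendre0.
  have [r1|r1] := legendreP r0.
    have [x x0 ->] := legendre_eq1 r1.
    by rewrite mulrC sq // legendre_sqr // a1 addNr.
  rewrite r1; have : a * r != 0 by rewrite mulf_neq0.
  by move=> /legendreP [] ->.
have : \sum_(r : 'F_p) - (chi (a * r) + chi r) = 0.
  rewrite sumrN big_split /= sum_legendre addr0.
  have := sum_legendre; rewrite (reindex_inj (mulfI a0)) /= => ->.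
  exact: oppr0.
move=> /eqP; rewrite psumr_eq0; last by move=> r _; rewrite oppr_ge0.
move=> /allP /(_ b (mem_index_enum _)) /=; rewrite oppr_eq0 b1 subr_eq0 => /eqP ->.
by rewrite a1 mulrNN mulr1.
Qed.

Lemma legendre_sq1 a : a != 0 -> chi a * chi a = 1.
Proof. by move=> /legendreP [] ->. Qed.

Lemma legendreV a : chi a^-1 = chi a.
Proof.
have [->|a0] := eqVneq a 0; first by rewrite invr0.
have /legendreP [] := a0 => a1; rewrite -[LHS]mulr1 -(legendre_sq1 a0);
  by rewrite mulrA -legendreM mulVf // legendre1 mul1r.
Qed.

Lemma exists_nonresidue (e : int) : e = 1 \/ e = -1 ->
  exists2 r : 'F_p, r != 0 & chi r = - e.
Proof.
case=> ->; last by exists 1; rewrite ?oner_neq0 // legendre1.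
have [/existsP [r /andP [r0 /eqP r1]]|] :=
  boolP [exists r : 'F_p, (r != 0) && (chi r == -1)]; first by exists r.
rewrite negb_exists => /forallP h; have : \sum_(r : 'F_p) chi r > 0.
  rewrite (bigD1 1) //= legendre1 ltr_pwDl // sumr_ge0 // => r _.
  have [->|r0] := eqVneq r 0; first by rewrite legendre0.
  have [->|] := legendreP r0; first by [].
  by move=> r1; have := h r; rewrite r0 r1 eqxx.
by rewrite sum_legendre ltxx.
Qed.

End LegendreSums.

Section FiniteFourier.
Variables (p : nat) (K : numFieldType).
Hypotheses (p_prime : prime p) (p_odd : odd p).
Local Notation chi := (@legendre p).
Variable psi : 'F_p -> K.
Hypothesis psiD : forall a b, psi (a + b) = psi a * psi b.
Hypothesis psi0 : psi 0 = 1.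
Hypothesis psi1 : psi 1 != 1.

(** The translation by [1] multiplies the sum by [psi 1] and permutes its
    terms. *)
Lemma sum_char : \sum_(a : 'F_p) psi a = 0.
Proof.
set s := \sum_(a : 'F_p) _.
have : psi 1 * s = s.
  rewrite mulr_sumr [RHS](reindex_inj (addrI 1)) /=.
  by apply: eq_bigr => a _; rewrite psiD.
move=> /eqP; rewrite -subr_eq0 -{2}[s]mul1r -mulrBl mulf_eq0 subr_eq0 (negPf psi1).
by move=> /eqP.
Qed.

Lemma sum_char_orth b : \sum_(a : 'F_p) psi (a * b) = p%:R * (b == 0)%:R.
Proof.
have [->|b0] := eqVneq b 0; last first.
  by have := sum_char; rewrite (reindex_inj (mulIf b0)) mulr0.
under eq_bigr do rewrite mulr0 psi0.
by rewrite sumr_const mulr1 card_Fp.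
Qed.

(** Inversion of the finite Fourier transform along the fibres of [q]. *)
Lemma fourier_fibre (I : finType) (q : I -> 'F_p) (g : I -> K) r :
  \sum_(j : 'F_p) psi (- (r * j)) * (\sum_i psi (j * q i) * g i) =
  p%:R * \sum_(i | q i == r) g i.
Proof.
under eq_bigr do rewrite mulr_sumr.
rewrite exchange_big /= mulr_sumr [RHS]big_mkcond /=; apply: eq_bigr => i _.
under eq_bigr => j _ do rewrite mulrA -psiD mulrC -[- (r * j)]mulNr [- r * j]mulrC -mulrDr.
rewrite -mulr_sumr sum_char_orth addrC subr_eq0; case: eqP => _.
  by rewrite mulr1 mulrC.
by rewrite !mulr0.
Qed.

Definition gauss (a : 'F_p) : K := \sum_(x : 'F_p) psi (a * x ^+ 2).

(** Counting square roots turns the Gauss sum into the transform of [chi]. *)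
Lemma gaussM a : a != 0 -> gauss a = (chi a)%:~R * gauss 1.
Proof.
have gE b : b != 0 -> gauss b = \sum_(r : 'F_p) (chi r)%:~R * psi (b * r).
  move=> b0; rewrite /gauss (sum_sqr p_prime p_odd (fun r => psi (b * r))).
  under eq_bigr do rewrite rmorphD mulrDl mul1r.
  rewrite big_split /= (_ : \sum_(_ : 'F_p) _ = 0) ?add0r //.
  by under eq_bigr do rewrite mulrC; rewrite sum_char_orth (negPf b0) mulr0.
move=> a0; rewrite !gE ?oner_neq0 //.
rewrite (reindex_inj (mulfI (invr_neq0 a0))) /= mulr_sumr.
apply: eq_bigr => r _; rewrite mulVKf // mul1r legendreM // legendreV //.
by rewrite rmorphM /= mulrA.
Qed.

(** Completing the square. *)
Lemma gauss_shift a b :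
  \sum_(x : 'F_p) psi (a * x ^+ 2 - 2 * a * b * x) =
  psi (- (a * b ^+ 2)) * gauss a.
Proof.
rewrite /gauss mulr_sumr (reindex_inj (addIr b)) /=.
by apply: eq_bigr => x _; rewrite -psiD; congr psi; ring.
Qed.

End FiniteFourier.

(** * The Weil representation and the descent to scalar forms *)


Section AdditiveCharacter.
Variables (R : realType) (p : nat).
Hypothesis p_prime : prime p.

Definition psi (a : 'F_p) : R[i] := e2pi ((val a)%:R / p%:R).

Lemma p_neq0 : (p%:R : R[i]) != 0.
Proof. by rewrite pnatr_eq0 -lt0n prime_gt0. Qed.

Lemma intr_p_Fp : (p%:~R : 'F_p) = 0.
Proof. by rewrite -pmulrn pchar_Fp_0. Qed.

Lemma intr_Fp_eq0 (m : int) : ((m%:~R : 'F_p) == 0) = (p %| m)%Z.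
Proof.
rewrite dvdzE /= (dvdn_pcharf (pchar_Fp p_prime)).
by case: m => m; rewrite ?NegzE ?rmorphN /= -?pmulrn ?oppr_eq0.
Qed.

Lemma psi_int (n : int) : psi (n%:~R) = e2pi (n%:~R / p%:R).
Proof.
have p0 : (p%:Z != 0) by rewrite -lt0n prime_gt0.
have [q [m e]] : exists q : int, exists m : nat, n = q * p%:Z + m%:Z.
  exists (n %/ p)%Z, `|(n %% p)%Z|%N.
  by rewrite gez0_abs ?modz_ge0 // -divz_eq.
have -> : (n%:~R : 'F_p) = m%:R.
  by rewrite e rmorphD rmorphM /= intr_p_Fp mulr0 add0r -pmulrn.
have mp : (n%:~R / p%:R : R[i]) = (q + (m %/ p)%N)%:~R + (m %% p)%N%:R / p%:R.
  have em : (m%:R : R[i]) = (m %/ p)%N%:R * p%:R + (m %% p)%N%:R.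
    by rewrite -natrM -natrD -divn_eq.
  by rewrite e !rmorphD rmorphM /= -!pmulrn em; field; exact: p_neq0.
rewrite mp e2piD e2pi_int mul1r /psi.
by have -> : val (m%:R : 'F_p) = (m %% p)%N by exact: val_Fp_nat.
Qed.

Lemma Fp_valK (a : 'F_p) : ((val a)%:~R : 'F_p) = a.
Proof. by rewrite -pmulrn natr_Zp. Qed.

Lemma psiD (a b : 'F_p) : psi (a + b) = psi a * psi b.
Proof.
rewrite -[a in LHS]Fp_valK -[b in LHS]Fp_valK -rmorphD /= psi_int rmorphD /=.
by rewrite mulrDl e2piD -!psi_int !Fp_valK.
Qed.

Lemma psi0 : psi 0 = 1.
Proof. by rewrite -[0](rmorph0 (intmul (1 : 'F_p))) psi_int mul0r e2pi0. Qed.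

Lemma psi1 : odd p -> psi 1 != 1.
Proof.
move=> p_odd; have p2 : (2 < p)%N by rewrite odd_prime_gt2.
rewrite -[1](rmorph1 (intmul (1 : 'F_p))) psi_int rmorph1 div1r.
rewrite -[p%:R](rmorph_nat (real_complex R)) -fmorphV /= e2pi_real.
apply/eqP => /(congr1 (@complex.Im R)) /=; apply/eqP; rewrite gt_eqF //.
have pp : 2 < (p%:R : R) by rewrite ltr_nat.
have pi0 := pi_gt0 R.
apply: sin_gt0_pi; apply/andP; split; first by rewrite !mulr_gt0 // invr_gt0; lra.
rewrite ltr_pdivrMr; last by lra.
by rewrite mulrC ltr_pM2l.
Qed.

Lemma psi_conj (a : 'F_p) : conjc (psi a) = psi (- a).
Proof.
have -> : psi (- a) = e2pi ((- (val a)%:Z)%:~R / p%:R).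
  by rewrite -psi_int rmorphN /= Fp_valK.
rewrite /psi e2pi_conj rmorphM fmorphV !rmorph_nat mulrNz -pmulrn.
by rewrite mulNr.
Qed.

Lemma norm_psi (a : 'F_p) : `|psi a| = 1.
Proof.
rewrite /psi norm_e2pi (_ : complex.Im _ = 0) ?mulr0 ?oppr0 ?expR0 //.
by rewrite -!(rmorph_nat (real_complex R)) -fmorph_div.
Qed.

Lemma psi_rat (x : rat) (a : 'F_p) :
  x - (val a)%:R / p%:R \is a Num.int -> e2pi (ratr x : R[i]) = psi a.
Proof.
move=> h; rewrite -[x](subrK ((val a)%:R / p%:R)) rmorphD e2piD /=.
by rewrite (e2pi_ratint _ h) mul1r /psi rmorphM fmorphV /= !ratr_nat.
Qed.

End AdditiveCharacter.

Section WeilAction.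
Variables (R : realType) (p : nat).
Hypotheses (p_prime : prime p) (p_odd : odd p).
Local Notation N := (Zp_trunc (pdiv p)).+2.
Local Notation chi := (@legendre p).
Local Notation psi := (@psi R p).
Variables (lambda : 'F_p) (sigma : R[i]) (k : int).
Variable rho : mp2 R -> 'M[R[i]]_N.
Hypothesis lambda_neq0 : lambda != 0.
Hypothesis rho_rep : is_mp2_rep rho.
Hypothesis rho_T : forall g : 'F_p, rho (mp2_T R) *m delta_mx g (0 : 'I_1) =
  psi (lambda * g ^+ 2) *: delta_mx g 0.
Hypothesis rho_S : forall g d : 'F_p,
  (rho (mp2_S R) *m delta_mx g (0 : 'I_1)) d 0 =
  sigma * psi (- (2 * lambda * g * d)).
Hypothesis sigma_k : sigma ^+ 2 * p%:R = (-1) ^ k.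

Implicit Types (v : 'cV[R[i]]_N) (tau : uhp R).

Let pD := psiD R p_prime.
Let p0 := psi0 R p_prime.
Let p1 := psi1 R p_prime p_odd.

Lemma rho_TE v (d : 'F_p) : (rho (mp2_T R) *m v) d 0 = psi (lambda * d ^+ 2) * v d 0.
Proof.
have e (g : 'F_p) : rho (mp2_T R) d g = psi (lambda * g ^+ 2) * (d == g)%:R.
  have := congr1 (fun M : 'cV_N => M d 0) (rho_T g).
  by rewrite -colE !mxE eqxx andbT.
rewrite mxE (bigD1 d) //= e eqxx mulr1 big1 ?addr0 // => g gd.
by rewrite e eq_sym (negPf gd) mulr0 mul0r.
Qed.

Lemma rho_SE v (d : 'F_p) : (rho (mp2_S R) *m v) d 0 =
  \sum_(g : 'F_p) sigma * psi (- (2 * lambda * g * d)) * v g 0.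
Proof.
by rewrite mxE; apply: eq_bigr => g _; rewrite -rho_S -colE mxE.
Qed.

Lemma sigma_neq0 : sigma != 0.
Proof.
apply/eqP => s0; move: sigma_k; rewrite s0 expr0n mul0r => /esym/eqP.
by rewrite expfz_eq0 oppr_eq0 oner_eq0 andbF.
Qed.

(** Milgram's formula: the relation [T S T S T = S] forces the value of the
    Gauss sum of the discriminant form. *)
Lemma sigma_gauss : sigma * gauss psi lambda = 1.
Proof.
have [_ rhoM] := rho_rep; have zS := Mp2Z_S R; have zT := Mp2Z_T R.
have zST := mp2_mulZ zS zT; have zTST := mp2_mulZ zT zST.
have zSTST := mp2_mulZ zS zTST.
have := congr1 rho (mp2_TSTST R); rewrite !rhoM //.
move/(congr1 (fun M : 'M[R[i]]_N => (M *m delta_mx 0 (0 : 'I_1)) 0 0)).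
rewrite -!mulmxA rho_T expr0n mulr0 p0 scale1r rho_S mulr0 oppr0 p0 mulr1.
rewrite rho_TE expr0n mulr0 p0 mul1r rho_SE.
rewrite (eq_bigr (fun g : 'F_p => sigma * (psi (lambda * g ^+ 2) * sigma))); last first.
  move=> g _; rewrite (mulr0 (2 * lambda * g)) oppr0 p0 mulr1 rho_TE rho_S.
  by rewrite mulr0 mul0r oppr0 p0 mulr1.
rewrite -mulr_sumr -mulr_suml => /eqP.
rewrite -subr_eq0 -{3}[sigma]mulr1 -mulrBr mulf_eq0 (negPf sigma_neq0) /= subr_eq0.
by rewrite mulrC => /eqP.
Qed.

Lemma gauss_scale (j : 'F_p) : j != 0 ->
  gauss psi (j * lambda) = (chi j)%:~R * gauss psi lambda.
Proof.
move=> j0; rewrite (gaussM p_prime p_odd pD p0 p1) ?mulf_neq0 //.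
by rewrite (gaussM p_prime p_odd pD p0 p1 lambda_neq0) legendreM // rmorphM /= mulrA.
Qed.

(** The product of the Gauss sum and its conjugate is [p]; compare with
    [sigma ^ 2 p]. *)
Lemma legendreN1 : ((chi (-1))%:~R : R[i]) = (-1) ^ k.
Proof.
have gg : gauss psi lambda * gauss psi (- lambda) = p%:R.
  transitivity (\sum_(x : 'F_p) \sum_(y : 'F_p)
      psi (lambda * y ^+ 2 - 2 * lambda * x * y)).
    rewrite [gauss psi (- lambda)]/gauss mulr_sumr; apply: eq_bigr => x _.
    by rewrite (gauss_shift pD) mulrC mulNr.
  rewrite exchange_big /=.
  under eq_bigr => y _.
    under eq_bigr => x _.
      rewrite (_ : _ - _ = lambda * y ^+ 2 + x * (- 2 * lambda * y)); last by ring.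
      rewrite pD.
    over.
    rewrite -mulr_sumr (sum_char_orth p_prime pD p0 p1) !mulf_eq0 oppr_eq0.
    rewrite (negPf lambda_neq0) (negPf (two_neq0_Fp p_prime p_odd)) /=.
  over.
  rewrite (bigD1 (0 : 'F_p)) // big1; last by move=> y /negPf y0; rewrite y0 !mulr0.
  rewrite [LHS]addr0; cbv beta.
  by rewrite eqxx expr0n mulr0 p0 mul1r mulr1.
have n1 : (-1 : 'F_p) != 0 by rewrite oppr_eq0 oner_neq0.
rewrite -mulN1r gauss_scale // in gg.
rewrite -sigma_k -gg.
transitivity ((chi (-1))%:~R * (sigma * gauss psi lambda) ^+ 2); last by ring.
by rewrite sigma_gauss expr1n mulr1.
Qed.

(** The functionals [theta_j v = \sum_g e(j Q(g)) v_g]; together with [v_0]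
    they are permuted by the action up to scalars, like the points [j] and
    infinity of the projective line over [Z/pZ]. *)
Definition theta (j : 'F_p) v : R[i] :=
  \sum_(g : 'F_p) psi (j * (lambda * g ^+ 2)) * v g 0.

Lemma thetaB j v w : theta j (v - w) = theta j v - theta j w.
Proof. by rewrite -sumrB; apply: eq_bigr => g _; rewrite !mxE mulrBr. Qed.

Lemma thetaZ j c v : theta j (c *: v) = c * theta j v.
Proof. by rewrite mulr_sumr; apply: eq_bigr => g _; rewrite !mxE mulrCA. Qed.

Lemma theta_T j v : theta j (rho (mp2_T R) *m v) = theta (j + 1) v.
Proof.
by apply: eq_bigr => g _; rewrite rho_TE mulrA -pD mulrDl mul1r.
Qed.

Lemma theta_S0 v : theta 0 (rho (mp2_S R) *m v) = sigma * p%:R * v 0 0.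
Proof.
rewrite /theta; under eq_bigr do rewrite mul0r p0 mul1r rho_SE.
rewrite exchange_big /=.
rewrite (eq_bigr (fun g : 'F_p => sigma * (p%:R * (g == 0)%:R) * v g 0)); last first.
  move=> g _; rewrite -mulr_suml -mulr_sumr; congr (_ * _ * _).
  rewrite (eq_bigr (fun d : 'F_p => psi (d * (- 2 * lambda * g)))); last first.
    by move=> d _; congr psi; ring.
  rewrite (sum_char_orth p_prime pD p0 p1) !mulf_eq0 oppr_eq0.
  by rewrite (negPf lambda_neq0) (negPf (two_neq0_Fp p_prime p_odd)).
rewrite (bigD1 (0 : 'F_p)) // big1; last by move=> y /negPf y0; rewrite y0 !mulr0 mul0r.
by rewrite [LHS]addr0; cbv beta; rewrite eqxx mulr1.
Qed.

(** Completing the square; the Gauss sum which comes out is cancelled by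
    [sigma]. *)
Lemma theta_S j v : j != 0 ->
  theta j (rho (mp2_S R) *m v) = (chi j)%:~R * theta (- j^-1) v.
Proof.
move=> j0; rewrite /theta; under eq_bigr do rewrite rho_SE mulr_sumr.
rewrite exchange_big mulr_sumr /=; apply: eq_bigr => g _.
have jl : j * lambda != 0 by rewrite mulf_neq0.
transitivity (sigma * v g 0 * \sum_(d : 'F_p)
    psi ((j * lambda) * d ^+ 2 - 2 * (j * lambda) * (g / j) * d)).
  rewrite mulr_sumr; apply: eq_bigr => d _.
  rewrite (_ : _ * _ * _ - _ = j * (lambda * d ^+ 2) + - (2 * lambda * g * d)).
    by rewrite pD; ring.
  by field.
rewrite (gauss_shift pD) gauss_scale //.
rewrite (_ : - (j * lambda * _) = - j^-1 * (lambda * g ^+ 2)); last by field.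
transitivity ((chi j)%:~R * (psi (- j^-1 * (lambda * g ^+ 2)) * v g 0) *
  (sigma * gauss psi lambda)); first by ring.
by rewrite sigma_gauss mulr1.
Qed.

Lemma coord0_S v : (rho (mp2_S R) *m v) 0 0 = sigma * theta 0 v.
Proof.
rewrite rho_SE mulr_sumr; apply: eq_bigr => g _.
by rewrite mulr0 oppr0 mul0r p0 mulr1 mul1r.
Qed.

Lemma rho_SS v (d : 'F_p) :
  (rho (mp2_S R) *m (rho (mp2_S R) *m v)) d 0 = (-1) ^ k * v (- d) 0.
Proof.
rewrite rho_SE; under eq_bigr do rewrite rho_SE mulr_sumr.
rewrite exchange_big /=.
rewrite (eq_bigr (fun h : 'F_p => sigma ^+ 2 * (p%:R * (h == - d)%:R) * v h 0)).
  rewrite (bigD1 (- d : 'F_p)) // big1; last first.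
    by move=> y /negPf y0; rewrite y0 !mulr0 mul0r.
  by rewrite [LHS]addr0; cbv beta; rewrite eqxx mulr1 sigma_k.
move=> h _; rewrite (eq_bigr (fun g : 'F_p => sigma ^+ 2 * v h 0 *
    psi (g * (- 2 * lambda * (h + d))))); last first.
  move=> g _; rewrite (_ : g * _ = - (2 * lambda * g * d) + - (2 * lambda * h * g)).
    by rewrite pD; ring.
  by ring.
rewrite -mulr_sumr (sum_char_orth p_prime pD p0 p1) !mulf_eq0 oppr_eq0.
rewrite (negPf lambda_neq0) (negPf (two_neq0_Fp p_prime p_odd)) /= addr_eq0.
by rewrite mulrAC.
Qed.

Definition lawT (F : uhp R -> 'cV[R[i]]_N) :=
  forall tau, F (mobius mT tau) = rho (mp2_T R) *m F tau.
Definition lawS (F : uhp R -> 'cV[R[i]]_N) := forall tau,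
  F (mobius mS tau) = val tau ^ k *: (rho (mp2_S R) *m F tau).

Lemma lawTE F : mp2_law k rho F (mp2_T R) <-> lawT F.
Proof. by split=> h tau; have := h tau; rewrite /= exp1rz scale1r. Qed.

Lemma lawSE F : mp2_law k rho F (mp2_S R) <-> lawS F.
Proof.
have e tau : sqrtc (val tau) ^ (2 * k) = val tau ^ k.
  by rewrite -exprz_exp -exprnP sqr_sqrtc.
by split=> h tau; have := h tau; rewrite /= e.
Qed.

(** [S ^ 2] acts by [g |-> - g] on the basis, so that the components of an
    invariant vector are even in [g]. *)
Lemma lawS_even F : lawS F -> forall tau (g : 'F_p), F tau (- g) 0 = F tau g 0.
Proof.
move=> hS tau g.
have SS : mobius mS (mobius mS tau) = tau.
  by apply: uhpP; rewrite !val_mobius_S invrN invrK opprK.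
rewrite -{2}SS hS hS val_mobius_S -scalemxAr scalerA mxE rho_SS.
rewrite -expfzMl mulNr mulVf ?uhp_neq0 // mulrA -expfzMl mulrNN mulr1.
by rewrite exp1rz mul1r.
Qed.

(** The functional attached to the point [(c : d)] of the projective line; it
    is homogeneous of character [chi] in [(c, d)]. *)
Definition line_form (c d : 'F_p) v : R[i] :=
  if c == 0 then (chi d)%:~R * sigma^-1 * v 0 0 else (chi c)%:~R * theta (d / c) v.

Lemma line_form_T c d v :
  line_form c d (rho (mp2_T R) *m v) = line_form c (c + d) v.
Proof.
rewrite /line_form; case: eqVneq => [->|c0].
  by rewrite add0r rho_TE expr0n mulr0 p0 mul1r.
by rewrite theta_T mulrDl divff // addrC.
Qed.

Lemma line_form_S c d v :
  line_form c d (rho (mp2_S R) *m v) = line_form d (- c) v.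
Proof.
rewrite /line_form; case: eqVneq => [->|c0].
  rewrite coord0_S oppr0 legendre0 !mul0r.
  case: eqVneq => [->|d0]; first by rewrite legendre0 !mul0r.
  by rewrite mulrA divfK ?sigma_neq0.
case: eqVneq => [->|d0].
  rewrite mul0r theta_S0 -mulN1r legendreM // rmorphM /= legendreN1.
  rewrite -sigma_k !mulrA; congr (_ * _).
  by field; exact: sigma_neq0.
rewrite theta_S ?mulf_neq0 ?invr_neq0 //.
rewrite mulrA -rmorphM -legendreM // mulrCA mulfV // mulr1.
by congr (_ * theta _ _); field; rewrite c0 d0.
Qed.

(** [T] and [S] act on the functionals as on row vectors [(c, d)], hence so does
    the whole group. *)
Lemma line_form_law F : lawT F -> lawS F -> forall M, SL2Z M ->
  forall c d tau, line_form c d (F (mobius M tau)) = autfac M tau ^ k *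
    line_form (c * (M 0 0)%:~R + d * (M 1 0)%:~R)
              (c * (M 0 1)%:~R + d * (M 1 1)%:~R) (F tau).
Proof.
move=> hT hS; have lZ c d a v : line_form c d (a *: v) = a * line_form c d v.
  by rewrite /line_form; case: ifP => _; rewrite ?thetaZ ?mxE mulrCA.
apply: SL2Z_ind.
- move=> c d tau; rewrite hT line_form_T autfac_T exp1rz mul1r !mx2E.
  by rewrite !mulr1 mulr0 addr0.
- move=> c d tau; rewrite {1}/autfac !mx2E mul0r add0r exp1rz mul1r.
  have -> : F tau = rho (mp2_T R) *m F (mobius mTi tau).
    rewrite -hT -mobiusM; [|exact: SL2Z_T|exact: SL2Z_Ti].
    rewrite (_ : _ *m _ = 1%:M) ?mobius1 //.
    by apply: eq_mx2; rewrite !mulmx2 !mx2E !mxE.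
  rewrite line_form_T !mulr1 mulr0 addr0 mulrN1.
  by rewrite addrA subrr add0r.
- move=> c d tau; rewrite hS lZ line_form_S autfac_S !mx2E.
  by rewrite !mulr0 add0r addr0 mulr1 mulrN1.
- move=> M M' sM sM' hM hM' c d tau.
  rewrite mobiusM // hM hM' mulrA -expfzMl -autfacM //; congr (_ * line_form _ _ _);
    by rewrite !mulmx2 !rmorphD !rmorphM /=; ring.
Qed.

(** The inverse of the lift: [theta_0] sums up all components, so that the
    residue classes of exponents which [F] separates are put together again. *)
Definition descent (F : uhp R -> 'cV[R[i]]_N) tau : R[i] :=
  2^-1 * theta 0 (F (uaff p%:R 0 tau)).

Lemma descentE F tau :
  descent F tau = 2^-1 * line_form 1 0 (F (uaff p%:R 0 tau)).
Proof.
by rewrite /line_form oner_eq0 legendre1 // mul1r divr1.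
Qed.

Let pR0 : 0 < (p%:R : R). Proof. by rewrite ltr0n prime_gt0. Qed.

(** Conjugation by [diag(p, 1)]: the law on [Gamma_0(p)] comes from the
    functional at the point [(1 : 0)], which is an eigenvector of the lower
    triangular matrices modulo [p]. *)
Lemma descent_Gamma0 F : lawT F -> lawS F -> forall M, SL2Z M ->
  (p %| M 1%R 0%R)%Z -> forall tau, descent F (mobius M tau) =
    (chi (M 1 1)%:~R)%:~R * autfac M tau ^ k * descent F tau.
Proof.
move=> hT hS M sM /dvdzP [c ec] tau.
pose M' := mx2 (M 0 0) (p%:Z * M 0 1) c (M 1 1).
have dM : M 0 0 * M 1 1 - M 0 1 * M 1 0 = 1 by rewrite -det2.
have sM' : SL2Z M' by rewrite /SL2Z /= det2 !mx2E -dM ec; ring.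
have aM : autfac M' (uaff p%:R 0 tau) = autfac M tau.
  rewrite /autfac !mx2E val_uaff // ec rmorphM /= addr0 mulrA.
  by rewrite -!pmulrn rmorph_nat.
rewrite descentE.
have -> : uaff p%:R 0 (mobius M tau) = mobius M' (uaff p%:R 0 tau) :> uhp R.
  apply: uhpP; rewrite val_uaff // !val_mobius // aM addr0 val_uaff // !mx2E.
  by rewrite addr0 rmorphM /= -pmulrn rmorph_nat; field; exact: autfac_neq0.
rewrite (line_form_law hT hS) // aM !mx2E !mul1r !mul0r !addr0.
rewrite rmorphM /= intr_p_Fp // mul0r /line_form.
have ad : (M 0 0)%:~R * (M 1 1)%:~R = 1 :> 'F_p.
  have := congr1 (fun n : int => n%:~R : 'F_p) dM.
  by rewrite ec rmorphB !rmorphM /= intr_p_Fp // !mulr0 subr0.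
have a0 : (M 0 0)%:~R != 0 :> 'F_p.
  by apply: contra_eq_neq ad => ->; rewrite mul0r eq_sym oner_eq0.
have d0 : (M 1 1)%:~R != 0 :> 'F_p.
  by apply: contra_eq_neq ad => ->; rewrite mulr0 eq_sym oner_eq0.
rewrite (negPf a0) mul0r /descent.
have -> : chi (M 0 0)%:~R = chi (M 1 1)%:~R.
  have h : chi (M 0 0)%:~R * chi (M 1 1)%:~R = 1 by rewrite -legendreM // ad legendre1.
  by rewrite -[LHS]mulr1 -[X in _ * X = _](legendre_sq1 d0) mulrA h mul1r.
by ring.
Qed.

(** A matrix outside [Gamma_0(p)], conjugated by [diag(p, 1)] and translated, has
    its upper left entry divisible by [p], and so carries the point [(1 : 0)] to
    [(0 : 1)], whose functional is the coordinate [v_0]. *)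
Lemma descent_slash F M : lawT F -> lawS F -> SL2Z M ->
  ~~ (p %| M 1%R 0%R)%Z -> exists (c : R[i]) (j : R), forall tau,
    slash k M (descent F) tau = c * F (uaff p%:R^-1 j tau) 0 0.
Proof.
move=> hT hS sM pc.
have dM : M 0 0 * M 1 1 - M 0 1 * M 1 0 = 1 by rewrite -det2.
have c0 : (M 1 0)%:~R != 0 :> 'F_p by rewrite intr_Fp_eq0.
pose j : 'F_p := (M 1 1)%:~R / (M 1 0)%:~R.
pose jz : int := (val j)%:Z.
have [e he] : exists e, M 1 1 - M 1 0 * jz = e * p%:Z.
  apply/dvdzP; rewrite -(intr_Fp_eq0 p_prime) rmorphB rmorphM /= Fp_valK //.
  by rewrite mulrC divfK // subrr.
pose M' := mx2 (p%:Z * M 0 0) (M 0 1 - M 0 0 * jz) (M 1 0) e.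
have sM' : SL2Z M'.
  rewrite /SL2Z /= det2 !mx2E -dM.
  rewrite (_ : p%:Z * M 0 0 * e = M 0 0 * (e * p%:Z)); last by ring.
  by rewrite -he; ring.
have pi0 : 0 < (p%:R^-1 : R) by rewrite invr_gt0.
exists (2^-1 * p%:R ^ (- k) * ((chi (M 0 1 - M 0 0 * jz)%:~R)%:~R * sigma^-1)), (jz%:~R / p%:R).
move=> tau; rewrite /slash descentE.
set u := uaff p%:R^-1 _ tau.
have vu : val u = (val tau + jz%:~R) / p%:R.
  rewrite val_uaff // fmorph_div fmorphV /= !rmorph_nat mulrDl.
  by rewrite [in RHS]mulrC.
have pC0 := p_neq0 R p_prime.
have aM : autfac M' u = autfac M tau / p%:R.
  have he' : (e%:~R : R[i]) = ((M 1 1)%:~R - (M 1 0)%:~R * jz%:~R) / p%:R.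
    by apply: (mulIf pC0); rewrite divfK // -rmorphM -rmorphB /= he rmorphM /= -pmulrn.
  by rewrite /autfac !mx2E vu he'; field.
have -> : uaff p%:R 0 (mobius M tau) = mobius M' u :> uhp R.
  apply: uhpP; rewrite val_uaff // !val_mobius // aM addr0 !mx2E vu.
  rewrite rmorphB !rmorphM /= -pmulrn rmorph_nat; field.
  by rewrite pC0 autfac_neq0.
rewrite (line_form_law hT hS) // aM !mx2E !mul1r !mul0r !addr0.
rewrite rmorphM /= intr_p_Fp // mul0r /line_form eqxx.
have a0 := autfac_neq0 tau sM.
rewrite expfzMl exprz_inv; transitivity (autfac M tau ^ (-k) * autfac M tau ^ k *
  (2^-1 * p%:R ^ (-k) * ((chi (M 0 1 - M 0 0 * jz)%:~R)%:~R * sigma^-1) * F u 0 0)).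
  by ring.
by rewrite -expfzDr // addNr expr0z mul1r.
Qed.

End WeilAction.

(** * The lift as a combination of translates *)


Section ScalarToVector.
Variables (R : realType) (p : nat).
Hypotheses (p_prime : prime p) (p_odd : odd p).
Local Notation N := (Zp_trunc (pdiv p)).+2.
Local Notation chi := (@legendre p).
Local Notation psi := (@psi R p).
Variables (lambda : 'F_p) (sigma : R[i]) (k : int).
Variable rho : mp2 R -> 'M[R[i]]_N.
Hypothesis lambda_neq0 : lambda != 0.
Hypothesis rho_rep : is_mp2_rep rho.
Hypothesis rho_T : forall g : 'F_p, rho (mp2_T R) *m delta_mx g (0 : 'I_1) =
  psi (lambda * g ^+ 2) *: delta_mx g 0.
Hypothesis rho_S : forall g d : 'F_p,
  (rho (mp2_S R) *m delta_mx g (0 : 'I_1)) d 0 =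
  sigma * psi (- (2 * lambda * g * d)).
Hypothesis sigma_k : sigma ^+ 2 * p%:R = (-1) ^ k.

Implicit Types (f : uhp R -> R[i]) (tau : uhp R).

Let pD := psiD R p_prime.
Let p0 := psi0 R p_prime.
Let p1 := psi1 R p_prime p_odd.
Let pR0 : 0 < (p%:R : R). Proof. by rewrite ltr0n prime_gt0. Qed.
Let pi0 : 0 < (p%:R^-1 : R). Proof. by rewrite invr_gt0. Qed.
Let pC0 := p_neq0 R p_prime.
Let two0 : (2 : R[i]) != 0. Proof. by rewrite pnatr_eq0. Qed.

Definition translate f (j : 'F_p) tau : R[i] :=
  f (uaff p%:R^-1 ((val j)%:R / p%:R) tau).

(** The part of [f (tau / p)] with exponents in the class [r], up to the factor
    [p]: averaging over translates isolates a class without any expansion. *)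
Definition class_proj f (r : 'F_p) tau : R[i] :=
  \sum_(j : 'F_p) psi (- (r * j)) * translate f j tau.

(** The lift, with each sum over a class of exponents replaced by a finite
    combination of translates. *)
Definition finite_lift f tau : 'cV[R[i]]_N :=
  \col_(g < N) ((s_factor (g : 'F_p))%:R / p%:R * class_proj f (lambda * g ^+ 2) tau).

Definition unit_periodic f := forall tau, f (uaff 1 1 tau) = f tau.

Definition Gamma0_law f := forall M, SL2Z M -> (p %| M 1%R 0%R)%Z -> forall tau,
  f (mobius M tau) = (chi (M 1 1)%:~R)%:~R * autfac M tau ^ k * f tau.

Lemma Gamma0_periodic f : Gamma0_law f -> unit_periodic f.
Proof.
move=> h tau; rewrite -mobius_T h; [|exact: SL2Z_T|by rewrite mx2E dvdz0].
by rewrite mx2E legendre1 autfac_T exp1rz !mul1r.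
Qed.

Lemma periodicz f : unit_periodic f -> forall (m : int) tau,
  f (uaff 1 m%:~R tau) = f tau.
Proof.
move=> h; have hn (n : nat) tau : f (uaff 1 n%:R tau) = f tau.
  elim: n => [|n IH]; first by rewrite uaff10.
  by rewrite -IH -[RHS]h uaff_comp // !mul1r -natr1.
case=> n tau; first by rewrite -pmulrn hn.
rewrite -(hn n.+1 (uaff _ _ _)) uaff_comp // !mul1r NegzE mulrNz -pmulrn addNr.
by rewrite uaff10.
Qed.

Lemma translateE f (n : int) tau : unit_periodic f ->
  f (uaff p%:R^-1 (n%:~R / p%:R) tau) = translate f n%:~R tau.
Proof.
move=> hf; rewrite /translate.
have [m e] : exists m : int, n = m * p%:Z + (val (n%:~R : 'F_p))%:Z.
  have /dvdzP [m em] : (p %| n - (val (n%:~R : 'F_p))%:Z)%Z.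
    by rewrite -(intr_Fp_eq0 p_prime) rmorphB /= Fp_valK // subrr.
  by exists m; rewrite -em subrK.
rewrite {1}e -[RHS](periodicz hf m) uaff_comp // !mul1r; congr (f (uaff _ _ _)).
by rewrite rmorphD rmorphM /= -!pmulrn; field; exact: lt0r_neq0.
Qed.

(** [tau |-> tau + 1] shifts the index of the translates. *)
Lemma finite_lift_T f : unit_periodic f -> lawT rho (finite_lift f).
Proof.
move=> hf tau; apply/matrixP => g [[|//] h]; rewrite (_ : Ordinal h = 0); last exact/val_inj.
rewrite (rho_TE rho_T) !mxE [RHS]mulrCA; congr (_ * _); rewrite /class_proj mulr_sumr.
rewrite (reindex_inj (subIr 1)) /=; apply: eq_bigr => j _.
rewrite [RHS]mulrA -pD mobius_T; congr (psi _ * _); first by ring.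
have -> : j - 1 = (((val j)%:Z - 1)%:~R : 'F_p) by rewrite rmorphB /= Fp_valK.
rewrite -translateE // uaff_comp // mulr1 /translate; congr (f (uaff _ _ _)).
by rewrite rmorphB /= -pmulrn; field; exact: lt0r_neq0.
Qed.

(** The condition on the coefficients, in terms of the projections. *)
Definition plus_space f := forall r : 'F_p, chi r = - chi lambda ->
  forall tau, class_proj f r tau = 0.

Lemma translate_proj f (j : 'F_p) tau :
  \sum_(r : 'F_p) psi (j * r) * class_proj f r tau = p%:R * translate f j tau.
Proof.
rewrite /class_proj; under eq_bigr do rewrite mulr_sumr.
rewrite exchange_big /= (bigD1 j) //= [X in _ + X]big1 ?addr0.
  rewrite (eq_bigr (fun=> translate f j tau)); last first.
    by move=> r _; rewrite mulrA -pD [j * r]mulrC subrr p0 mul1r.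
  by rewrite sumr_const card_Fp // mulr_natl.
move=> i ij; rewrite (eq_bigr (fun r : 'F_p => translate f i tau * psi (r * (j - i)))).
  rewrite -mulr_sumr (sum_char_orth p_prime pD p0 p1) subr_eq0 eq_sym (negPf ij).
  by rewrite !mulr0.
by move=> r _; rewrite mulrA -pD mulrC; congr (_ * psi _); ring.
Qed.

(** The residue classes [r] with [chi r = chi lambda] are each represented
    twice by [lambda g ^ 2], and the factor [s] counts the class [0] twice. *)
Lemma theta_finite_lift f (j : 'F_p) tau : plus_space f ->
  theta lambda j (finite_lift f tau) = 2 * translate f j tau.
Proof.
move=> hf; pose h (r : 'F_p) := psi (j * r) * class_proj f r tau.
have h0 r : chi r = - chi lambda -> h r = 0 by move=> /hf e; rewrite /h e mulr0.
apply: (mulfI pC0); rewrite [RHS]mulrCA -translate_proj mulr_sumr [RHS]mulr_sumr.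
transitivity (\sum_(g : 'F_p) (s_factor g)%:R * h (lambda * g ^+ 2)).
  by apply: eq_bigr => g _; rewrite mxE /h; field.
transitivity (h 0 + \sum_(g : 'F_p) h (lambda * g ^+ 2)).
  rewrite (bigD1 (0 : 'F_p)) //= [in RHS](bigD1 (0 : 'F_p)) //= addrA.
  rewrite /s_factor eqxx expr0n mulr0 mulr_natl mulr2n; congr (_ + _).
  by apply: eq_bigr => g /negPf g0; rewrite g0 mul1r.
rewrite (sum_sqr p_prime p_odd (fun r => h (lambda * r))).
rewrite (eq_bigr (fun r : 'F_p => (1 + chi (lambda * r) * chi lambda)%:~R * h (lambda * r))); last first.
  move=> r _; rewrite legendreM // mulrAC legendre_sq1 // mul1r //.
have -> : \sum_(r : 'F_p) (1 + chi (lambda * r) * chi lambda)%:~R * h (lambda * r) =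
    \sum_(r : 'F_p) (1 + chi r * chi lambda)%:~R * h r.
  by rewrite [RHS](reindex_inj (mulfI lambda_neq0)).
rewrite (bigD1 (0 : 'F_p)) //= [in RHS](bigD1 (0 : 'F_p)) //= addrA.
rewrite legendre0 mul0r addr0 mul1r mulr_natl mulr2n; congr (_ + _).
apply: eq_bigr => r r0; have [e|e] := legendreP r0; have [e'|e'] := legendreP lambda_neq0;
  rewrite ?e ?e' ?mulr1 ?mulN1r ?mul1r ?opprK //.
  by rewrite -/(h r) (h0 r) ?mulr0 // e e' opprK.
by rewrite -/(h r) (h0 r) ?mulr0 // e e'.
Qed.

(** The matrix [j, - (1 + j j') / p; p, - j'] of [Gamma_0(p)], where [j j' = -1]
    mod [p], carries [(tau + j') / p] to [(- 1 / tau + j) / p]. *)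
Lemma translate_S f (j : 'F_p) tau : Gamma0_law f -> j != 0 ->
  translate f j (mobius mS tau) = (chi j)%:~R * val tau ^ k * translate f (- j^-1) tau.
Proof.
move=> hf j0; have nt := uhp_neq0 tau.
pose a : int := (val j)%:Z; pose b : int := (val (- j^-1))%:Z.
have [c ec] : exists c, a * b + 1 = c * p%:Z.
  apply/dvdzP; rewrite -(intr_Fp_eq0 p_prime) rmorphD rmorphM /= !Fp_valK //.
  by rewrite mulrN mulfV // addNr.
pose M := mx2 a (- c) p%:Z (- b).
have sM : SL2Z M by rewrite /SL2Z /= det2 !mx2E mulrN mulNr opprK -ec; ring.
set u := uaff p%:R^-1 ((val (- j^-1))%:R / p%:R) tau.
have vu : val u = (val tau + b%:~R) / p%:R.
  rewrite val_uaff // fmorph_div fmorphV /= !rmorph_nat mulrDl.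
  by rewrite [in RHS]mulrC.
have aM : autfac M u = val tau.
  by rewrite /autfac !mx2E vu rmorphN /= -[p%:~R]pmulrn; field.
have := hf M sM _ u; rewrite !mx2E aM => hM.
have -> : translate f j (mobius mS tau) = f (mobius M u).
  congr f; apply: uhpP; rewrite val_mobius // aM val_uaff // val_mobius_S !mx2E vu.
  have cR : (c%:~R : R[i]) = (a%:~R * b%:~R + 1) / p%:R.
    have := congr1 (fun n : int => n%:~R : R[i]) ec; rewrite /= rmorphD !rmorphM /=.
    by rewrite -[p%:~R]pmulrn => ->; rewrite mulfK.
  rewrite rmorphN /= cR fmorph_div fmorphV /= !rmorph_nat [a%:~R]/(a%:~R) -[(val j)%:R]/(a%:~R).
  by field; rewrite nt pC0.
rewrite hM; last by rewrite dvdzz.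
congr (_%:~R * _ * _); rewrite rmorphN /= Fp_valK // opprK legendreV //.
Qed.

Lemma finite_lift_even f tau (g : 'F_p) :
  finite_lift f tau (- g) 0 = finite_lift f tau g 0.
Proof. by rewrite !mxE /s_factor oppr_eq0 sqrrN. Qed.

(** The fibre of [lambda g ^ 2] is [{g, - g}]; the factor [s] corrects for its
    single element when [g = 0]. *)
Lemma sum_fibre (h : 'F_p -> R[i]) (g : 'F_p) :
  (forall g, h (- g) = h g) ->
  (s_factor g)%:R * \sum_(x : 'F_p | lambda * x ^+ 2 == lambda * g ^+ 2) h x =
  2 * h g.
Proof.
move=> he; have eqs x : (lambda * x ^+ 2 == lambda * g ^+ 2) = (x == g) || (x == - g).
  by rewrite (inj_eq (mulfI lambda_neq0)) eqf_sqr.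
rewrite (eq_bigl _ _ eqs) /s_factor; have [->|g0] := eqVneq g 0.
  by rewrite oppr0 (eq_bigl (pred1 0)) ?big_pred1_eq // => x; rewrite /= orbb.
rewrite (bigD1 g) ?eqxx //= (big_pred1 (- g)); last first.
  move=> x; rewrite /=; case: (eqVneq x g) => [->|] /=; last by rewrite andbT.
  by rewrite eq_sym (negPf (opp_neq_Fp p_prime p_odd g0)).
by rewrite he mul1r mulr_natl mulr2n.
Qed.

(** The defect [K] of the law under [S] is even and killed by [theta_j] for all
    [j != 0]. Fourier inversion gives the same sum [theta_0 K] over every fibre
    of [g |-> lambda g ^ 2]; the fibre over a class that is not represented is
    empty, so these sums vanish. *)
Lemma finite_lift_S f : Gamma0_law f -> plus_space f -> lawS k rho (finite_lift f).
Proof.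
move=> hf hp tau; apply/eqP; rewrite -subr_eq0; apply/eqP.
set K := _ - _.
have rho_even (v : 'cV[R[i]]_N) (d : 'F_p) : (forall g : 'F_p, v (- g) 0 = v g 0) ->
    (rho (mp2_S R) *m v) (- d) 0 = (rho (mp2_S R) *m v) d 0.
  move=> ve; rewrite !(rho_SE rho_S) (reindex_inj oppr_inj) /=.
  by apply: eq_bigr => g _; rewrite ve !mulrN !mulNr !opprK.
have Ke (g : 'F_p) : K (- g) 0 = K g 0.
  have e1 := finite_lift_even f tau; have e2 := finite_lift_even f (mobius mS tau) g.
  have e3 := rho_even _ g e1.
  have KE (A B : 'cV[R[i]]_N) c (d : 'F_p) : (A - c *: B) d 0 = A d 0 - c * B d 0.
    by rewrite !mxE.
  by rewrite /K !KE e2 e3.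
have Kj j : j != 0 -> theta lambda j K = 0.
  move=> j0; rewrite thetaB thetaZ (theta_S p_prime p_odd lambda_neq0 rho_rep rho_T rho_S sigma_k _ j0) !theta_finite_lift // translate_S //.
  by ring.
have fib (r : 'F_p) : p%:R * \sum_(g : 'F_p | lambda * g ^+ 2 == r) K g 0 = theta lambda 0 K.
  have := fourier_fibre p_prime pD p0 p1 (fun g : 'F_p => lambda * g ^+ 2) (fun g => K g 0) r.
  move <-; rewrite (bigD1 (0 : 'F_p)) //= [X in _ + X]big1 ?addr0.
    by rewrite mulr0 oppr0 p0 mul1r.
  by move=> j j0; rewrite [X in _ * X](Kj j j0) mulr0.
have [|r r0 hr] := @exists_nonresidue p p_prime p_odd (chi lambda).
  exact: legendreP.
have t0 : theta lambda 0 K = 0.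
  rewrite -(fib r) big_pred0 ?mulr0 // => g; apply/eqP => e.
  have g0 : g != 0 by apply: contraNneq r0 => g0; rewrite -e g0 expr0n mulr0.
  move: hr; rewrite -e legendreM // legendre_sqr // mulr1.
  by have [->|->] := legendreP lambda_neq0.
apply/matrixP => g [[|//] h]; rewrite (_ : Ordinal h = 0); last exact/val_inj.
have := @sum_fibre (fun g => K g 0) g Ke.
have /eqP := fib (lambda * g ^+ 2); rewrite t0 mulf_eq0 (negPf pC0) /= => /eqP ->.
by rewrite mulr0 => /esym/eqP; rewrite mulf_eq0 (negPf two0) /= => /eqP ->; rewrite mxE.
Qed.

Lemma descent_finite_lift f tau : plus_space f ->
  descent lambda (finite_lift f) tau = f tau.
Proof.
move=> hf; rewrite /descent theta_finite_lift // mulrA mulVf // mul1r /translate.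
rewrite uaff_comp // mulVf ?gt_eqF // mulr0 mul0r addr0.
by rewrite uaff10.
Qed.

Lemma translate_descent F (j : 'F_p) tau : lawT rho F ->
  translate (descent lambda F) j tau = 2^-1 * theta lambda j (F tau).
Proof.
move=> hT; rewrite /translate /descent; congr (_ * _).
rewrite uaff_comp // mulfV ?gt_eqF // addr0 mulrCA mulfV ?gt_eqF // mulr1.
have hn (n : nat) : theta lambda 0 (F (uaff 1 n%:R tau)) = theta lambda n%:R (F tau).
  elim: n tau => [|n IH] tau; first by rewrite uaff10.
  have -> : uaff 1 n.+1%:R tau = uaff 1 n%:R (uaff 1 1 tau).
    by rewrite uaff_comp // !mul1r nat1r.
  by rewrite IH -mobius_T hT (theta_T p_prime rho_T) natr1.
by rewrite hn natr_Zp.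
Qed.

Lemma proj_descent F r tau : lawT rho F -> class_proj (descent lambda F) r tau =
  p%:R / 2 * \sum_(g : 'F_p | lambda * g ^+ 2 == r) F tau g 0.
Proof.
move=> hT; rewrite /class_proj.
rewrite mulrAC -(fourier_fibre p_prime pD p0 p1) mulrC mulr_sumr.
by apply: eq_bigr => j _; rewrite translate_descent // mulrCA.
Qed.

Lemma plus_space_descent F : lawT rho F -> plus_space (descent lambda F).
Proof.
move=> hT r hr tau; rewrite proj_descent // big_pred0 ?mulr0 // => g.
apply/eqP => e; move: hr; rewrite -e legendreM //.
have [->|g0] := eqVneq g 0.
  by rewrite expr0n legendre0 mulr0; have [->|->] := legendreP lambda_neq0.
by rewrite legendre_sqr // mulr1; have [->|->] := legendreP lambda_neq0.
Qed.

Lemma finite_lift_descent F tau : lawT rho F -> lawS k rho F ->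
  finite_lift (descent lambda F) tau = F tau.
Proof.
move=> hT hS; apply/matrixP => g [[|//] h]; rewrite (_ : Ordinal h = 0); last exact/val_inj.
rewrite mxE proj_descent //.
have := @sum_fibre (fun g => F tau g 0) g (lawS_even p_prime p_odd lambda_neq0 rho_S sigma_k hS tau).
move/(congr1 (fun z => z / 2)); rewrite [2 * _]mulrC mulfK // => <-.
by field; rewrite pC0.
Qed.

End ScalarToVector.

(** * Fourier coefficients of functions of a real variable *)


Section ComplexValued.
Variable R : realType.
Implicit Types (u v w g h : R -> R[i]) (t x : R) (c z : R[i]) (n m : int).
Local Notation mu := (@lebesgue_measure R).

(** Functions of a real variable with complex values are treated through their
    real and imaginary parts. *)
Definition contC u := continuous (fun t => complex.Re (u t)) /\
  continuous (fun t => complex.Im (u t)).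

Definition is_cder u t z := is_derive t (1 : R) (fun t => complex.Re (u t)) (complex.Re z) /\
  is_derive t (1 : R) (fun t => complex.Im (u t)) (complex.Im z).

Definition cint u : R[i] :=
  (\int[mu]_(t in `[0, 1]) complex.Re (u t)) +i*
  (\int[mu]_(t in `[0, 1]) complex.Im (u t)).

Lemma Re_cint u : complex.Re (cint u) = \int[mu]_(t in `[0, 1]) complex.Re (u t).
Proof. by []. Qed.
Lemma Im_cint u : complex.Im (cint u) = \int[mu]_(t in `[0, 1]) complex.Im (u t).
Proof. by []. Qed.

Lemma contC_cst c : contC (fun=> c).
Proof. by split; exact: cst_continuous. Qed.

Lemma contCD u v : contC u -> contC v -> contC (fun t => u t + v t).
Proof.
move=> [ur ui] [vr vi]; split => t.
  rewrite (funext (fun t => ReDc (u t) (v t))).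
  by apply: cvgD; [exact: ur|exact: vr].
rewrite (funext (fun t => ImDc (u t) (v t))).
by apply: cvgD; [exact: ui|exact: vi].
Qed.

Lemma contCM u v : contC u -> contC v -> contC (fun t => u t * v t).
Proof.
move=> [ur ui] [vr vi]; split => t.
  rewrite (funext (fun t => ReMc (u t) (v t))).
  by apply: cvgB; apply: cvgM; [exact: ur|exact: vr|exact: ui|exact: vi].
rewrite (funext (fun t => ImMc (u t) (v t))).
by apply: cvgD; apply: cvgM; [exact: ur|exact: vi|exact: ui|exact: vr].
Qed.

Lemma contC_conj u : contC u -> contC (fun t => conjc (u t)).
Proof.
move=> [ur ui]; split => t.
  by rewrite (funext (fun t => cRe_conj (u t))); exact: ur.
by rewrite (funext (fun t => cIm_conj (u t))); apply: cvgN; exact: ui.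
Qed.

Lemma contCB u v : contC u -> contC v -> contC (fun t => u t - v t).
Proof.
move=> cu cv; rewrite (_ : (fun _ => _) = fun t => u t + (-1) * v t).
  by apply: contCD => //; apply: contCM => //; exact: contC_cst.
by apply/funext => t; rewrite mulN1r.
Qed.

Lemma derivable_continuousR (f : R -> R) t : derivable f t 1 -> {for t, continuous f}.
Proof. by move=> /derivable1_diffP /differentiable_continuous. Qed.

Lemma is_cder_cont u : (forall t, exists z, is_cder u t z) -> contC u.
Proof.
move=> h; split => t; have [z [[ur _] [ui _]]] := h t.
  exact (derivable_continuousR ur).
exact (derivable_continuousR ui).
Qed.

Lemma is_cder_cst c t : is_cder (fun=> c) t 0.
Proof. by split; exact: is_derive_cst. Qed.

Lemma is_cderD u v t z c : is_cder u t z -> is_cder v t c ->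
  is_cder (fun t => u t + v t) t (z + c).
Proof.
move=> [ur ui] [vr vi]; split.
  by rewrite (funext (fun t => ReDc (u t) (v t))) ReDc; exact: is_deriveD.
by rewrite (funext (fun t => ImDc (u t) (v t))) ImDc; exact: is_deriveD.
Qed.

Lemma is_cderM u v t z c : is_cder u t z -> is_cder v t c ->
  is_cder (fun t => u t * v t) t (z * v t + u t * c).
Proof.
move=> [ur ui] [vr vi]; split.
  rewrite (funext (fun t => ReMc (u t) (v t))).
  by apply: is_derive_eq; rewrite /GRing.scale /= !reimE; ring.
rewrite (funext (fun t => ImMc (u t) (v t))).
by apply: is_derive_eq; rewrite /GRing.scale /= !reimE; ring.
Qed.

Lemma is_cderZ u t z c : is_cder u t z -> is_cder (fun t => c * u t) t (c * z).
Proof.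
move=> h; have := is_cderM (is_cder_cst c t) h.
by rewrite mul0r add0r.
Qed.

Definition ez n t : R[i] := e2pi (n%:~R * t%:C).

Lemma ezE n t : ez n t = cos (2 * pi * (n%:~R * t)) +i* sin (2 * pi * (n%:~R * t)).
Proof. by rewrite -e2pi_real rmorphM /= rmorph_int. Qed.

Lemma ezD n m t : ez (n + m) t = ez n t * ez m t.
Proof. by rewrite /ez rmorphD mulrDl e2piD. Qed.

Lemma ez0 t : ez 0 t = 1.
Proof. by rewrite /ez mul0r e2pi0. Qed.

Lemma ez_conj n t : conjc (ez n t) = ez (- n) t.
Proof.
rewrite /ez e2pi_conj; congr e2pi.
by apply: complex_eqP; rewrite !reimE rmorphN /=; ring.
Qed.

Lemma ez_add1 n t : ez n (t + 1) = ez n t.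
Proof.
rewrite /ez rmorphD /= mulrDr e2piD mulr1.
by rewrite e2pi_int mulr1.
Qed.

Lemma norm_ez n t : `|ez n t| = 1.
Proof. by rewrite /ez norm_e2pi !reimE mulr0 mul0r addr0 mulr0 oppr0 expR0. Qed.

Definition twopi_i : R[i] := 0 +i* (2 * pi).

Lemma Re_twopi_i : complex.Re twopi_i = 0. Proof. by []. Qed.
Lemma Im_twopi_i : complex.Im twopi_i = 2 * pi. Proof. by []. Qed.
Lemma Re_ez n t : complex.Re (ez n t) = cos (2 * pi * (n%:~R * t)).
Proof. by rewrite ezE. Qed.
Lemma Im_ez n t : complex.Im (ez n t) = sin (2 * pi * (n%:~R * t)).
Proof. by rewrite ezE. Qed.

Lemma is_cder_ez n t : is_cder (ez n) t (twopi_i * n%:~R * ez n t).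
Proof.
have d1 : is_derive t (1 : R) (fun t : R => 2 * pi * (n%:~R * t)) (2 * pi * n%:~R).
  by apply: is_derive_eq; rewrite /GRing.scale /=; ring.
have dc := @is_derive1_comp R cos _ t _ _ (is_derive_cos _) d1.
have ds := @is_derive1_comp R sin _ t _ _ (is_derive_sin _) d1.
split.
  rewrite (funext (Re_ez n)).
  apply: (@is_derive_eq _ _ _ _ _ _ _ _ dc).
  by rewrite (ReMc (_ * _) (ez n t)) (ReMc twopi_i) (ImMc twopi_i) Re_twopi_i Im_twopi_i Reint Imint Re_ez Im_ez; ring.
rewrite (funext (Im_ez n)).
apply: (@is_derive_eq _ _ _ _ _ _ _ _ ds).
by rewrite (ImMc (_ * _) (ez n t)) (ReMc twopi_i) (ImMc twopi_i) Re_twopi_i Im_twopi_i Reint Imint Re_ez Im_ez; ring.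
Qed.

Lemma contC_ez n : contC (ez n).
Proof. by apply: is_cder_cont => t; exists (twopi_i * n%:~R * ez n t); exact: is_cder_ez. Qed.

Let cont_integrable (f : R -> R) : continuous f ->
  mu.-integrable `[0, 1] (EFin \o f).
Proof.
move=> cf; apply: continuous_compact_integrable; first exact: segment_compact.
exact: continuous_subspaceT.
Qed.

Lemma cintD u v : contC u -> contC v ->
  cint (fun t => u t + v t) = cint u + cint v.
Proof.
move=> [ur ui] [vr vi]; apply: complex_eqP.
  rewrite ReDc !Re_cint (funext (fun t => ReDc (u t) (v t))).
  by rewrite RintegralD //; exact: cont_integrable.
rewrite ImDc !Im_cint (funext (fun t => ImDc (u t) (v t))).
by rewrite RintegralD //; exact: cont_integrable.
Qed.

Lemma cintZ c u : contC u -> cint (fun t => c * u t) = c * cint u.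
Proof.
move=> [ur ui]; have cZ (a : R) (f : R -> R) : continuous f -> continuous (fun t => a * f t).
  by move=> cf t; apply: cvgM; [exact: cvg_cst|exact: cf].
apply: complex_eqP.
  rewrite (ReMc c) !Re_cint Im_cint (funext (fun t => ReMc c (u t))).
  rewrite RintegralB //; try by apply: cont_integrable; exact: cZ.
  by rewrite !RintegralZl //; exact: cont_integrable.
rewrite (ImMc c) !Im_cint Re_cint (funext (fun t => ImMc c (u t))).
rewrite RintegralD //; try by apply: cont_integrable; exact: cZ.
by rewrite !RintegralZl //; exact: cont_integrable.
Qed.

Lemma cint_conj u : contC u -> cint (fun t => conjc (u t)) = conjc (cint u).
Proof.
move=> [ur ui]; apply: complex_eqP.
  by rewrite cRe_conj !Re_cint (funext (fun t => cRe_conj (u t))).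
rewrite cIm_conj !Im_cint (funext (fun t => cIm_conj (u t))).
rewrite -[in RHS]mulN1r -RintegralZl //; last exact: cont_integrable.
by apply: eq_Rintegral => t _; rewrite mulN1r.
Qed.

Lemma eq_cint u v : u =1 v -> cint u = cint v.
Proof. by move=> /funext ->. Qed.

Lemma cint_bound u (B : R) : contC u -> (forall t, 0 <= t <= 1 -> `|u t| <= B%:C) ->
  `|cint u| <= (2 * B)%:C.
Proof.
move=> [ur ui] hB.
have bound (f : R -> R) : continuous f -> (forall t, 0 <= t <= 1 -> `|f t| <= B) ->
    `|\int[mu]_(t in `[0, 1]) f t| <= B.
  move=> cf fB; apply: le_trans (le_normr_Rintegral _ _) _ => //.
    exact: cont_integrable.
  apply: (@le_trans _ _ (\int[mu]_(t in `[0, 1]) B)).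
    apply: le_Rintegral => //.
    - by apply: (cont_integrable (f := fun t => `|f t|)) => t; apply: cvg_norm; exact: cf.
    - by apply: (cont_integrable (f := fun=> B)); exact: cst_continuous.
  have mu01 : (mu `[0%R, 1%R] = 1)%E.
    by rewrite lebesgue_measure_itv /= lte_fin ltr01 -EFinD oppr0 addr0.
  rewrite Rintegral_cst //; have f1 := congr1 fine mu01.
  by rewrite (_ : fine _ = 1) ?mulr1 //; exact f1.
apply: le_trans (normc_le_ReIm _) _; rewrite lecR mulr_natl mulr2n; apply: lerD.
  apply: bound => // t /hB h; rewrite -lecR; exact: le_trans (normc_ge_Re _) h.
apply: bound => // t /hB h; rewrite -lecR.
exact: le_trans (normc_ge_Im _) h.
Qed.

Lemma cint_der u v : (forall t, is_cder u t (v t)) -> contC v ->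
  cint v = u 1 - u 0.
Proof.
move=> du [vr vi].
have ftc (f df : R -> R) : (forall t, is_derive t (1 : R) f (df t)) -> continuous df ->
    \int[mu]_(t in `[0, 1]) df t = f 1 - f 0.
  move=> hf cdf; have cf t : {for t, continuous f}.
    apply: differentiable_continuous; apply/derivable1_diffP.
    by have [] := hf t.
  rewrite /Rintegral (@continuous_FTC2 R df f 0 1) //.
  - exact: continuous_subspaceT.
  - split.
    + by move=> t _; have [] := hf t.
    + exact: cvg_at_right_filter (cf 0).
    + exact: cvg_at_left_filter (cf 1).
  - by move=> t _; rewrite derive1E; have [] := hf t.
apply: complex_eqP.
  rewrite Re_cint ReDc ReNc.
  by apply: (ftc (fun t => complex.Re (u t))) => // t; have [] := du t.
rewrite Im_cint ImDc ImNc.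
by apply: (ftc (fun t => complex.Im (u t))) => // t; have [] := du t.
Qed.

End ComplexValued.

Section Fourier.
Variable R : realType.
Implicit Types (u v w g h : R -> R[i]) (t x : R) (c z : R[i]) (n m : int).

Definition fcoef g n : R[i] := cint (fun t => g t * @ez R (- n) t).

Lemma contC_fcoef g n : contC g -> contC (fun t => g t * @ez R (- n) t).
Proof. by move=> cg; apply: contCM => //; exact: contC_ez. Qed.

Lemma fcoefD g h n : contC g -> contC h ->
  fcoef (fun t => g t + h t) n = fcoef g n + fcoef h n.
Proof.
move=> cg ch; rewrite /fcoef -cintD; [|exact: contC_fcoef..].
by apply: eq_cint => t; rewrite mulrDl.
Qed.

Lemma fcoefZ c g n : contC g -> fcoef (fun t => c * g t) n = c * fcoef g n.
Proof.
move=> cg; rewrite /fcoef -cintZ; last exact: contC_fcoef.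
by apply: eq_cint => t; rewrite mulrA.
Qed.

Lemma twopi_i_neq0 : twopi_i R != 0.
Proof.
apply/eqP => /(congr1 (@complex.Im R)); rewrite Im_twopi_i /=.
by have := pi_gt0 R; lra.
Qed.

Lemma cint_ez n : cint (@ez R n) = (n == 0)%:R.
Proof.
have [->|n0] := eqVneq n 0.
  rewrite (eq_cint (v := fun=> 1)); last by move=> t; rewrite ez0.
  have := @cint_der R (fun t => t%:C) (fun=> 1).
  rewrite subr0; apply; last exact: contC_cst.
  by move=> t; split; rewrite /=; [exact: is_derive_id|exact: is_derive_cst].
have c0 : twopi_i R * n%:~R != 0 by rewrite mulf_neq0 ?twopi_i_neq0 // intr_eq0.
apply: (mulfI c0); rewrite mulr0 -cintZ; last exact: contC_ez.
rewrite (@cint_der R (@ez R n)); first by rewrite -[1]add0r ez_add1 subrr.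
  by move=> t; exact: is_cder_ez.
by apply: contCM; [exact: contC_cst|exact: contC_ez].
Qed.

Lemma fcoef_ez n m : fcoef (@ez R m) n = (m == n)%:R.
Proof.
rewrite /fcoef (eq_cint (v := @ez R (m - n))); last by move=> t; rewrite ezD.
by rewrite cint_ez subr_eq0.
Qed.

(** Integration by parts: the boundary terms cancel by periodicity. *)
Lemma fcoef_der g h n : (forall t, is_cder g t (h t)) -> contC h ->
  g 1 = g 0 -> fcoef h n = twopi_i R * n%:~R * fcoef g n.
Proof.
move=> dg ch g10; have cg : contC g by apply: is_cder_cont => t; exists (h t).
have d t : is_cder (fun t => g t * @ez R (- n) t) t
    (h t * @ez R (- n) t + g t * (twopi_i R * (- n)%:~R * @ez R (- n) t)).
  by apply: is_cderM; [exact: dg|exact: is_cder_ez].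
have c2 : contC (fun t => g t * (twopi_i R * (- n)%:~R * @ez R (- n) t)).
  apply: contCM => //; apply: contCM; [exact: contC_cst|exact: contC_ez].
have := cint_der d (contCD (contC_fcoef n ch) c2).
have e1 : ez (- n) 1 = ez (- n) 0 :> R[i] by rewrite -(ez_add1 (- n) 0) add0r.
rewrite g10 e1 subrr cintD //; last exact: contC_fcoef.
rewrite -/(fcoef h n) (eq_cint (v := fun t => - (twopi_i R * n%:~R) * (g t * @ez R (- n) t))).
  rewrite cintZ; last exact: contC_fcoef.
  by rewrite mulNr => /eqP; rewrite subr_eq0 => /eqP.
by move=> t; rewrite rmorphN /=; ring.
Qed.

Definition energy h : R := complex.Re (cint (fun t => h t * conjc (h t))).

Definition sqnorm z : R := complex.Re z ^+ 2 + complex.Im z ^+ 2.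

Lemma mulJ z : z * conjc z = (sqnorm z)%:C.
Proof. by apply: complex_eqP; rewrite !reimE /sqnorm; ring. Qed.

Lemma energy_ge0 h : 0 <= energy h.
Proof.
apply: Rintegral_ge0 => t _; rewrite mulJ /=.
by rewrite addr_ge0 ?sqr_ge0.
Qed.

(** Bessel's inequality: removing one frequency [n] from [h]
    lowers the energy by [|fcoef h n| ^ 2] and leaves the other coefficients
    unchanged. *)
Lemma bessel h (s : seq int) : contC h -> uniq s ->
  \sum_(n <- s) sqnorm (fcoef h n) <= energy h.
Proof.
elim: s h => [|n s IH] h ch /=; first by rewrite big_nil energy_ge0.
move=> /andP [ns us]; rewrite big_cons; set c := fcoef h n.
pose h' t := h t + (- c) * @ez R n t.
have ce : contC (fun t => (- c) * @ez R n t).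
  by apply: contCM; [exact: contC_cst|exact: contC_ez].
have ch' : contC h' by exact: contCD.
have coef m : m != n -> fcoef h' m = fcoef h m.
  move=> mn; rewrite /h' fcoefD // fcoefZ; last exact: contC_ez.
  by rewrite fcoef_ez eq_sym (negPf mn) mulr0 addr0.
have cu : contC (fun t => h t * @ez R (- n) t) by exact: contC_fcoef.
have cj := contC_conj cu; have chh := contCM ch (contC_conj ch).
have c1 : contC (fun t => - conjc c * (h t * @ez R (- n) t)).
  by apply: contCM => //; exact: contC_cst.
have c2 : contC (fun t => - c * conjc (h t * @ez R (- n) t)).
  by apply: contCM => //; exact: contC_cst.
have c3 : contC (fun t : R => c * conjc c * ez 0 t).
  by apply: contCM; [exact: contC_cst|exact: contC_ez].
have e1 : cint (fun t => h' t * conjc (h' t)) =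
    cint (fun t => h t * conjc (h t)) - (sqnorm c)%:C.
  rewrite (eq_cint (v := fun t => h t * conjc (h t) + (- conjc c * (h t * @ez R (- n) t) +
      (- c * conjc (h t * @ez R (- n) t) + c * conjc c * ez 0 t)))).
    have c23 := contCD c2 c3; have c123 := contCD c1 c23.
    rewrite (cintD chh c123) (cintD c1 c23) (cintD c2 c3) (cintZ _ cu) (cintZ _ cj).
    rewrite (cintZ _ (@contC_ez R 0)) (cint_conj cu) cint_ez eqxx mulr1 -/(fcoef h n) -/c -mulJ.
    by ring.
  move=> t.
  have e1 : conjc (h' t) = conjc (h t) + (- conjc c) * ez (- n) t.
    by rewrite rmorphD rmorphM rmorphN; congr (_ + _ * _); exact: ez_conj.
  have e2 : conjc (h t * ez (- n) t) = conjc (h t) * ez n t.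
    by rewrite rmorphM; congr (_ * _); rewrite -[n in RHS]opprK; exact: ez_conj.
  have e3 : ez 0 t = ez n t * ez (- n) t :> R[i] by rewrite -ezD subrr.
  rewrite e1 e2 e3 /h'.
  generalize (conjc (h t)) (h t) (ez n t : R[i]) (ez (- n) t : R[i]) (conjc c) => a1 a2 a3 a4 a5.
  by ring.
have -> : energy h = sqnorm c + energy h'.
  rewrite /energy e1; generalize (cint (fun t => h t * conjc (h t))) (sqnorm c) => z r.
  by rewrite ReDc ReNc ReR addrC subrK.
rewrite lerD2l; apply: le_trans (IH h' ch' us).
by rewrite le_eqVlt; apply/orP; left; apply/eqP/eq_big_seq => m ms;
  rewrite coef //; apply: contraNneq ns => <-.
Qed.

(** By Bessel's inequality the squares of the coefficients form a convergent
    series, so that they tend to zero. *)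
Lemma riemann_lebesgue h (k : nat -> int) : contC h -> injective k ->
  (fcoef h (k j) : R[i]^o) @[j --> \oo] --> (0 : R[i]^o).
Proof.
move=> ch ki; pose a j := sqnorm (fcoef h (k j)).
have a0 j : 0 <= a j by rewrite addr_ge0 ?sqr_ge0.
have bnd N : series a N <= energy h.
  rewrite /series /= big_mkord -(big_mkord xpredT (fun j => sqnorm (fcoef h (k j)))).
  rewrite -(big_map k xpredT (fun n => sqnorm (fcoef h n))).
  by apply: bessel => //; rewrite map_inj_uniq // iota_uniq.
have cv : cvgn (series a).
  apply: nondecreasing_is_cvgn.
    by apply/nondecreasing_seqP => j; rewrite seriesSr lerDl.
  by exists (energy h) => _ [N _ <-].
have acv := cvg_series_cvg_0 cv.
have sq (f : R[i] -> R) : (forall z, f z ^+ 2 <= sqnorm z) ->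
    f (fcoef h (k j)) @[j --> \oo] --> (0 : R).
  move=> hf; apply/cvgrPdist_lt => e e0.
  have e2 : 0 < e ^+ 2 by rewrite exprn_gt0.
  move/cvgrPdist_lt/(_ _ e2) : acv; apply: filterS => j.
  rewrite !sub0r !normrN ger0_norm // => hj.
  have := real_normK (num_real (f (fcoef h (k j)))); have := hf (fcoef h (k j)).
  rewrite -/(a j) !expr2 in e2 hj *; move: (f _) => F; move: `|F| => N hF eN.
  by rewrite ltNge; apply/negP => he; nra.
apply: cvgC_ReIm.
  by apply: (sq (@complex.Re R)) => z; rewrite lerDl sqr_ge0.
by apply: (sq (@complex.Im R)) => z; rewrite lerDr sqr_ge0.
Qed.

End Fourier.

(** * Differential operators on the upper half plane *)


Section ComplexDerivatives.
Variable R : realType.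
Implicit Types (u v : R -> R[i]) (t a b : R) (z w : R[i]).

Lemma is_cder_unique u t z w : is_cder u t z -> is_cder u t w -> z = w.
Proof.
move=> [ur ui] [vr vi]; apply: complex_eqP.
  by rewrite -(@derive_val _ _ _ _ _ _ _ ur) (@derive_val _ _ _ _ _ _ _ vr).
by rewrite -(@derive_val _ _ _ _ _ _ _ ui) (@derive_val _ _ _ _ _ _ _ vi).
Qed.

Lemma is_cder_affine u a b t z : is_cder u (a * t + b) z ->
  is_cder (fun s => u (a * s + b)) t (a%:C * z).
Proof.
have d : is_derive t (1 : R) (fun s : R => a * s + b) a.
  by apply: is_derive_eq; rewrite /GRing.scale /=; ring.
move=> [ur ui]; split.
  have := @is_derive1_comp R (fun s => complex.Re (u s)) (fun s => a * s + b) t _ _ ur d.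
  by rewrite ReMc ReR ImR mul0r subr0 mulrC.
have := @is_derive1_comp R (fun s => complex.Im (u s)) (fun s => a * s + b) t _ _ ui d.
by rewrite ImMc ReR ImR mul0r addr0 mulrC.
Qed.

Lemma near_eq_is_cder u v t z : (\forall s \near t, u s = v s) ->
  is_cder u t z -> is_cder v t z.
Proof.
move=> e [ur ui]; split.
  by apply: near_eq_is_derive ur; apply: filterS e => s ->.
by apply: near_eq_is_derive ui; apply: filterS e => s ->.
Qed.

Lemma near_eq_continuous (u v : R * R -> R) (z : R * R) :
  (\forall t \near z, u t = v t) -> {for z, continuous u} -> {for z, continuous v}.
Proof.
move=> h hu; rewrite /prop_for /continuous_at -(nbhs_singleton h).
by apply: cvg_trans hu; apply: near_eq_cvg; apply: filterS h => t ->.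
Qed.

End ComplexDerivatives.

Section SmoothClosure.
Variable R : realType.
Implicit Types (f g : uhp R -> R[i]) (tau : uhp R) (c : R[i]).

Definition lincomb c f g : uhp R -> R[i] := fun tau => c * f tau + g tau.

Let re c f g x y : complex.Re (at_xy (lincomb c f g) x y) =
  complex.Re c * complex.Re (at_xy f x y) +
  - complex.Im c * complex.Im (at_xy f x y) + complex.Re (at_xy g x y).
Proof. by rewrite /at_xy /lincomb !reimE mulNr. Qed.

Let im c f g x y : complex.Im (at_xy (lincomb c f g) x y) =
  complex.Re c * complex.Im (at_xy f x y) +
  complex.Im c * complex.Re (at_xy f x y) + complex.Im (at_xy g x y).
Proof. by rewrite /at_xy /lincomb !reimE. Qed.

Lemma derivable_x_cder f tau : derivable_x f tau ->
  is_cder (fun x => at_xy f x (ycoord tau)) (xcoord tau) (dx f tau).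
Proof.
by move=> [hr hi]; split; [exact (DeriveDef hr (esym (derive1E _ _)))|exact (DeriveDef hi (esym (derive1E _ _)))].
Qed.

Lemma derivable_y_cder f tau : derivable_y f tau ->
  is_cder (fun y => at_xy f (xcoord tau) y) (ycoord tau) (dy f tau).
Proof.
by move=> [hr hi]; split; [exact (DeriveDef hr (esym (derive1E _ _)))|exact (DeriveDef hi (esym (derive1E _ _)))].
Qed.

Lemma cder_derivable_x f tau z :
  is_cder (fun x => at_xy f x (ycoord tau)) (xcoord tau) z ->
  derivable_x f tau /\ dx f tau = z.
Proof.
move=> h; have hx : derivable_x f tau.
  by case: h => -[hr _] [hi _]; exact (conj hr hi).
by split => //; exact: is_cder_unique (derivable_x_cder hx) h.
Qed.

Lemma cder_derivable_y f tau z :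
  is_cder (fun y => at_xy f (xcoord tau) y) (ycoord tau) z ->
  derivable_y f tau /\ dy f tau = z.
Proof.
move=> h; have hy : derivable_y f tau.
  by case: h => -[hr _] [hi _]; exact (conj hr hi).
by split => //; exact: is_cder_unique (derivable_y_cder hy) h.
Qed.

Lemma derivable_x_lin c f g tau : derivable_x f tau -> derivable_x g tau ->
  derivable_x (lincomb c f g) tau /\
  dx (lincomb c f g) tau = c * dx f tau + dx g tau.
Proof.
move=> /derivable_x_cder hf /derivable_x_cder hg; apply: cder_derivable_x.
exact: is_cderD (is_cderZ c hf) hg.
Qed.

Lemma derivable_y_lin c f g tau : derivable_y f tau -> derivable_y g tau ->
  derivable_y (lincomb c f g) tau /\
  dy (lincomb c f g) tau = c * dy f tau + dy g tau.
Proof.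
move=> /derivable_y_cder hf /derivable_y_cder hg; apply: cder_derivable_y.
exact: is_cderD (is_cderZ c hf) hg.
Qed.

Lemma continuous_uhp_lin c f g : continuous_uhp f -> continuous_uhp g ->
  continuous_uhp (lincomb c f g).
Proof.
move=> hf hg tau; have [fr fi] := hf tau; have [gr gi] := hg tau.
split.
  rewrite (funext (fun z : R * R => re c f g z.1 z.2)).
  by apply: cvgD gr; apply: cvgD; apply: cvgM; try exact: cvg_cst.
rewrite (funext (fun z : R * R => im c f g z.1 z.2)).
by apply: cvgD gi; apply: cvgD; apply: cvgM; try exact: cvg_cst.
Qed.

Lemma Cn_lin n c f g : Cn n f -> Cn n g -> Cn n (lincomb c f g).
Proof.
elim: n f g => [|n IH] f g /= [fc hf] [gc hg].
  by split; [exact: continuous_uhp_lin|].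
split; first exact: continuous_uhp_lin.
case: hf => fx fy cfx cfy; case: hg => gx gy cgx cgy; split.
- by move=> tau; have [] := derivable_x_lin c (fx tau) (gx tau).
- by move=> tau; have [] := derivable_y_lin c (fy tau) (gy tau).
- rewrite (_ : dx _ = lincomb c (dx f) (dx g)); first exact: IH.
  by apply/funext => tau; have [] := derivable_x_lin c (fx tau) (gx tau).
- rewrite (_ : dy _ = lincomb c (dy f) (dy g)); first exact: IH.
  by apply/funext => tau; have [] := derivable_y_lin c (fy tau) (gy tau).
Qed.

Lemma smooth_lin c f g : smooth f -> smooth g -> smooth (lincomb c f g).
Proof. by move=> hf hg n; exact: Cn_lin. Qed.

Lemma smooth_dx f : smooth f -> smooth (dx f).
Proof. by move=> hf n; have [_ []] := hf n.+1. Qed.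

Lemma smooth_dy f : smooth f -> smooth (dy f).
Proof. by move=> hf n; have [_ []] := hf n.+1. Qed.

Lemma smooth_derx f tau : smooth f -> derivable_x f tau.
Proof. by move=> /(_ 1%N) [_ []]. Qed.

Lemma smooth_dery f tau : smooth f -> derivable_y f tau.
Proof. by move=> /(_ 1%N) [_ []]. Qed.

Lemma dx_lin c f g : smooth f -> smooth g ->
  dx (lincomb c f g) = lincomb c (dx f) (dx g).
Proof.
move=> hf hg; apply/funext => tau.
by have [] := derivable_x_lin c (smooth_derx tau hf) (smooth_derx tau hg).
Qed.

Lemma dy_lin c f g : smooth f -> smooth g ->
  dy (lincomb c f g) = lincomb c (dy f) (dy g).
Proof.
move=> hf hg; apply/funext => tau.
by have [] := derivable_y_lin c (smooth_dery tau hf) (smooth_dery tau hg).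
Qed.

Lemma Delta_lin k c f g tau : smooth f -> smooth g ->
  Delta k (lincomb c f g) tau = c * Delta k f tau + Delta k g tau.
Proof.
move=> hf hg; have hfx := smooth_dx hf; have hfy := smooth_dy hf.
have hgx := smooth_dx hg; have hgy := smooth_dy hg.
rewrite /Delta (dx_lin c hf hg) (dx_lin c hfx hgx) (dy_lin c hf hg).
rewrite (dy_lin c hfy hgy) /lincomb.
generalize (dx (dx f) tau) (dy (dy f) tau) (dx f tau) (dy f tau)
  (dx (dx g) tau) (dy (dy g) tau) (dx g tau) (dy g tau).
generalize (((ycoord tau) ^+ 2)%:C) ((ycoord tau)%:C) (k%:~R : R[i]) ('i : R[i]).
by move=> *; ring.
Qed.

Lemma at_xy_uaff f (a b x y : R) : 0 < a -> 0 < y ->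
  at_xy (f \o uaff a b) x y = at_xy f (a * x + b) (a * y).
Proof.
move=> a0 y0; rewrite /at_xy /=; congr f; apply: uhpP.
rewrite val_uaff // !to_uhpK ?mulr_gt0 //.
by apply: complex_eqP; rewrite !reimE; ring.
Qed.

Lemma near_ycoord tau : \forall y \near ycoord tau, 0 < y.
Proof. exact: (lt_nbhsr (ycoord_gt0 tau)). Qed.

Lemma derivable_x_uaff f (a b : R) tau : 0 < a -> derivable_x f (uaff a b tau) ->
  derivable_x (f \o uaff a b) tau /\
  dx (f \o uaff a b) tau = a%:C * dx f (uaff a b tau).
Proof.
move=> a0 /derivable_x_cder; rewrite (xcoord_uaff b tau a0) (ycoord_uaff b tau a0).
move=> /is_cder_affine h; apply: cder_derivable_x.
by rewrite (funext (fun x => at_xy_uaff f b x a0 (ycoord_gt0 tau))).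
Qed.

Lemma derivable_y_uaff f (a b : R) tau : 0 < a -> derivable_y f (uaff a b tau) ->
  derivable_y (f \o uaff a b) tau /\
  dy (f \o uaff a b) tau = a%:C * dy f (uaff a b tau).
Proof.
move=> a0 /derivable_y_cder; rewrite (xcoord_uaff b tau a0) (ycoord_uaff b tau a0).
rewrite -[a * ycoord tau]addr0 => /is_cder_affine h; apply: cder_derivable_y.
apply: near_eq_is_cder h; apply: filterS (near_ycoord tau) => y y0.
by rewrite at_xy_uaff // addr0.
Qed.

Lemma continuous_uhp_uaff f (a b : R) : 0 < a -> continuous_uhp f ->
  continuous_uhp (f \o uaff a b).
Proof.
move=> a0 hf tau; have [fr fi] := hf (uaff a b tau).
rewrite xcoord_uaff // ycoord_uaff // in fr fi.
have ny : \forall z \near (xcoord tau, ycoord tau), 0 < z.2.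
  have h : (z : R * R).2 @[z --> (xcoord tau, ycoord tau)] --> ycoord tau.
    exact: cvg_snd.
  exact: (h _ (near_ycoord tau)).
have ca : (a * z.1 + b, a * z.2) @[z --> (xcoord tau, ycoord tau)] -->
    (a * xcoord tau + b, a * ycoord tau).
  have c1 : a * (z : R * R).1 + b @[z --> (xcoord tau, ycoord tau)] --> a * xcoord tau + b.
    apply: cvgD; last exact: cvg_cst.
    by apply: cvgM; [exact: cvg_cst|exact: cvg_fst].
  have c2 : a * (z : R * R).2 @[z --> (xcoord tau, ycoord tau)] --> a * ycoord tau.
    by apply: cvgM; [exact: cvg_cst|exact: cvg_snd].
  have FF : Filter (nbhs (xcoord tau, ycoord tau)) by exact: nbhs_filter.
  exact (cvg_pair c1 c2).
split.
  apply: (near_eq_continuous _ (cvg_comp _ _ ca fr)).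
  by apply: filterS ny => z z0; rewrite /= at_xy_uaff.
apply: (near_eq_continuous _ (cvg_comp _ _ ca fi)).
by apply: filterS ny => z z0; rewrite /= at_xy_uaff.
Qed.

Lemma Cn0 n : Cn n (fun _ : uhp R => 0).
Proof.
elim: n => [|n IH] /=.
  by split => // tau; split; exact: cvg_cst.
have dx0 : dx (fun _ : uhp R => 0) = fun _ => 0.
  by apply/funext => tau; rewrite /dx /at_xy /= derive1_cst.
have dy0 : dy (fun _ : uhp R => 0) = fun _ => 0.
  by apply/funext => tau; rewrite /dy /at_xy /= derive1_cst.
rewrite dx0 dy0; split; first by move=> tau; split; exact: cvg_cst.
by split => // tau; split; exact: derivable_cst.
Qed.

Lemma smooth0 : smooth (fun _ : uhp R => 0).
Proof. by move=> n; exact: Cn0. Qed.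

Lemma Cn_scale n c f : Cn n f -> Cn n (fun tau => c * f tau).
Proof.
move=> hf; rewrite (_ : (fun _ => _) = lincomb c f (fun=> 0)).
  by apply: Cn_lin => //; exact: Cn0.
by apply/funext => tau; rewrite /lincomb addr0.
Qed.

Lemma Cn_uaff n f (a b : R) : 0 < a -> Cn n f -> Cn n (f \o uaff a b).
Proof.
move=> a0; elim: n f => [|n IH] f /= [fc hf].
  by split; [exact: continuous_uhp_uaff|].
split; first exact: continuous_uhp_uaff.
case: hf => fx fy cfx cfy; split.
- by move=> tau; have [] := derivable_x_uaff a0 (fx (uaff a b tau)).
- by move=> tau; have [] := derivable_y_uaff a0 (fy (uaff a b tau)).
- rewrite (_ : dx _ = fun tau => a%:C * (dx f \o uaff a b) tau).
    exact: Cn_scale (IH _ cfx).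
  by apply/funext => tau; have [] := derivable_x_uaff a0 (fx (uaff a b tau)).
- rewrite (_ : dy _ = fun tau => a%:C * (dy f \o uaff a b) tau).
    exact: Cn_scale (IH _ cfy).
  by apply/funext => tau; have [] := derivable_y_uaff a0 (fy (uaff a b tau)).
Qed.

Lemma smooth_uaff f (a b : R) : 0 < a -> smooth f -> smooth (f \o uaff a b).
Proof. by move=> a0 hf n; exact: Cn_uaff. Qed.

Lemma smooth_scale c f : smooth f -> smooth (fun tau => c * f tau).
Proof. by move=> hf n; exact: Cn_scale. Qed.

Lemma dx_uaff f (a b : R) : 0 < a -> smooth f ->
  dx (f \o uaff a b) = fun tau => a%:C * (dx f \o uaff a b) tau.
Proof.
move=> a0 hf; apply/funext => tau.
by have [] := derivable_x_uaff a0 (smooth_derx (uaff a b tau) hf).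
Qed.

Lemma dy_uaff f (a b : R) : 0 < a -> smooth f ->
  dy (f \o uaff a b) = fun tau => a%:C * (dy f \o uaff a b) tau.
Proof.
move=> a0 hf; apply/funext => tau.
by have [] := derivable_y_uaff a0 (smooth_dery (uaff a b tau) hf).
Qed.

Lemma dx0 : dx (fun _ : uhp R => 0) = fun _ => 0.
Proof. by apply/funext => tau; rewrite /dx /at_xy /= derive1_cst. Qed.

Lemma dy0 : dy (fun _ : uhp R => 0) = fun _ => 0.
Proof. by apply/funext => tau; rewrite /dy /at_xy /= derive1_cst. Qed.

Lemma Delta0 k tau : Delta k (fun _ : uhp R => 0) tau = 0.
Proof. by rewrite /Delta !(dx0, dy0, mulr0, addr0). Qed.

Lemma scale_lincomb c f : (fun tau => c * f tau) = lincomb c f (fun=> 0).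
Proof. by apply/funext => tau; rewrite /lincomb addr0. Qed.

Lemma Delta_scale k c f tau : smooth f ->
  Delta k (fun tau => c * f tau) tau = c * Delta k f tau.
Proof.
by move=> hf; rewrite scale_lincomb (Delta_lin k c tau hf smooth0) Delta0 addr0.
Qed.

(** [Delta_k] commutes with the affine maps: each derivative contributes a
    factor [a], and so does each power of [y]. *)
Lemma Delta_uaff k f (a b : R) tau : 0 < a -> smooth f ->
  Delta k (f \o uaff a b) tau = Delta k f (uaff a b tau).
Proof.
move=> a0 hf; have hx := smooth_dx hf; have hy := smooth_dy hf.
have dxs g : smooth g -> dx (fun tau => a%:C * (g \o uaff a b) tau) =
    fun tau => a%:C * (a%:C * (dx g \o uaff a b) tau).
  move=> hg; rewrite scale_lincomb (dx_lin a%:C (smooth_uaff b a0 hg) smooth0).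
  by rewrite dx0 dx_uaff // -scale_lincomb.
have dys g : smooth g -> dy (fun tau => a%:C * (g \o uaff a b) tau) =
    fun tau => a%:C * (a%:C * (dy g \o uaff a b) tau).
  move=> hg; rewrite scale_lincomb (dy_lin a%:C (smooth_uaff b a0 hg) smooth0).
  by rewrite dy0 dy_uaff // -scale_lincomb.
rewrite /Delta (dx_uaff b a0 hf) (dy_uaff b a0 hf) (dxs _ hx) (dys _ hy).
rewrite (ycoord_uaff b tau a0) /comp.
generalize (dx (dx f) (uaff a b tau)) (dy (dy f) (uaff a b tau))
  (dx f (uaff a b tau)) (dy f (uaff a b tau)) (ycoord tau) => X Y Z W y.
have -> : ((a * y) ^+ 2)%:C = a%:C ^+ 2 * (y ^+ 2)%:C by rewrite exprMn rmorphM rmorphXn.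
have -> : (a * y)%:C = a%:C * y%:C by rewrite rmorphM.
generalize (a%:C) ((y ^+ 2)%:C) (y%:C) (k%:~R : R[i]) ('i : R[i]) => A B C K I.
by ring.
Qed.

Section Sums.
Variables (I : eqType) (r : seq I) (c : I -> R[i]) (f : I -> uhp R -> R[i]).
Hypothesis hf : forall i, i \in r -> smooth (f i).

Lemma smooth_sum : smooth (fun tau => \sum_(i <- r) c i * f i tau).
Proof.
elim: r hf => [|i s IH] h.
  by rewrite (_ : (fun _ => _) = fun=> 0); [exact: smooth0|apply/funext => tau; rewrite big_nil].
rewrite (_ : (fun _ => _) = lincomb (c i) (f i) (fun tau => \sum_(i <- s) c i * f i tau)).
  apply: smooth_lin; first by apply: h; rewrite mem_head.
  by apply: IH => j js; apply: h; rewrite in_cons js orbT.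
by apply/funext => tau; rewrite big_cons.
Qed.

End Sums.

Lemma Delta_sum (I : eqType) k (r : seq I) (c : I -> R[i]) (f : I -> uhp R -> R[i]) :
  (forall i, i \in r -> smooth (f i)) ->
  (forall i, i \in r -> forall tau, Delta k (f i) tau = 0) ->
  forall tau, Delta k (fun tau => \sum_(i <- r) c i * f i tau) tau = 0.
Proof.
elim: r => [|i s IH] h hD tau.
  rewrite (_ : (fun _ => _) = fun=> 0); first exact: Delta0.
  by apply/funext => t; rewrite big_nil.
rewrite (_ : (fun _ => _) = lincomb (c i) (f i) (fun tau => \sum_(i <- s) c i * f i tau)).
  rewrite Delta_lin; first last.
  - by apply: smooth_sum => j js; apply: h; rewrite in_cons js orbT.
  - by apply: h; rewrite mem_head.
  rewrite hD ?mem_head // mulr0 add0r; apply: IH => j js.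
    by apply: h; rewrite in_cons js orbT.
  by apply: hD; rewrite in_cons js orbT.
by apply/funext => t; rewrite big_cons.
Qed.

End SmoothClosure.

(** * Principal parts *)


Section PrincipalParts.
Variable R : realType.
Implicit Types (f g : uhp R -> R[i]) (tau : uhp R) (c : R[i]) (E : set rat).

Definition fourier_poly (P : seq (rat * R[i])) tau : R[i] :=
  \sum_(rc <- P) rc.2 * e2pi (ratr rc.1 * val tau).

Lemma normcE_real (z : R[i]) : exists2 m : R, 0 <= m & `|z| = m%:C.
Proof.
have : 0 <= `|z| by [].
by case: `|z| => a b; rewrite lecE /= => /andP [/eqP -> a0]; exists a.
Qed.

Lemma principal_part_lin E c f g : has_principal_part E f ->
  has_principal_part E g -> has_principal_part E (fun tau => c * f tau + g tau).
Proof.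
move=> [P [hP [e1 [B1 [y1 [e10 h1]]]]]] [P' [hP' [e2 [B2 [y2 [e20 h2]]]]]].
exists ([seq (rc.1, c * rc.2) | rc <- P] ++ P'); split.
  move=> rc; rewrite mem_cat => /orP [/mapP [rc' /hP [? ?] -> //]|]; exact: hP'.
have [m m0 em] := normcE_real c.
pose e := Num.min e1 e2.
exists e, (m * `|B1| + `|B2|), (Num.max (Num.max y1 y2) 0); split.
  by rewrite lt_min e10.
move=> tau; rewrite !ge_max => /andP [/andP [t1 t2] t0].
rewrite big_cat big_map /=.
rewrite (_ : _ - _ = c * (f tau - fourier_poly P tau) + (g tau - fourier_poly P' tau)); last first.
  rewrite mulrBr [c * fourier_poly _ _]mulr_sumr opprD addrACA; congr (_ - _ + _).
  by apply: eq_bigr => rc _; rewrite mulrA.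
apply: (le_trans (ler_normD _ _)); rewrite normrM em mulrDl rmorphD; apply: lerD.
  rewrite -mulrA rmorphM ler_wpM2l ?ler0c //; apply: (le_trans (h1 tau t1)).
  rewrite lecR; apply: (@le_trans _ _ (`|B1| * expR (- e1 * ycoord tau))).
    by rewrite ler_wpM2r ?expR_ge0 ?ler_norm.
  by rewrite ler_wpM2l // ler_expR !mulNr lerN2 ler_wpM2r // ge_min lexx.
apply: (le_trans (h2 tau t2)).
rewrite lecR; apply: (@le_trans _ _ (`|B2| * expR (- e2 * ycoord tau))).
  by rewrite ler_wpM2r ?expR_ge0 ?ler_norm.
by rewrite ler_wpM2l // ler_expR !mulNr lerN2 ler_wpM2r // ge_min lexx orbT.
Qed.

Lemma principal_part0 E : has_principal_part E (fun _ : uhp R => 0).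
Proof.
exists [::]; split => //; exists 1, 0, 0; split => // tau _.
by rewrite big_nil subr0 normr0 mul0r.
Qed.

Lemma principal_part_scale E c f : has_principal_part E f ->
  has_principal_part E (fun tau => c * f tau).
Proof.
move=> h; rewrite (_ : (fun _ => _) = fun tau => c * f tau + 0).
  exact: principal_part_lin h (principal_part0 E).
by apply/funext => tau; rewrite addr0.
Qed.

Lemma principal_part_sum E (I : eqType) (r : seq I) (c : I -> R[i]) (f : I -> uhp R -> R[i]) :
  (forall i, has_principal_part E (f i)) ->
  has_principal_part E (fun tau => \sum_(i <- r) c i * f i tau).
Proof.
move=> h; elim: r => [|i s IH].
  rewrite (_ : (fun _ => _) = fun=> 0); first exact: principal_part0.
  by apply/funext => tau; rewrite big_nil.
rewrite (_ : (fun _ => _) = fun tau => c i * f i tau + \sum_(i <- s) c i * f i tau).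
  exact: principal_part_lin.
by apply/funext => tau; rewrite big_cons.
Qed.

Lemma fourier_poly_uaff P (a : rat) (b : R) tau : 0 < a ->
  fourier_poly P (uaff (ratr a) b tau) =
  fourier_poly [seq (a * rc.1, rc.2 * e2pi (ratr rc.1 * b%:C)) | rc <- P] tau.
Proof.
move=> a0; have aR : 0 < (ratr a : R) by rewrite ltr0q.
rewrite /fourier_poly big_map; apply: eq_bigr => rc _ /=.
rewrite val_uaff // -mulrA -e2piD; congr (_ * e2pi _).
rewrite [ratr (a * rc.1)]rmorphM /= -[sval tau]/(val tau).
have -> : (ratr a : R)%:C = ratr a by exact: fmorph_rat.
by ring.
Qed.

Lemma principal_part_uaff (E E' : set rat) f (a : rat) (b : R) : 0 < a ->
  (forall r, E r -> E' (a * r)) ->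
  has_principal_part E f -> has_principal_part E' (f \o uaff (ratr a) b).
Proof.
move=> a0 hE [P [hP [e [B [y [e0 h]]]]]].
have aR : 0 < (ratr a : R) by rewrite ltr0q.
exists [seq (a * rc.1, rc.2 * e2pi (ratr rc.1 * b%:C)) | rc <- P]; split.
  move=> _ /mapP [rc /hP [r0 Er] ->] /=; split; last exact: hE.
  by rewrite pmulr_rle0.
exists (e * ratr a), B, (y / ratr a); split; first by rewrite mulr_gt0.
move=> tau; rewrite ler_pdivrMr // => ht.
have := h (uaff (ratr a) b tau); rewrite ycoord_uaff // mulrC => /(_ ht).
rewrite -/(fourier_poly P _) -/(fourier_poly _ tau) fourier_poly_uaff //.
by rewrite (_ : - e * _ = - (e * ratr a) * ycoord tau) //; ring.
Qed.

End PrincipalParts.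

Section PrincipalPartProj.
Variables (R : realType) (p : nat).
Hypotheses (p_prime : prime p) (p_odd : odd p).
Local Notation psi := (@psi R p).

(** On a term [e(n tau)] of the principal part the projection is a sum over the
    additive characters, which is zero unless [n] lies in the class [r]; the
    remainder keeps its exponential decay. *)
Lemma principal_part_proj (f : uhp R -> R[i]) (r : 'F_p) :
  has_principal_part [set x | x \is a Num.int] f ->
  has_principal_part [set x : rat | x - (val r)%:R / p%:R \is a Num.int] (class_proj f r).
Proof.
move=> [P [hP [e [B [y [e0 h]]]]]].
have p0 : 0 < (p%:R : R) by rewrite ltr0n prime_gt0.
have pi0 : 0 < (p%:R^-1 : R) by rewrite invr_gt0.
have pQ0 : 0 < (p%:R^-1 : rat) by rewrite invr_gt0 ltr0n prime_gt0.
pose cls (rc : rat * R[i]) : 'F_p := (numq rc.1)%:~R.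
have hm rc : rc \in P -> rc.1 = (numq rc.1)%:~R.
  by move=> /hP [_ /= /intrP [m ->]]; rewrite numq_int.
pose Pr := [seq rc <- P | cls rc == r].
have pQ : (p%:R : rat) != 0 by rewrite pnatr_eq0 -lt0n prime_gt0.
exists [seq (p%:R^-1 * rc.1, p%:R * rc.2) | rc <- Pr]; split.
  move=> x /mapP [rc]; rewrite mem_filter => /andP [/eqP ecls rcP] -> /=.
  have [r0 _] := hP _ rcP; split; first by rewrite pmulr_rle0.
  rewrite (hm _ rcP); move: ecls; rewrite /cls; move: (numq rc.1) => m ecls.
  have : (p %| m - (val r)%:Z)%Z.
    by rewrite -(intr_Fp_eq0 p_prime) rmorphB /= Fp_valK // ecls subrr.
  move=> /dvdzP [q eq]; apply/intrP; exists q.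
  have -> : m = q * p%:Z + (val r)%:Z by rewrite -eq subrK.
  by rewrite rmorphD rmorphM /= -!pmulrn; field.
exists (e / p%:R), (\sum_(j : 'F_p) B), (p%:R * y); split; first by rewrite divr_gt0.
move=> tau ht.
pose u (j : 'F_p) := uaff p%:R^-1 ((val j)%:R / p%:R) tau.
have yu j : y <= ycoord (u j).
  by rewrite ycoord_uaff // mulrC ler_pdivlMr // mulrC.
have eqP : \sum_(rc <- [seq (p%:R^-1 * rc.1, p%:R * rc.2) | rc <- Pr]) rc.2 * e2pi (ratr rc.1 * val tau)
    = \sum_(j : 'F_p) psi (- (r * j)) * fourier_poly P (u j).
  rewrite big_map big_filter big_mkcond /=.
  under [RHS]eq_bigr do rewrite mulr_sumr.
  rewrite exchange_big /= big_seq [RHS]big_seq; apply: eq_bigr => rc rcP.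
  set z := e2pi (ratr (p%:R^-1 * rc.1) * _).
  have eu j : e2pi (ratr rc.1 * val (u j)) = z * psi (cls rc * j).
    have -> : cls rc * j = (numq rc.1 * (val j)%:Z)%:~R.
      by rewrite rmorphM /= Fp_valK.
    rewrite psi_int // -e2piD; congr e2pi; rewrite val_uaff //.
    have e1 : (ratr rc.1 : R[i]) = (numq rc.1)%:~R by rewrite {1}(hm _ rcP) ratr_int.
    have e2 : (ratr (p%:R^-1 * rc.1) : R[i]) = p%:R^-1 * (numq rc.1)%:~R.
      by rewrite rmorphM fmorphV -e1 /= ratr_nat.
    have e3 : (p%:R^-1 : R)%:C = p%:R^-1 by rewrite fmorphV rmorph_nat.
    have e4 : ((val j)%:R / p%:R : R)%:C = (val j)%:R / p%:R.
      by rewrite fmorph_div !rmorph_nat.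
    rewrite -[sval tau]/(val tau) e1 e2 e3 e4 rmorphM /= -pmulrn.
    by ring.
  under eq_bigr do rewrite eu.
  rewrite (eq_bigr (fun j : 'F_p => rc.2 * z * psi (j * (cls rc - r)))); last first.
    move=> j _; rewrite (_ : j * (cls rc - r) = - (r * j) + cls rc * j); last by ring.
    by rewrite (psiD R p_prime); ring.
  rewrite -mulr_sumr (sum_char_orth p_prime (psiD R p_prime) (psi0 R p_prime) (psi1 R p_prime p_odd)).
  rewrite subr_eq0; case: eqP => _; last by rewrite !mulr0.
  by rewrite mulr1; ring.
rewrite eqP /class_proj -sumrB; apply: (le_trans (ler_norm_sum _ _ _)).
rewrite mulr_suml rmorph_sum; apply: ler_sum => j _.
rewrite -mulrBr normrM norm_psi mul1r.
apply: (le_trans (h _ (yu j))); rewrite lecR.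
by rewrite ycoord_uaff // !mulNr -mulrA.
Qed.

End PrincipalPartProj.

(** * The incomplete Gamma function *)


Section OneVariable.
Variable R : realType.
Implicit Types (H : R -> R) (s x y c : R).

Lemma decreasing_of_derive H (dH : R -> R) :
  (forall x, 0 < x -> is_derive x 1 H (dH x)) -> (forall x, 0 < x -> dH x <= 0) ->
  forall x y, 0 < x -> x <= y -> H y <= H x.
Proof.
move=> hd hn x y x0 xy; have [->//|xny] := eqVneq x y.
have lxy : x < y by rewrite lt_neqAle xny.
have [||c] := @MVT R H dH x y lxy.
- move=> z; rewrite in_itv /= => /andP [z1 _]; apply: hd.
  exact: lt_trans z1.
- apply: derivable_within_continuous => z; rewrite in_itv /= => /andP [z1 _].
  by have [] := hd z (lt_le_trans x0 z1).
rewrite in_itv /= => /andP [c1 c2] e.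
rewrite -subr_le0 e mulr_le0_ge0 ?subr_ge0 //; apply: hn.
exact: lt_trans c1.
Qed.

Lemma nonneg_of_derive H (dH : R -> R) :
  (forall x, 0 < x -> is_derive x 1 H (dH x)) -> (forall x, 0 < x -> dH x <= 0) ->
  H x @[x --> +oo] --> 0 -> forall x, 0 < x -> 0 <= H x.
Proof.
move=> hd hn h0 x x0; apply: (cvgr_to_le h0).
near=> y; apply: (decreasing_of_derive hd hn x0).
by near: y; apply: nbhs_pinfty_ge; rewrite num_real.
Unshelve. all: by end_near. Qed.

Lemma powR_expR_bound s c : 0 < c ->
  exists2 C, 0 < C & forall t, c <= t -> t `^ s <= C * expR (t / 2).
Proof.
move=> c0; have pos t : c <= t -> 0 < t by exact: lt_le_trans.
have powE t : c <= t -> t `^ s = expR (s * ln t).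
  by move=> /pos t0; rewrite /powR gt_eqF.
case: (lerP s 0) => s0.
  exists (expR (s * ln c)); rewrite ?expR_gt0 // => t ct.
  rewrite powE // -expRD ler_expR; have t0 := pos _ ct.
  apply: (@le_trans _ _ (s * ln c)); last by rewrite lerDl divr_ge0 // ltW.
  by rewrite ler_wnM2l // ler_ln.
have s2 : 0 < 2 * s by rewrite mulr_gt0.
exists (expR (s * ln (2 * s))); rewrite ?expR_gt0 // => t ct.
have t0 := pos _ ct; rewrite powE // -expRD ler_expR.
have tE : t = (2 * s) * (t / (2 * s)) by rewrite mulrC divfK // gt_eqF.
have q0 : 0 < t / (2 * s) by rewrite divr_gt0.
rewrite {1}tE lnM // mulrDr lerD2l.
apply: (@le_trans _ _ (s * (t / (2 * s)))).
  by rewrite ler_pM2l // ltW // ln_sublinear.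
by rewrite le_eqVlt; apply/orP; left; apply/eqP; field; rewrite gt_eqF.
Qed.

End OneVariable.

Section IncompleteGamma.
Variables (R : realType) (a : R).
Local Notation mu := (@lebesgue_measure R).
Implicit Types (x y c t : R).

Let w t := expR (- t) * t `^ (a - 1).

Let w_ge0 t : 0 <= w t. Proof. by rewrite mulr_ge0 ?expR_ge0 ?powR_ge0. Qed.
Let w_gt0 t : 0 < t -> 0 < w t.
Proof. by move=> t0; rewrite mulr_gt0 ?expR_gt0 ?powR_gt0. Qed.

Let w_derivable t : 0 < t -> derivable w t 1.
Proof.
move=> t0; apply: derivableM; first by apply: ex_derive.
by have [] := is_derive1_powR (a - 1) t0.
Qed.

Let w_continuous t : 0 < t -> {for t, continuous w}.
Proof. by move=> /w_derivable /derivable1_diffP /differentiable_continuous. Qed.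

Let w_within c : 0 < c -> {within `[c, +oo[, continuous w}.
Proof.
move=> c0; apply: derivable_within_continuous => t.
by rewrite in_itv /= andbT => ct; apply: w_derivable; exact: lt_le_trans ct.
Qed.

Let expR_half_cvg : expR (- (t / 2)) @[t --> +oo] --> (0 : R).
Proof.
apply: (cvg_comp (fun t : R => t / 2) (fun t => expR (- t)) _ (@cvgr_expR R)).
by apply: gt0_cvgMly; [rewrite invr_gt0|exact: cvg_id].
Qed.

Let int_exp C x : 0 < C ->
  (\int[mu]_(t in `[x, +oo[) (C * expR (- (t / 2)))%:E = (2 * C * expR (- (x / 2)))%:E)%E.
Proof.
move=> C0; have dF t : is_derive t (1 : R) (fun t => - (2 * C) * expR (- (t / 2)))
    (C * expR (- (t / 2))).
  have d1 : is_derive t (1 : R) (fun t : R => - (t / 2)) (- 2^-1).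
    by apply: is_derive_eq; rewrite /GRing.scale /=; field.
  have := @is_derive1_comp R expR (fun t => - (t / 2)) t _ _ (is_derive_expR _) d1.
  by move=> d2; apply: is_derive_eq; rewrite /GRing.scale /=; field.
have lim : - (2 * C) * expR (- (t / 2)) @[t --> +oo] --> (0 : R).
  rewrite -[X in _ --> X](mulr0 (- (2 * C))).
  by apply: cvgM; [exact: cvg_cst|exact: expR_half_cvg].
rewrite (@ge0_continuous_FTC2y R (fun t => C * expR (- (t / 2)))
  (fun t => - (2 * C) * expR (- (t / 2))) x 0 _ _ lim).
- by rewrite -EFinB; congr EFin; ring.
- by move=> t _; rewrite mulr_ge0 ?expR_ge0 ?ltW.
- apply: derivable_within_continuous => t _.
  apply: derivableM; first exact: derivable_cst.
  have d1 : is_derive t (1 : R) (fun t : R => - (t / 2)) (- 2^-1).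
    by apply: is_derive_eq; rewrite /GRing.scale /=; field.
  by have [] := @is_derive1_comp R expR (fun t => - (t / 2)) t _ _ (is_derive_expR _) d1.
- by move=> t _; have [] := dF t.
- apply: cvg_at_right_filter.
  by have [/derivable1_diffP /differentiable_continuous] := dF x.
- by move=> t _; rewrite derive1E; have [] := dF t.
Qed.

Let w_measurable c : 0 < c -> measurable_fun `[c, +oo[ w.
Proof.
move=> c0; apply: subspace_continuous_measurable_fun => //.
exact: w_within.
Qed.

Let w_bound c : 0 < c -> exists2 C, 0 < C &
  forall t, c <= t -> w t <= C * expR (- (t / 2)).
Proof.
move=> c0; have [C C0 hC] := powR_expR_bound (a - 1) c0; exists C => // t ct.
apply: (@le_trans _ _ (expR (- t) * (C * expR (t / 2)))).
  by rewrite ler_wpM2l ?expR_ge0 ?hC.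
by rewrite mulrCA -expRD (_ : - t + t / 2 = - (t / 2)) //; field.
Qed.

Let exp_measurable C c : measurable_fun `[c, +oo[ (fun t : R => C * expR (- (t / 2))).
Proof.
apply: measurable_funM => //; apply: measurableT_comp => //.
by apply: measurableT_comp => //; apply: measurable_funM.
Qed.

Let exp_integrable C c : 0 < C ->
  mu.-integrable `[c, +oo[ (EFin \o (fun t : R => C * expR (- (t / 2)))).
Proof.
move=> C0; apply/integrableP; split.
  by apply/measurable_EFinP; exact: exp_measurable.
under eq_integral.
  move=> t _ /=; rewrite ger0_norm; last by rewrite mulr_ge0 ?expR_ge0 ?ltW.
over.
by rewrite int_exp // ltry.
Qed.

Let w_integrable c : 0 < c -> mu.-integrable `[c, +oo[ (EFin \o w).
Proof.
move=> c0; have [C C0 hC] := w_bound c0.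
apply: (le_integrable _ _ _ (exp_integrable c C0)) => //.
  by apply/measurable_EFinP; exact: w_measurable.
move=> t /=; rewrite in_itv /= andbT => ct; rewrite lee_fin.
rewrite ger0_norm ?w_ge0 // ger0_norm ?hC //.
by rewrite mulr_ge0 ?expR_ge0 ?ltW.
Qed.

Lemma upper_gamma_ge0 x : 0 <= upper_gamma a x.
Proof. by apply: Rintegral_ge0 => t _; exact: w_ge0. Qed.

Lemma upper_gamma_cvg0 : upper_gamma a x @[x --> +oo] --> 0.
Proof.
have [C C0 hC] := w_bound (@ltr01 R).
apply: (@squeeze_cvgr _ _ _ _ (fun=> 0) (fun x => 2 * C * expR (- (x / 2)))).
- near=> x; rewrite upper_gamma_ge0 /= -lee_fin -int_exp //.
  have x1 : 1 <= x by near: x; apply: nbhs_pinfty_ge; rewrite num_real.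
  have x0 : 0 < x by exact: lt_le_trans x1.
  rewrite /upper_gamma /Rintegral fineK; last first.
    by apply: integrable_fin_num => //; exact: w_integrable.
  apply: ge0_le_integral => //.
  + by move=> t _; rewrite lee_fin w_ge0.
  + by apply/measurable_EFinP; exact: w_measurable.
  + by apply/measurable_EFinP; exact: exp_measurable.
  + move=> t /=; rewrite in_itv /= andbT => xt; rewrite lee_fin hC //.
    exact: le_trans xt.
- exact: cvg_cst.
- rewrite -[X in _ --> X](mulr0 (2 * C)).
  by apply: cvgM; [exact: cvg_cst|exact: expR_half_cvg].
Unshelve. all: by end_near. Qed.

Lemma is_derive_upper_gamma x : 0 < x ->
  is_derive x 1 (upper_gamma a) (- (expR (- x) * x `^ (a - 1))).
Proof.
move=> x0; pose c := x / 2; have c0 : 0 < c by rewrite divr_gt0.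
have cx : c < x by rewrite ltr_pdivrMr // ltr_pMr // ltr1n.
pose F t := \int[mu]_(u in `[c, t]) w u.
have split_G t : c < t -> upper_gamma a t = upper_gamma a c - F t.
  move=> ct; rewrite /upper_gamma -Rintegral_itv_obnd_cbnd; last first.
    apply: (integrableS _ _ _ (w_integrable c0)) => // u /=.
    by rewrite !in_itv /= !andbT => tu; exact: ltW (lt_trans ct tu).
  rewrite -(@Rintegral_itvB _ w (BLeft c) +oo%O t (w_integrable c0)) //.
  by rewrite bnd_simp ltW.
have [dF F'] : derivable F x 1 /\ derive1 F x = w x.
  apply: (@continuous_FTC1_closed R w c x (x + 1)) => //.
  - by rewrite ltrDl.
  - apply: (integrableS _ _ _ (w_integrable c0)) => // u /=.
    by rewrite !in_itv /= andbT => /andP [].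
  - exact: w_continuous.
have dG : is_derive x (1 : R) (fun t => upper_gamma a c - F t) (- w x).
  rewrite -F' derive1E; move/derivableP: dF => dF.
  by apply: is_derive_eq; ring.
apply: (near_eq_is_derive _ dG).
have near_c : \forall t \near x, c < t by exact: (lt_nbhsr cx).
by apply: filterS near_c => t ct; rewrite (split_G t ct).
Qed.

Lemma upper_gamma_gt0 x : 0 < x -> 0 < upper_gamma a x.
Proof.
move=> x0; have xx : x < x + 1 by rewrite ltrDl.
have [||c] := @MVT R (upper_gamma a) (fun t => - w t) x (x + 1) xx.
- move=> z; rewrite in_itv /= => /andP [z1 _]; apply: is_derive_upper_gamma.
  exact: lt_trans z1.
- apply: derivable_within_continuous => z; rewrite in_itv /= => /andP [z1 _].
  by have [] := is_derive_upper_gamma (lt_le_trans x0 z1).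
rewrite in_itv /= => /andP [c1 c2] e.
have wc : 0 < w c by apply: w_gt0; exact: lt_trans c1.
have := upper_gamma_ge0 (x + 1); rewrite (_ : x + 1 - x = 1) in e; last by ring.
by rewrite mulr1 in e; lra.
Qed.

(** Along a ray [r u] the incomplete Gamma function decays by the factor
    [e^(-(r - 1) u)], uniformly in [u]: the derivative of the difference of the
    two sides has a sign. *)
Lemma upper_gamma_scale r x : 1 < r -> 0 < x ->
  upper_gamma a (r * x) <= r `^ a * expR (- ((r - 1) * x)) * upper_gamma a x.
Proof.
move=> r1 x0; rewrite -subr_ge0; have r0 : 0 < r by exact: lt_trans r1.
pose H (u : R) : R := r `^ a * expR (- ((r - 1) * u)) * upper_gamma a u - upper_gamma a (r * u).
pose dH (u : R) : R := - (r - 1) * r `^ a * expR (- ((r - 1) * u)) * upper_gamma a u.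
have hd (u : R) : 0 < u -> is_derive u (1 : R) H (dH u).
  move=> u0; have d1 : is_derive u (1 : R) (fun u : R => - ((r - 1) * u)) (- (r - 1)).
    by apply: is_derive_eq; rewrite /GRing.scale /=; ring.
  have d2 := @is_derive1_comp R expR (fun u => - ((r - 1) * u)) u _ _ (is_derive_expR _) d1.
  have d3 := is_derive_upper_gamma u0.
  have d4 : is_derive u (1 : R) (fun u : R => r * u) r.
    by apply: is_derive_eq; rewrite /GRing.scale /=; ring.
  have ru0 : 0 < r * u by rewrite mulr_gt0.
  have d5 := @is_derive1_comp R (upper_gamma a) (fun u => r * u) u _ _ (is_derive_upper_gamma ru0) d4.
  have d6 : is_derive u (1 : R) (fun u : R => upper_gamma a (r * u))
    (- (expR (- (r * u)) * (r * u) `^ (a - 1)) * r) by exact: d5.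
  have d7 : is_derive u (1 : R) (fun u : R => expR (- ((r - 1) * u)))
    (expR (- ((r - 1) * u)) * - (r - 1)) by exact: d2.
  apply: is_derive_eq; rewrite /GRing.scale /dH /=.
  rewrite (_ : expR (- (r * u)) = expR (- ((r - 1) * u)) * expR (- u)); last first.
    by rewrite -expRD; congr expR; ring.
  rewrite powRM ?ltW // (_ : r `^ a = r * r `^ (a - 1)); last first.
    by rewrite -[X in X * _](powRr1 (ltW r0)) -powRD ?(gt_eqF r0) ?implybT // addrC subrK.
  by ring.
apply: (@nonneg_of_derive _ H dH hd _ _ x x0).
  move=> u u0; rewrite /dH !mulNr oppr_le0 !mulr_ge0 ?expR_ge0 ?powR_ge0 ?upper_gamma_ge0 //.
  by rewrite subr_ge0 ltW.
have rcvg : r * u @[u --> +oo] --> +oo by apply: gt0_cvgMry => //; exact: cvg_id.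
rewrite -[X in _ --> X]subr0; apply: cvgB; last first.
  exact: (cvg_comp _ _ rcvg upper_gamma_cvg0).
rewrite -[X in _ --> X](mulr0 (r `^ a * 0)); apply: cvgM; last exact: upper_gamma_cvg0.
apply: cvgM; first exact: cvg_cst.
apply: (cvg_comp (fun t : R => (r - 1) * t) (fun t => expR (- t)) _ (@cvgr_expR R)).
by apply: gt0_cvgMry; [rewrite subr_gt0|exact: cvg_id].
Qed.

End IncompleteGamma.

(** * Pointwise convergence of Fourier series *)


Lemma cvg_div (K : numFieldType) (T : Type) (F : set_system T) {FF : Filter F}
    (u v : T -> K^o) (a b : K^o) : b != 0 ->
  u @ F --> a -> v @ F --> b -> (u t / v t : K^o) @[t --> F] --> (a / b : K^o).
Proof. by move=> b0 ua vb; apply: cvgM => //; exact: cvgV. Qed.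

Lemma cvg_cstB (K : numFieldType) (c : K) (u : nat -> K^o) :
  u @ \oo --> (0 : K^o) -> (c - u N : K^o) @[N --> \oo] --> (c : K^o).
Proof. by move=> h; rewrite -[X in _ --> X]subr0; apply: cvgB => //; exact: cvg_cst. Qed.

Lemma cvg_subr_cst (K : numFieldType) (c : K) (u : nat -> K^o) :
  u @ \oo --> (0 : K^o) -> (u N - c : K^o) @[N --> \oo] --> (- c : K^o).
Proof. by move=> h; rewrite -[X in _ --> X]sub0r; apply: cvgB => //; exact: cvg_cst. Qed.

Section Pointwise.
Variable R : realType.
Implicit Types (u v w g h : R -> R[i]) (t x s : R) (c z : R[i]) (n m : int).

Lemma contC_cvg u t : contC u -> (u s : R[i]^o) @[s --> t] --> (u t : R[i]^o).
Proof. by move=> [ur ui]; apply: cvgC_ReIm; [exact: ur|exact: ui]. Qed.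

Lemma cvg_contC u :
  (forall t, (u s : R[i]^o) @[s --> t] --> (u t : R[i]^o)) -> contC u.
Proof.
by move=> h; split=> t; [exact: (cvgC_Re (h t))|exact: (cvgC_Im (h t))].
Qed.

Lemma is_cder_quot u t z : is_cder u t z ->
  ((s^-1)%:C * (u (s + t) - u t) : R[i]^o) @[s --> (0 : R)^'] --> (z : R[i]^o).
Proof.
move=> [[ur er] [ui ei]]; apply: cvgC_ReIm.
  rewrite -er; move: ur => /cvg_ex [l hl].
  have := hl; rewrite /derive (cvg_lim _ hl) // => _.
  apply: cvg_trans hl; apply: near_eq_cvg; apply: filterE => s.
  by rewrite /= ReMc ReR ImR mul0r subr0 ReDc ReNc /GRing.scale /= mulr1.
rewrite -ei; move: ui => /cvg_ex [l hl].
have := hl; rewrite /derive (cvg_lim _ hl) // => _.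
apply: cvg_trans hl; apply: near_eq_cvg; apply: filterE => s.
by rewrite /= ImMc ReR ImR mul0r addr0 ImDc ImNc /GRing.scale /= mulr1.
Qed.

Lemma cvg_of_punctured u t :
  (u (s + t) : R[i]^o) @[s --> (0 : R)^'] --> (u t : R[i]^o) ->
  (u s : R[i]^o) @[s --> t] --> (u t : R[i]^o).
Proof.
move=> /cvgrPdist_lt h; apply/cvgrPdist_lt => e e0.
have [r r0 hr] := h e e0.
exists r => // s /= ts.
have [->|st] := eqVneq s t; first by rewrite subrr normr0.
have := hr (s - t); rewrite /= subrK sub0r normrN -normrN opprB subr_eq0 => /(_ ts st).
by [].
Qed.

Lemma ez1_eq1 s : ez 1 s = 1 :> R[i] -> exists m : int, s = m%:~R.
Proof.
pose m := Num.floor s; have [m1 m2] : m%:~R <= s /\ s < (m + 1)%:~R.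
  by rewrite floor_le_tmp floorD1_gt.
rewrite rmorphD /= in m2.
have [->|sm] := eqVneq s m%:~R; first by exists m.
pose r := s - m%:~R; have r0 : 0 < r by rewrite subr_gt0 lt_neqAle eq_sym sm.
have r1 : r < 1 by rewrite /r; lra.
have -> : ez 1 s = ez 1 r :> R[i].
  rewrite (_ : s = r + m%:~R); last by rewrite /r subrK.
  rewrite /ez rmorphD mulrDr e2piD -[X in _ * X = _](_ : 1 = _) ?mulr1 //.
  by rewrite mul1r rmorph_int e2pi_int.
move=> /(congr1 (@complex.Re R)); rewrite Re_ez /= mul1r.
have := cos_mulr2n (pi * r).
rewrite -mulr_natl (_ : pi * r *+ 2 = 2 * pi * r); last by rewrite -mulr_natl mulrA.
move=> -> h; have c1 : cos (pi * r) ^+ 2 = 1 by lra.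
have s0 : 0 < sin (pi * r).
  apply: sin_gt0_pi; apply/andP; split; first by rewrite mulr_gt0 ?pi_gt0.
  by rewrite -[ltRHS]mulr1 ltr_pM2l ?pi_gt0.
have := cos2Dsin2 (pi * r); rewrite c1 => /eqP.
by rewrite -subr_eq0 addrAC subrr add0r sqrf_eq0 gt_eqF.
Qed.

Lemma is_cder_ez0 n : is_cder (@ez R n) 0 (twopi_i R * n%:~R).
Proof. by have := is_cder_ez n (0 : R); rewrite {2}/ez mulr0 e2pi0 mulr1. Qed.

Lemma periodic_int g : (forall t, g (t + 1) = g t) -> forall m t, g (t + m%:~R) = g t.
Proof.
move=> gp; have gn (k : nat) t : g (t + k%:R) = g t.
  elim: k => [|k IH]; first by rewrite addr0.
  by rewrite -natr1 addrA gp.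
case=> k t; first by rewrite -pmulrn.
by rewrite -(gn k.+1) NegzE mulrNz -pmulrn subrK.
Qed.

Section Chernoff.
Variables (g v : R -> R[i]) (x : R).
Hypotheses (dg : forall t, is_cder g t (v t)) (g_per : forall t, g (t + 1) = g t).

Let cg : contC g. Proof. by apply: is_cder_cont => t; exists (v t). Qed.

(** Dividing [g - g x] by [e(t - x) - 1] turns the partial sums of the Fourier
    series at [x] into differences of two Fourier coefficients of the quotient.
    At the zeros of the denominator the quotient of the derivatives makes it
    continuous. *)
Definition chernoff_quot t : R[i] :=
  if ez 1 (t - x) == 1 :> R[i] then v t / twopi_i R
  else (g t - g x) / (ez 1 (t - x) - 1).

Local Notation q := chernoff_quot.

Let ez_shift_cvg t : (ez 1 (s - x) : R[i]^o) @[s --> t] --> (ez 1 (t - x) : R[i]^o).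
Proof.
have sh : (s - x) @[s --> t] --> t - x by apply: cvgB; [exact: cvg_id|exact: cvg_cst].
exact: (cvg_comp _ _ sh (@contC_cvg _ (t - x) (@contC_ez R 1))).
Qed.

Lemma contC_quot : contC q.
Proof.
apply: cvg_contC => t; have [E1|E1] := eqVneq (ez 1 (t - x) : R[i]) 1.
  apply: cvg_of_punctured; rewrite {2}/q E1 eqxx.
  have [m em] := ez1_eq1 E1.
  have gx : g t = g x by rewrite -(periodic_int g_per m x) -em addrC subrK.
  have l1 := is_cder_quot (dg t).
  have l2 := is_cder_quot (is_cder_ez0 1); rewrite mulr1 in l2.
  have FF : Filter (0 : R)^' by exact: dnbhs_filter.
  have l3 := @cvg_div R[i] R _ FF _ _ _ _ (twopi_i_neq0 R) l1 l2.
  apply: cvg_trans l3; apply: near_eq_cvg.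
  have n1 : \forall s \near (0 : R)^', s != 0 by exact: nbhs_dnbhs_neq.
  have n2 : \forall s \near (0 : R)^', `|s| < 1.
    by exists 1 => //= s /=; rewrite sub0r normrN.
  move: n1 n2; apply: filterS2 => s s0 s1.
  have Es : ez 1 (s + t - x) = ez 1 s :> R[i].
    rewrite -addrA em /ez rmorphD mulrDr e2piD -[X in _ * X = _](_ : 1 = _) ?mulr1 //.
    by rewrite mul1r rmorph_int e2pi_int.
  rewrite /q Es ifN; last first.
    apply/eqP => /ez1_eq1 [k ek]; move: s0 s1; rewrite ek intr_eq0 -intr_norm.
    by rewrite -[1](rmorph1 (intmul (1 : R))) ltr_int; lia.
  have sC : (s^-1)%:C != 0 :> R[i] by rewrite fmorph_eq0 invr_eq0.
  rewrite addr0 gx [ez 1 0](_ : _ = 1); last by rewrite /ez mulr0 e2pi0.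
  by rewrite invfM mulrACA divff // mul1r.
have n1 : \forall s \near t, ez 1 (s - x) != 1 :> R[i].
  have l : (ez 1 (s - x) - 1 : R[i]^o) @[s --> t] --> (ez 1 (t - x) - 1 : R[i]^o).
    by apply: contC_cvg; apply: contCB; [exact: cvg_contC ez_shift_cvg|exact: contC_cst].
  have nz : ez 1 (t - x) - 1 != 0 :> R[i] by rewrite subr_eq0.
  have FF : Filter (nbhs t) by exact: nbhs_filter.
  have := @cvgr_neq0 R[i] _ R _ FF _ _ l nz; apply: filterS => s.
  by rewrite subr_eq0.
rewrite {2}/q (negPf E1).
have l2 : (ez 1 (s - x) - 1 : R[i]^o) @[s --> t] --> (ez 1 (t - x) - 1 : R[i]^o).
  by apply: contC_cvg; apply: contCB; [exact: cvg_contC ez_shift_cvg|exact: contC_cst].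
have l1 : (g s - g x : R[i]^o) @[s --> t] --> (g t - g x : R[i]^o).
  by apply: contC_cvg; apply: contCB; [exact: cg|exact: contC_cst].
have nz : ez 1 (t - x) - 1 != 0 :> R[i] by rewrite subr_eq0.
have FF : Filter (nbhs t) by exact: nbhs_filter.
have l3 := @cvg_div R[i] R _ FF _ _ _ _ nz l1 l2.
by apply: cvg_trans l3; apply: near_eq_cvg; apply: filterS n1 => s s1; rewrite /q ifN.
Qed.

Lemma quotE t : g t - g x = q t * (ez 1 (t - x) - 1).
Proof.
rewrite /q; case: eqVneq => [E1|E1]; last by rewrite divfK // subr_eq0.
have [m em] := ez1_eq1 E1.
have -> : g t = g x by rewrite -(periodic_int g_per m x) -em addrC subrK.
by rewrite E1 !subrr mulr0.
Qed.

Let tele n : R[i] := ez n x * fcoef q n.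

Let teleE n : ez n x * fcoef g n = (n == 0)%:R * g x + tele (n - 1) - tele n.
Proof.
have cq := contC_quot.
have e1 : fcoef g n = g x * (n == 0)%:R + (ez (- 1) x * fcoef q (n - 1) - fcoef q n).
  have cqe : contC (fun t => q t * ez 1 t) by apply: contCM => //; exact: contC_ez.
  have cx : contC (fun t : R => g x * ez 0 t) by apply: contCM; [exact: contC_cst|exact: contC_ez].
  have c1 : contC (fun t => ez (- 1) x * (q t * ez 1 t)) by apply: contCM => //; exact: contC_cst.
  have c2 : contC (fun t => (- 1) * q t) by apply: contCM => //; exact: contC_cst.
  have gE : g = (fun t => g x * ez 0 t + (ez (- 1) x * (q t * ez 1 t) + (- 1) * q t)).
    apply/funext => t; rewrite ez0 mulr1; apply/eqP; rewrite addrC -subr_eq quotE; apply/eqP.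
    have -> : ez 1 (t - x) = ez 1 t * ez (- 1) x :> R[i].
      rewrite /ez rmorphB mulrBr e2piD; congr (_ * e2pi _).
      by rewrite rmorphN /= mulNr.
    by ring.
  rewrite (congr1 (fun h => fcoef h n) gE) (fcoefD _ cx (contCD c1 c2)) (fcoefD _ c1 c2).
  rewrite (fcoefZ _ _ (@contC_ez R 0)) fcoef_ez [0 == n]eq_sym (fcoefZ _ _ cqe) (fcoefZ _ _ cq) mulN1r.
  congr (_ + (_ * _ - _)); apply: eq_cint => t.
  have en : - (n - 1) = 1 + - n by rewrite opprB.
  by rewrite en ezD mulrA.
rewrite e1 /tele.
have e2 : ez (n - 1) x = ez n x * ez (- 1) x :> R[i] by rewrite ezD.
rewrite e2; have [->|n0] := eqVneq n 0; last by rewrite mulr0n; ring.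
by rewrite ez0 mulr1n; ring.
Qed.

Let tele_cvg (k : nat -> int) : injective k ->
  (tele (k j) : R[i]^o) @[j --> \oo] --> (0 : R[i]^o).
Proof.
move=> ki; have := riemann_lebesgue contC_quot ki.
move=> /cvgrPdist_lt h; apply/cvgrPdist_lt => e e0; have := h e e0.
by apply: filterS => j; rewrite !sub0r !normrN normrM norm_ez mul1r.
Qed.

(** The telescoping sums over nonnegative and over negative frequencies have the
    boundary term [A] in common, and their other ends tend to zero: the two
    halves of the series converge separately. *)
Lemma fourier_pointwise : exists A : R[i],
  ((\sum_(j < N) ez j%:Z x * fcoef g j : R[i]^o) @[N --> \oo] --> (g x + A : R[i]^o)) /\
  ((\sum_(j < N) ez (- j.+1%:Z) x * fcoef g (- j.+1%:Z) : R[i]^o) @[N --> \oo] --> (- A : R[i]^o)).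
Proof.
exists (tele (- 1)); split.
  have e N : \sum_(j < N.+1) ez j%:Z x * fcoef g j = g x + tele (- 1) - tele N%:Z.
    elim: N => [|N IH]; first by rewrite big_ord1 teleE eqxx mul1r sub0r.
    rewrite big_ord_recr /= IH teleE /= mul0r add0r.
    rewrite (_ : N.+1%:Z - 1 = N%:Z); last by lia.
    by rewrite addrA subrK.
  rewrite -cvg_shiftS /=.
  have ki : injective (fun N : nat => N%:Z) by move=> i j [].
  have l := tele_cvg ki.
  rewrite (_ : (fun N => _) = (fun N => g x + tele (- 1) - tele N%:Z)); last by apply/funext.
  exact (@cvg_cstB R[i] (g x + tele (- 1)) _ l).
have e N : \sum_(j < N) ez (- j.+1%:Z) x * fcoef g (- j.+1%:Z) = tele (- N.+1%:Z) - tele (- 1).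
  elim: N => [|N IH]; first by rewrite big_ord0 subrr.
  rewrite big_ord_recr /= IH teleE /= mul0r add0r.
  rewrite (_ : - N.+1%:Z - 1 = - N.+2%:Z); last by lia.
  by rewrite [LHS]addrC addrA subrK.
have ki : injective (fun N : nat => - N.+1%:Z) by move=> i j E; lia.
have l := tele_cvg ki.
rewrite (_ : (fun N => _) = (fun N => tele (- N.+1%:Z) - tele (- 1))); last by apply/funext.
exact (@cvg_subr_cst R[i] (tele (- 1)) _ l).
Qed.

End Chernoff.

End Pointwise.

(** * Fourier coefficients along horizontal lines *)


Section UnderIntegral.
Variable R : realType.
Local Notation mu := (@lebesgue_measure R).

(** The derivative is bounded on the product of [[0, 1]] with a compact
    neighbourhood of the parameter, so that dominated convergence applies. *)
Lemma is_derive_under_integral (H dH : R -> R -> R) (y0 : R) : 0 < y0 ->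
  (forall y, 0 < y -> continuous (H y)) ->
  (forall y x : R, 0 < y -> is_derive y (1 : R) (H^~ x) (dH y x)) ->
  (forall x y : R, 0 < y -> {for (x, y), continuous (fun z : R * R => dH z.2 z.1)}) ->
  is_derive y0 (1 : R) (fun y => \int[mu]_(x in `[0, 1]) H y x)
    (\int[mu]_(x in `[0, 1]) dH y0 x).
Proof.
move=> y00 cH dHd cdH.
pose u := y0 / 2; pose v := 2 * y0.
have u0 : 0 < u by rewrite divr_gt0.
have Iy y : `]u, v[%classic y -> 0 < y by rewrite /= in_itv /= => /andP [/(lt_trans u0)].
have Ia : `]u, v[%classic y0 by rewrite /= in_itv /= /u /v; apply/andP; split; lra.
pose K : set (R * R) := `[0, 1]%classic `*` `[u, v]%classic.
have cK : compact K by apply: compact_setX; exact: segment_compact.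
have cdK : {within K, continuous (fun z : R * R => dH z.2 z.1)}.
  apply: continuous_in_subspaceT => -[x y]; rewrite inE => -[_ /=].
  by rewrite in_itv /= => /andP [uy _]; apply: cdH; exact: lt_le_trans uy.
have [M [_ hM]] := compact_bounded (continuous_compact cdK cK).
pose B := `|M| + 1.
have hB x y : `]u, v[%classic y -> `[0, 1]%classic x -> `|dH y x| <= B.
  rewrite /= !in_itv /= => /andP [y1 y2] x01.
  apply: (hM B); first by rewrite /B; have := ler_norm M; lra.
  by exists (x, y) => //; split => //=; rewrite !in_itv /= ?x01 // !ltW.
have cint (f : R -> R) : continuous f -> mu.-integrable `[0, 1] (EFin \o f).
  move=> cf; apply: continuous_compact_integrable; first exact: segment_compact.
  exact: continuous_subspaceT.
have pE y x : 0 < y -> partial1of2 H y x = dH y x.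
  by move=> y0'; rewrite partial1of2E (@derive_val _ _ _ _ _ _ _ (dHd y x y0')).
have h1 y : `]u, v[%classic y -> mu.-integrable `[0, 1] (EFin \o H y).
  by move=> /Iy /cH; exact: cint.
have h2 y x : `]u, v[%classic y -> `[0, 1]%classic x -> derivable (H^~ x) y 1.
  by move=> /Iy yp _; have [] := dHd y x yp.
have h3 : mu.-integrable `[0, 1] (EFin \o (fun _ : R => B)).
  by apply: cint; exact: cst_continuous.
have h4 y x : `]u, v[%classic y -> `[0, 1]%classic x -> `|partial1of2 H y x| <= B.
  by move=> yI xI; rewrite pE ?hB //; exact: Iy.
have B0 : forall x : R, 0 <= B by move=> _; rewrite /B addr_ge0.
have m01 : measurable (`[0, 1]%classic : set R) by [].
apply: DeriveDef; first exact (@derivable_under_integral _ _ _ mu H _ m01 y0 u v Ia h1 h2 (fun=> B) B0 h3 h4).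
rewrite -derive1E (@differentiation_under_integral _ _ _ mu H _ m01 y0 u v Ia h1 h2 (fun=> B) B0 h3 h4).
by apply: eq_Rintegral => x _; exact: pE.
Qed.

Lemma is_cder_cint (u v : R -> R -> R[i]) (y : R) : 0 < y ->
  (forall y, 0 < y -> contC (u y)) ->
  (forall y x : R, 0 < y -> is_cder (u^~ x) y (v y x)) ->
  (forall x y : R, 0 < y ->
     {for (x, y), continuous (fun z : R * R => complex.Re (v z.2 z.1))} /\
     {for (x, y), continuous (fun z : R * R => complex.Im (v z.2 z.1))}) ->
  is_cder (fun y => cint (u y)) y (cint (v y)).
Proof.
move=> y0 cu duv cv; split.
  rewrite (funext (fun y => Re_cint (u y))) Re_cint.
  apply: (@is_derive_under_integral (fun y x => complex.Re (u y x))
    (fun y x => complex.Re (v y x))) => // [t t0|t x t0|x t t0].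
  - by have [] := cu t t0.
  - by have [] := duv t x t0.
  - by have [] := cv x t t0.
rewrite (funext (fun y => Im_cint (u y))) Im_cint.
apply: (@is_derive_under_integral (fun y x => complex.Im (u y x))
  (fun y x => complex.Im (v y x))) => // [t t0|t x t0|x t t0].
- by have [] := cu t t0.
- by have [] := duv t x t0.
- by have [] := cv x t t0.
Qed.

End UnderIntegral.

Lemma solve_dyy (K : fieldType) (Y A B C D I m : K) : Y != 0 ->
  - Y ^+ 2 * (A + B) + I * m * Y * (C + I * D) = 0 ->
  B = -1 * A + I * m / Y * (C + I * D).
Proof.
move=> Y0 E; apply: (mulfI (expf_neq0 2 Y0)); apply/eqP; rewrite -subr_eq0; apply/eqP.
by rewrite -[RHS]oppr0 -E; field.
Qed.

Lemma ode_alg (K : fieldType) (I T n m Y a a1 : K) : I * I = -1 ->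
  -1 * (I * T * n * (I * T * n * a)) + I * m / Y * (I * T * n * a + I * a1) =
  (T * n) ^+ 2 * a - m / Y * (a1 + T * n * a).
Proof.
move=> i2; transitivity (- (I * I) * ((T * n) ^+ 2 * a) + (I * I) * (m / Y) * (a1 + T * n * a)).
  by ring.
by rewrite i2; ring.
Qed.

Section Coefficients.
Variable R : realType.
Implicit Types (f g : uhp R -> R[i]) (tau : uhp R) (x y t : R) (n : int).

Lemma xcoord_to_uhp x y : 0 < y -> xcoord (to_uhp (x +i* y)) = x.
Proof. by move=> y0; rewrite /xcoord to_uhpK. Qed.

Lemma ycoord_to_uhp x y : 0 < y -> ycoord (to_uhp (x +i* y)) = y.
Proof. by move=> y0; rewrite /ycoord to_uhpK. Qed.

Lemma is_cder_dx f x y : 0 < y -> smooth f ->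
  is_cder (fun x => at_xy f x y) x (at_xy (dx f) x y).
Proof.
move=> y0 sf; have := derivable_x_cder (smooth_derx (to_uhp (x +i* y)) sf).
by rewrite xcoord_to_uhp // ycoord_to_uhp.
Qed.

Lemma is_cder_dy f x y : 0 < y -> smooth f ->
  is_cder (fun y => at_xy f x y) y (at_xy (dy f) x y).
Proof.
move=> y0 sf; have := derivable_y_cder (smooth_dery (to_uhp (x +i* y)) sf).
by rewrite xcoord_to_uhp // ycoord_to_uhp.
Qed.

Lemma contC_at_xy f y : 0 < y -> smooth f -> contC (fun x => at_xy f x y).
Proof. by move=> y0 sf; apply: is_cder_cont => x; exists (at_xy (dx f) x y); exact: is_cder_dx. Qed.

Definition line_coef f n y : R[i] := fcoef (fun x => at_xy f x y) n.

Lemma is_cder_line_coef f n y : 0 < y -> smooth f ->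
  is_cder (line_coef f n) y (line_coef (dy f) n y).
Proof.
move=> y0 sf.
apply: (@is_cder_cint R (fun y x => at_xy f x y * ez (- n) x)
  (fun y x => at_xy (dy f) x y * ez (- n) x)) => // [t t0|t x t0|x t t0].
- by apply: contC_fcoef; exact: contC_at_xy.
- have h := is_cderZ (ez (- n) x) (is_cder_dy x t0 sf); rewrite mulrC.
  by rewrite (_ : (fun _ => _) = (fun y => ez (- n) x * at_xy f x y)) //;
    apply/funext => z; rewrite mulrC.
- have [cr ci] := (smooth_dy sf 0%N).1 (to_uhp (x +i* t)).
  rewrite (xcoord_to_uhp x t0) (ycoord_to_uhp x t0) in cr ci.
  have [er ei] := @contC_ez R (- n).
  have c1 : {for (x, t), continuous (fun z : R * R => complex.Re (ez (- n) z.1 : R[i]))}.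
    by apply: (continuous_comp (f := fst) (g := fun t => complex.Re (ez (- n) t : R[i]))); [exact: cvg_fst|exact: er].
  have c2 : {for (x, t), continuous (fun z : R * R => complex.Im (ez (- n) z.1 : R[i]))}.
    by apply: (continuous_comp (f := fst) (g := fun t => complex.Im (ez (- n) t : R[i]))); [exact: cvg_fst|exact: ei].
  split.
    rewrite (funext (fun z : R * R => ReMc (at_xy (dy f) z.1 z.2) (ez (- n) z.1))).
    by apply: cvgB; apply: cvgM.
  rewrite (funext (fun z : R * R => ImMc (at_xy (dy f) z.1 z.2) (ez (- n) z.1))).
  by apply: cvgD; apply: cvgM.
Qed.

Definition x_periodic f := forall x y, 0 < y -> at_xy f (x + 1) y = at_xy f x y.

Lemma x_periodic_dx f : smooth f -> x_periodic f -> x_periodic (dx f).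
Proof.
move=> sf pf x y y0; apply: (@is_cder_unique R (fun x => at_xy f x y) x); last first.
  exact: is_cder_dx.
have := @is_cder_affine R _ 1 1 x (at_xy (dx f) (x + 1) y); rewrite mul1r => /(_ _ (is_cder_dx _ y0 sf)).
rewrite mul1r (_ : (fun s => at_xy f (1 * s + 1) y) = fun x => at_xy f x y) //.
by apply/funext => s; rewrite mul1r pf.
Qed.

Lemma line_coef_dx f n y : 0 < y -> smooth f -> x_periodic f ->
  line_coef (dx f) n y = twopi_i R * n%:~R * line_coef f n y.
Proof.
move=> y0 sf pf; apply: fcoef_der.
- by move=> x; exact: is_cder_dx.
- by apply: contC_at_xy => //; exact: smooth_dx.
- by rewrite -[1]add0r pf.
Qed.

Lemma line_coefD f g n y : 0 < y -> smooth f -> smooth g ->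
  line_coef (fun tau => f tau + g tau) n y = line_coef f n y + line_coef g n y.
Proof. by move=> y0 sf sg; rewrite -fcoefD //; exact: contC_at_xy. Qed.

Lemma line_coefZ (c : R[i]) f n y : 0 < y -> smooth f ->
  line_coef (fun tau => c * f tau) n y = c * line_coef f n y.
Proof. by move=> y0 sf; rewrite -fcoefZ //; exact: contC_at_xy. Qed.

(** The equation [Delta k f = 0] on Fourier coefficients: [d/dx] becomes the
    multiplication by [2 pi i n], and [d/dy] passes under the integral. *)
Lemma line_coef_ode k f n y : 0 < y -> smooth f -> x_periodic f ->
  (forall tau, Delta k f tau = 0) ->
  let a := line_coef f n y in let a1 := line_coef (dy f) n y in
  line_coef (dy (dy f)) n y = (2 * pi * n%:~R)%:C ^+ 2 * a
    - (k%:~R / y)%:C * (a1 + (2 * pi * n%:~R)%:C * a).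
Proof.
move=> y0 sf pf D0 a a1.
have sx := smooth_dx sf; have sy := smooth_dy sf.
have sxx := smooth_dx sx; have syy := smooth_dy sy.
have e : dy (dy f) = fun tau => -1 * dx (dx f) tau +
    ('i * (k%:~R : R[i]) / (ycoord tau)%:C) * (dx f tau + 'i * dy f tau).
  apply/funext => tau; have := D0 tau; rewrite /Delta.
  have y1 : (ycoord tau)%:C != 0 :> R[i] by rewrite fmorph_eq0 gt_eqF ?ycoord_gt0.
  have -> : ((ycoord tau) ^+ 2)%:C = (ycoord tau)%:C ^+ 2 :> R[i] by exact: rmorphXn.
  exact: (@solve_dyy R[i]).
have e1 : line_coef (dy (dy f)) n y = -1 * line_coef (dx (dx f)) n y +
    ('i * (k%:~R : R[i]) / y%:C) * (line_coef (dx f) n y + 'i * line_coef (dy f) n y).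
  rewrite -(line_coefZ ('i) n y0 sy) -(line_coefD n y0 sx) //; last exact: smooth_scale.
  rewrite -(line_coefZ (-1) n y0 sxx).
  have s1 : smooth (fun tau => dx f tau + 'i * dy f tau).
    rewrite (_ : (fun _ => _) = lincomb 'i (dy f) (dx f)); first exact: smooth_lin.
    by apply/funext => tau; rewrite /lincomb addrC.
  rewrite -(line_coefZ _ n y0 s1) -(line_coefD n y0); [|exact: smooth_scale..].
  by apply: eq_cint => x; congr (_ * _); rewrite e /at_xy ycoord_to_uhp.
rewrite e1 (line_coef_dx n y0 sx (x_periodic_dx sf pf)) (line_coef_dx n y0 sf pf).
rewrite -/a -/a1 (_ : twopi_i R = 'i * (2 * pi)%:C); last first.
  by rewrite /twopi_i; apply: complex_eqP; rewrite /=; ring.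
have i2 : 'i * 'i = -1 :> R[i] by rewrite -expr2 sqr_i.
rewrite (rmorphM _ (2 * pi) n%:~R) (rmorphM _ k%:~R y^-1) (fmorphV _ y) /= !rmorph_int.
exact: (@ode_alg R[i]).
Qed.

End Coefficients.

(** * Existence of the expansion *)


Lemma cvgn_lim_num (K : numFieldType) (u : nat -> K^o) (l : K^o) :
  u @ \oo --> l -> cvgn u /\ limn u = l.
Proof. by move=> h; split; [exact: cvgP h|exact: cvg_lim h]. Qed.

Section FirstIntegral.
Variable R : realType.
Implicit Types (u v : R -> R[i]) (x y t : R) (c z : R[i]) (n : int).

Lemma is_cder_real (r : R -> R) t (d : R) : is_derive t (1 : R) r d ->
  is_cder (fun t => (r t)%:C) t (d%:C : R[i]).
Proof. by move=> h; split => //; exact: is_derive_cst. Qed.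

Lemma is_cder_eq u t z z' : is_cder u t z -> z = z' -> is_cder u t z'.
Proof. by move=> h <-. Qed.

Lemma const_of_derive (H : R -> R) : (forall x, 0 < x -> is_derive x (1 : R) H 0) ->
  forall x, 0 < x -> H x = H 1.
Proof.
move=> h; have le x y : 0 < x -> x <= y -> H y <= H x.
  by apply: (@decreasing_of_derive R H (fun=> 0)) => // x0 _.
have ge x y : 0 < x -> x <= y -> H x <= H y.
  move=> x0 xy; rewrite -lerN2.
  apply: (@decreasing_of_derive R (fun x => - H x) (fun=> 0) _ _ x y x0 xy) => // z z0.
  by have hz := h z z0; apply: is_derive_eq; rewrite oppr0.
move=> x x0; apply/eqP; rewrite eq_le; have [x1|/ltW x1] := lerP x 1.
  by apply/andP; split; [exact: ge|exact: le].
by apply/andP; split; [exact: le|exact: ge].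
Qed.

Lemma const_of_cder u : (forall y, 0 < y -> is_cder u y 0) ->
  forall y, 0 < y -> u y = u 1.
Proof.
move=> h y y0; apply: complex_eqP.
  by apply: (@const_of_derive (fun t => complex.Re (u t))) => // x x0; have [] := h x x0.
by apply: (@const_of_derive (fun t => complex.Im (u t))) => // x x0; have [] := h x x0.
Qed.

Lemma powRD_gt0 (x a b : R) : 0 < x -> x `^ (a + b) = x `^ a * x `^ b.
Proof. by move=> x0; apply: powRD; apply/implyP => _; rewrite gt_eqF. Qed.

Lemma is_derive_expRM (a t : R) :
  is_derive t (1 : R) (fun t => expR (a * t)) (a * expR (a * t)).
Proof.
have d : is_derive t (1 : R) (fun t => a * t) a.
  by apply: is_derive_eq; rewrite /GRing.scale /= mulr1.
have := @is_derive1_comp R expR (fun t => a * t) t _ _ (is_derive_expR _) d.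
by rewrite mulrC.
Qed.

(** The second order equation has the first integral
    [(a' + N a) y^s e^(- N y)], which is the derivative of [a e^(N y)] up to
    the factor [y^s e^(- 2 N y)]. *)
Lemma ode_first_integral (s N : R) (a a1 a2 : R -> R[i]) :
  (forall y, 0 < y -> is_cder a y (a1 y)) ->
  (forall y, 0 < y -> is_cder a1 y (a2 y)) ->
  (forall y, 0 < y -> a2 y = N%:C ^+ 2 * a y - (s / y)%:C * (a1 y + N%:C * a y)) ->
  exists C : R[i], forall y, 0 < y ->
    is_cder (fun y => a y * (expR (N * y))%:C) y
      (C * (y `^ (- s) * expR (2 * N * y))%:C).
Proof.
move=> d1 d2 ode.
pose w y := y `^ s * expR (- N * y).
pose h y := (a1 y + N%:C * a y) * (w y)%:C.
have dw y : 0 < y -> is_derive y (1 : R) w ((s / y - N) * w y).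
  move=> y0; have e1 := is_derive1_powR s y0; have e2 := is_derive_expRM (- N) y.
  apply: (@is_derive_eq _ _ _ _ _ _ _ _ (is_deriveM e1 e2)).
  have -> : y `^ (s - 1) = y `^ s / y by rewrite powRD_gt0 // powRN powRr1 // ltW.
  by rewrite /w /GRing.scale /=; ring.
have dh y : 0 < y -> is_cder h y 0.
  move=> y0; apply: (is_cder_eq (is_cderM (is_cderD (d2 y y0) (is_cderZ N%:C (d1 y y0))) (is_cder_real (dw y y0)))).
  have -> : ((s / y - N) * w y)%:C = ((s / y)%:C - N%:C) * (w y)%:C :> R[i].
    by rewrite -rmorphB -rmorphM.
  rewrite ode //; generalize (a1 y) (a y) (N%:C : R[i]) ((w y)%:C : R[i]) ((s / y)%:C : R[i]).
  by move=> *; ring.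
exists (h 1) => y y0; apply: (is_cder_eq (is_cderM (d1 y y0) (is_cder_real (is_derive_expRM N y)))).
rewrite -(const_of_cder dh y0) /h.
have e : w y * (y `^ (- s) * expR (2 * N * y)) = expR (N * y).
  rewrite /w mulrACA -powRD_gt0 //.
  by rewrite subrr powRr0 mul1r -expRD; congr expR; ring.
have e2 : (N * expR (N * y))%:C = N%:C * (expR (N * y))%:C :> R[i] by exact: rmorphM.
have e3 : (w y)%:C * (y `^ (- s) * expR (2 * N * y))%:C = (expR (N * y))%:C :> R[i].
  by rewrite -rmorphM e.
rewrite -[X in _ = X]mulrA e3 e2; generalize (a1 y) (a y) (N%:C : R[i]) ((expR (N * y))%:C : R[i]).
by move=> *; ring.
Qed.

Lemma cvg_expR_neg (e : R) : 0 < e -> expR (- (e * t)) @[t --> +oo] --> (0 : R).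
Proof.
move=> e0; apply: (cvg_comp (fun t : R => e * t) (fun t => expR (- t)) _ (@cvgr_expR R)).
by apply: gt0_cvgMry => //; exact: cvg_id.
Qed.

Lemma powR_expR_le (s e : R) : 0 < e -> exists2 K, 0 < K &
  forall t, 1 <= t -> t `^ s <= K * expR (e * t / 2).
Proof.
move=> e0; have [K K0 hK] := powR_expR_bound s e0.
exists (e `^ (- s) * K); first by rewrite mulr_gt0 ?powR_gt0.
move=> t t1; have et : e <= e * t by rewrite ler_pMr.
have t0 : 0 < t by exact: lt_le_trans t1.
have := hK _ et; rewrite (powRM _ (ltW e0) (ltW t0)) => h.
have := ler_wpM2l (powR_ge0 e (- s)) h; rewrite [leRHS]mulrA; apply: le_trans.
by rewrite mulrA -powRD_gt0 // addNr powRr0 mul1r.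
Qed.

Implicit Types (G : R -> R[i]).

(** Growth excludes the exponentially increasing solution: if [G' = C y^(- s) e^(2 N y)]
    with [0 <= N] and [G] is a constant up to [e^((N - eps) y)], then the
    increments of [G] are too small for a nonzero [C]. *)
Lemma growing_coef_eq0 (s N eps B Y : R) G (C c : R[i]) : 0 <= N -> 0 < eps ->
  (forall y, 0 < y -> is_cder G y (C * (y `^ (- s) * expR (2 * N * y))%:C)) ->
  (forall y, Y <= y -> `|G y - c| <= (B * expR ((N - eps) * y))%:C) ->
  C = 0.
Proof.
move=> N0 eps0 dG hG.
pose q := sqnorm C; have q0 : 0 <= q by rewrite addr_ge0 ?sqr_ge0.
have [m m0 em] := normcE_real C.
pose r y := complex.Re (conjc C * G y).
have dr y : 0 < y -> is_derive y (1 : R) r (q * (y `^ (- s) * expR (2 * N * y))).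
  move=> y0; have [h _] := is_cderZ (conjc C) (dG y y0).
  apply: (@is_derive_eq _ _ _ _ _ _ _ _ h).
  by rewrite mulrA [conjc C * C]mulrC mulJ (ReMc (sqnorm C)%:C) ReR ImR mul0r subr0 ReR.
have [K K0 hK] := powR_expR_le s eps0.
have B0 : 0 <= `|B| by [].
pose L := K * (m * `|B| * (expR N + expR eps)).
(* The mean value theorem on [[y, y + 1]], applied to [conj C * G]. *)
have step y : Y <= y -> 1 <= y -> q <= L * expR (- (eps / 2 * y)).
  move=> Yy y1; have y0 : 0 < y by exact: lt_le_trans y1.
  have yy : y < y + 1 by rewrite ltrDl.
  have [||x] := @MVT R r (fun x => q * (x `^ (- s) * expR (2 * N * x))) y (y + 1) yy.
  - by move=> z; rewrite in_itv /= => /andP [z1 _]; apply: dr; exact: lt_trans z1.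
  - apply: derivable_within_continuous => z; rewrite in_itv /= => /andP [z1 _].
    by have [] := dr z (lt_le_trans y0 z1).
  rewrite in_itv /= => /andP [x1 x2]; rewrite (_ : y + 1 - y = 1) ?mulr1; last by ring.
  move=> e; have x0 : 0 < x by exact: lt_trans x1.
  have x1' : 1 <= x by exact: le_trans y1 (ltW x1).
  have up : q * (x `^ (- s) * expR (2 * N * x)) <=
      m * `|B| * (expR N + expR eps) * expR ((2 * N - eps) * x).
    rewrite -e -lecR; apply: (@le_trans _ _ `|conjc C * (G (y + 1) - G y)|).
      apply: le_trans (normc_ge_Re _); rewrite lecR.
      by rewrite mulrBr ReDc ReNc ler_norm.
    rewrite normrM normcJ em -!mulrA rmorphM; apply: ler_wpM2l; first by rewrite lecE /= eqxx.
    have -> : G (y + 1) - G y = (G (y + 1) - c) - (G y - c) by ring.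
    apply: le_trans (ler_normB _ _) _.
    apply: le_trans (lerD (hG _ (le_trans Yy (ltW yy))) (hG _ Yy)) _.
    rewrite -rmorphD lecR -mulrDr; apply: (@le_trans _ _ (`|B| * (expR ((N - eps) * (y + 1)) + expR ((N - eps) * y)))).
      by rewrite ler_wpM2r ?ler_norm // addr_ge0 ?expR_ge0.
    rewrite ler_wpM2l // [leRHS]mulrDl -!expRD; apply: lerD; rewrite ler_expR; nra.
  have xs : x `^ s * x `^ (- s) = 1 by rewrite -powRD_gt0 // subrr powRr0.
  have -> : q = q * (x `^ (- s) * expR (2 * N * x)) * (x `^ s * expR (- (2 * N * x))).
    rewrite -[RHS]mulrA mulrACA [x `^ (- s) * _]mulrC xs mul1r -expRD subrr expR0 mulr1 //.
  have w0 : 0 <= x `^ s * expR (- (2 * N * x)) by rewrite mulr_ge0 ?powR_ge0 ?expR_ge0.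
  apply: le_trans (ler_wpM2r w0 up) _.
  have h3 : expR ((2 * N - eps) * x) * expR (- (2 * N * x)) = expR (- (eps * x)).
    by rewrite -expRD; congr expR; ring.
  have -> : m * `|B| * (expR N + expR eps) * expR ((2 * N - eps) * x) *
      (x `^ s * expR (- (2 * N * x))) = m * `|B| * (expR N + expR eps) * (x `^ s * expR (- (eps * x))).
    by rewrite -h3; ring.
  rewrite /L -mulrA [K * _]mulrC -!mulrA; do 3! (apply: ler_wpM2l; rewrite ?addr_ge0 ?expR_ge0 //).
  apply: le_trans (ler_wpM2r (expR_ge0 _) (hK x x1')) _.
  rewrite -[leLHS]mulrA -expRD; apply: ler_wpM2l; first exact: ltW K0.
  rewrite ler_expR; have : eps * y <= eps * x by rewrite ler_pM2l // ltW.
  by generalize (eps * x) => a; lra.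
have : q <= 0.
  apply: (cvgr_to_ge (F := +oo) (f := fun y => L * expR (- (eps / 2 * y)))).
    rewrite -[X in _ --> X](mulr0 L); apply: cvgM; first exact: cvg_cst.
    by apply: cvg_expR_neg; rewrite divr_gt0.
  near=> y; apply: step; near: y; apply: nbhs_pinfty_ge; exact: num_real.
move=> qle; have : q = 0 by apply/eqP; rewrite eq_le qle.
rewrite /q /sqnorm => /eqP; rewrite paddr_eq0 ?sqr_ge0 // !sqrf_eq0 => /andP [/eqP h1 /eqP h2].
exact: complex_eqP.
Unshelve. all: by end_near. Qed.

(** For [N < 0] the equation [G' = C y^(- s) e^(2 N y)] is solved by the
    incomplete Gamma function, and the constant is the limit at infinity. *)
Lemma decaying_coef (s N eps B Y : R) G (C c : R[i]) : N < 0 -> 0 < eps ->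
  (forall y, 0 < y -> is_cder G y (C * (y `^ (- s) * expR (2 * N * y))%:C)) ->
  (forall y, Y <= y -> `|G y - c| <= (B * expR ((N - eps) * y))%:C) ->
  exists d : R[i], forall y, 0 < y ->
    G y = c + d * (upper_gamma (1 - s) (- (2 * N) * y))%:C.
Proof.
move=> N0 eps0 dG hG; pose M := - (2 * N); have M0 : 0 < M by rewrite /M; lra.
pose U y := upper_gamma (1 - s) (M * y).
pose m := M * M `^ (- s); have m0 : 0 < m by rewrite mulr_gt0 ?powR_gt0.
pose d := - C / m%:C; exists d.
have dU y : 0 < y -> is_derive y (1 : R) U (- (m * (y `^ (- s) * expR (2 * N * y)))).
  move=> y0; have My : 0 < M * y by rewrite mulr_gt0.
  have dM : is_derive y (1 : R) (fun y => M * y) M.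
    by apply: is_derive_eq; rewrite /GRing.scale /= mulr1.
  have h := @is_derive1_comp R (upper_gamma (1 - s)) (fun y => M * y) y _ _ (is_derive_upper_gamma _ My) dM.
  apply: (@is_derive_eq _ _ _ _ _ _ _ _ h).
  rewrite (_ : 1 - s - 1 = - s); last by ring.
  rewrite powRM ?ltW // /m (_ : - (M * y) = 2 * N * y); last by rewrite /M; ring.
  by ring.
pose D := G 1 - d * (U 1)%:C.
have eD y : 0 < y -> G y - d * (U y)%:C = D.
  move=> y0; apply: (@const_of_cder (fun y => G y - d * (U y)%:C)) => // z z0.
  have h := is_cderD (dG z z0) (is_cderZ (- d) (is_cder_real (dU z z0))).
  rewrite (_ : (fun _ => _) = (fun t => G t + - d * (U t)%:C)); last first.
    by apply/funext => t; rewrite mulNr.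
  apply: (is_cder_eq h); rewrite /d.
  have -> : (- (m * (z `^ (- s) * expR (2 * N * z))))%:C =
      - (m%:C * (z `^ (- s) * expR (2 * N * z))%:C) :> R[i] by rewrite -rmorphM -rmorphN.
  have mC : m%:C != 0 :> R[i] by rewrite fmorph_eq0 gt_eqF.
  move: mC; generalize (m%:C : R[i]) ((z `^ (- s) * expR (2 * N * z))%:C : R[i]) => a b a0.
  by field.
have [e e0 ee] := normcE_real (D - c); have [l l0 el] := normcE_real d.
have : e <= 0.
  apply: (cvgr_to_ge (F := +oo) (f := fun y => `|B| * expR (- (eps * y)) + l * U y)).
    rewrite (_ : 0 = `|B| * 0 + l * 0 :> R); last by ring.
    apply: cvgD; apply: cvgM; try exact: cvg_cst; first exact: cvg_expR_neg.
    apply: (cvg_comp (fun y : R => M * y) (upper_gamma (1 - s)) _ (@upper_gamma_cvg0 R (1 - s))).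
    by apply: gt0_cvgMry => //; exact: cvg_id.
  near=> y; have Yy : Y <= y by near: y; apply: nbhs_pinfty_ge; exact: num_real.
  have y0 : 0 < y by near: y; apply: nbhs_pinfty_gt; exact: num_real.
  rewrite -lecR -ee -(eD y y0) (_ : _ - c = G y - c - d * (U y)%:C); last by ring.
  apply: le_trans (ler_normB _ _) _; rewrite rmorphD; apply: lerD.
    apply: le_trans (hG y Yy) _; rewrite lecR.
    apply: (@le_trans _ _ (`|B| * expR ((N - eps) * y))).
      by rewrite ler_wpM2r ?expR_ge0 ?ler_norm.
    rewrite ler_wpM2l // ler_expR; nra.
  rewrite normrM el rmorphM (_ : `|(U y)%:C| = (U y)%:C) //.
  by rewrite ger0_norm // lecE /= eqxx upper_gamma_ge0.
move=> ele; have : D - c = 0.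
  by apply/eqP; rewrite -normr_eq0 ee fmorph_eq0 eq_le ele.
by move=> /eqP; rewrite subr_eq0 => /eqP Dc y y0; rewrite -Dc -(eD y y0) /U /M subrK.
Unshelve. all: by end_near. Qed.

End FirstIntegral.

Section Expansion.
Variable R : realType.
Implicit Types (f : uhp R -> R[i]) (x y t : R) (c z : R[i]) (n m : int) (k : int).

Lemma e2pi_im t : e2pi (0 +i* t) = (expR (- (2 * pi * t)))%:C :> R[i].
Proof.
rewrite /e2pi (_ : (0 +i* (2 * pi)) * (0 +i* t) = (- (2 * pi * t))%:C); last first.
  by apply: complex_eqP; rewrite /=; ring.
by rewrite /cexp /= cos0 sin0; apply: complex_eqP; rewrite /=; ring.
Qed.

Lemma e2pi_line m x y :
  e2pi (m%:~R * (x +i* y)) = ez m x * (expR (- (2 * pi * m%:~R * y)))%:C :> R[i].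
Proof.
rewrite /ez -mulrA -e2pi_im -e2piD; congr e2pi.
by rewrite -[m%:~R](rmorph_int (real_complex R)); apply: complex_eqP; rewrite /=; ring.
Qed.

Lemma line_fourier_poly (P : seq (rat * R[i])) n y :
  (forall rc, rc \in P -> rc.1 \is a Num.int) ->
  contC (fun x => \sum_(rc <- P) rc.2 * e2pi (ratr rc.1 * (x +i* y))) /\
  fcoef (fun x => \sum_(rc <- P) rc.2 * e2pi (ratr rc.1 * (x +i* y))) n =
  (\sum_(rc <- P) (if rc.1 == n%:~R then rc.2 else 0)) * (expR (- (2 * pi * n%:~R * y)))%:C.
Proof.
elim: P => [|rc P IH] hP.
  rewrite (_ : (fun _ => _) = fun=> 0); last by apply/funext => x; rewrite big_nil.
  split; first exact: contC_cst.
  have h0 := fcoefZ 0 n (contC_cst (0 : R[i])).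
  rewrite big_nil mul0r -[RHS](mul0r (fcoef (fun=> 0) n)) -h0.
  by apply: eq_cint => x; rewrite !mul0r.
have [|cP eP] := IH; first by move=> rc' h; apply: hP; rewrite inE h orbT.
have /intrP [m em] : rc.1 \is a Num.int by apply: hP; rewrite inE eqxx.
rewrite (_ : (fun x => _) = fun x => rc.2 * (expR (- (2 * pi * m%:~R * y)))%:C * ez m x +
    \sum_(rc <- P) rc.2 * e2pi (ratr rc.1 * (x +i* y))); last first.
  apply/funext => x; rewrite big_cons em ratr_int e2pi_line.
  by rewrite [ez m x * _]mulrC mulrA.
have c1 : contC (fun x => rc.2 * (expR (- (2 * pi * m%:~R * y)))%:C * ez m x).
  by apply: contCM; [exact: contC_cst|exact: contC_ez].
split; first exact: contCD.
rewrite fcoefD // fcoefZ; last exact: contC_ez.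
rewrite fcoef_ez eP big_cons em eqr_int [RHS]mulrDl.
congr (_ + _).
by case: eqP => [->|_]; rewrite ?mulr1 // mulr0 mul0r.
Qed.

(** The Fourier coefficients of [f] minus its principal part inherit the
    exponential decay. *)
Lemma line_coef_principal f : smooth f -> has_principal_part [set r | r \is a Num.int] f ->
  exists (c : int -> R[i]) (N0 : int) (eps B Y : R),
  [/\ 0 < eps, forall n, n < N0 -> c n = 0
    & forall n y, Y <= y -> `|line_coef f n y - c n * (expR (- (2 * pi * n%:~R * y)))%:C|
        <= (B * expR (- eps * y))%:C].
Proof.
move=> sf [P [hP [eps [B [Y [e0 hB]]]]]].
have [N0 hN0] : exists N0 : int, forall rc, rc \in P -> N0%:~R <= rc.1.
  elim: {hB} P {hP} => [|rc P [N hN]]; first by exists 0.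
  exists (Num.min (Num.floor rc.1) N) => rc'; rewrite inE => /orP [/eqP ->|h].
    by apply: le_trans (floor_le_tmp rc.1); rewrite ler_int ge_min lexx.
  by apply: le_trans (hN _ h); rewrite ler_int ge_min lexx orbT.
exists (fun n => \sum_(rc <- P) (if rc.1 == n%:~R then rc.2 else 0)), N0, eps, (2 * B), (Num.max Y 1).
split => // [n nN|n y].
  apply: big1_seq => rc /andP [_ /hN0 h]; case: eqP => // e; move: h.
  by rewrite e ler_int leNgt nN.
rewrite ge_max => /andP [Yy y1]; have y0 : 0 < y by exact: lt_le_trans y1.
have intP rc : rc \in P -> rc.1 \is a Num.int by move=> /hP [].
have [cP <-] := line_fourier_poly n y intP.
have cf := contC_at_xy y0 sf.
set g := fun x => \sum_(rc <- P) _.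
have -> : line_coef f n y - fcoef g n = fcoef (fun x => at_xy f x y - g x) n.
  rewrite (_ : (fun x => at_xy f x y - g x) = fun x => at_xy f x y + (-1) * g x); last first.
    by apply/funext => x; rewrite mulN1r.
  rewrite fcoefD // ?fcoefZ // ?mulN1r //.
  by apply: contCM => //; exact: contC_cst.
rewrite -mulrA; apply: cint_bound; first by apply: contC_fcoef; exact: contCB.
move=> x _; rewrite normrM norm_ez mulr1.
have := hB (to_uhp (x +i* y)); rewrite ycoord_to_uhp // => /(_ Yy).
by rewrite /at_xy /g to_uhpK.
Qed.

(** Growth decides between the two solutions of the differential equation: for
    [0 <= n] only the holomorphic one is compatible with the principal part,
    and for [n < 0] the limit at infinity is the coefficient of the principal
    part, which is zero for almost all [n]. *)
Lemma line_coef_shape k f : smooth f -> x_periodic f ->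
  (forall tau, Delta k f tau = 0) -> has_principal_part [set r | r \is a Num.int] f ->
  exists (c : (int -> R[i]) * (int -> R[i])) (N0 : int),
  [/\ forall n, n < N0 -> c.1 n = 0, forall n, 0 <= n -> c.2 n = 0
    & forall n y, 0 < y -> line_coef f n y =
        (c.1 n + c.2 n * (upper_gamma (1 - k%:~R) (4 * pi * `|n|%:~R * y))%:C) *
        (expR (- (2 * pi * n%:~R * y)))%:C].
Proof.
move=> sf pf D0 hpp.
have [c [N0 [eps [B [Y [eps0 hc hB]]]]]] := line_coef_principal sf hpp.
have one n : exists d : R[i] * R[i], [/\ n < Num.min N0 0 -> d.1 = 0, 0 <= n -> d.2 = 0 &
    forall y, 0 < y -> line_coef f n y =
      (d.1 + d.2 * (upper_gamma (1 - k%:~R) (4 * pi * `|n|%:~R * y))%:C) *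
      (expR (- (2 * pi * n%:~R * y)))%:C].
  pose N : R := 2 * pi * n%:~R.
  have [||y y0|C hC] := @ode_first_integral R k%:~R N (line_coef f n) (line_coef (dy f) n)
      (line_coef (dy (dy f)) n).
  - by move=> y y0; exact: is_cder_line_coef.
  - by move=> y y0; apply: is_cder_line_coef => //; exact: smooth_dy.
  - exact: line_coef_ode.
  pose G y := line_coef f n y * (expR (N * y))%:C.
  have eN y : expR (N * y) * expR (- (2 * pi * n%:~R * y)) = 1.
    by rewrite -expRD subrr expR0.
  have GE y : line_coef f n y = G y * (expR (- (2 * pi * n%:~R * y)))%:C.
    by rewrite /G -mulrA -rmorphM eN mulr1.
  have hG y : Y <= y -> `|G y - c n| <= (B * expR ((N - eps) * y))%:C.
    move=> Yy; rewrite (_ : G y - c n = (line_coef f n y - c n * (expR (- (2 * pi * n%:~R * y)))%:C) * (expR (N * y))%:C); last first.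
      by rewrite mulrBl -[c n * _ * _]mulrA -rmorphM [_ * expR (N * y)]mulrC eN mulr1.
    rewrite normrM (_ : `|(expR (N * y))%:C| = (expR (N * y))%:C); last first.
      by rewrite ger0_norm // lecE /= eqxx expR_ge0.
    rewrite (_ : B * _ = B * expR (- eps * y) * expR (N * y)); last first.
      by rewrite -mulrA -expRD; congr (_ * expR _); ring.
    rewrite rmorphM; apply: ler_wpM2r; last exact: hB.
    by rewrite lecE /= eqxx expR_ge0.
  have pi2 : 0 < 2 * pi :> R by rewrite mulr_gt0 ?pi_gt0.
  have [n0|n0] := lerP 0 n.
    have N0' : 0 <= N by rewrite mulr_ge0 ?ler0z //; exact: ltW.
    have C0 := growing_coef_eq0 N0' eps0 hC hG.
    exists (G 1, 0); split => //=.
      by rewrite lt_min => /andP [_]; rewrite ltNge n0.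
    move=> y y0; rewrite mul0r addr0 GE; congr (_ * _).
    apply: const_of_cder => // z z0; apply: (is_cder_eq (hC z z0)).
    by rewrite C0 mul0r.
  have Nn : N < 0 by rewrite pmulr_rlt0 // ltrz0.
  have [d hd] := decaying_coef Nn eps0 hC hG.
  exists (c n, d); split => //=.
  - by rewrite lt_min => /andP [/hc].
  - move=> y y0; rewrite GE; congr (_ * _); rewrite [LHS](hd y y0).
    by congr (_ + _ * (upper_gamma _ _)%:C); rewrite ltr0_norm // /N rmorphN /=; ring.
have [d hd] := choice one.
exists (fun n => (d n).1, fun n => (d n).2), (Num.min N0 0).
by split=> [n|n|n]; have [] := hd n.
Qed.

Definition zpos (u : int -> R[i]) (N : nat) : R[i]^o := \sum_(j < N) u j%:Z.
Definition zneg (u : int -> R[i]) (N : nat) : R[i]^o := \sum_(j < N) u (- j.+1%:Z).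

Lemma zseriesE (u : int -> R[i]) : zseries u = (fun N => zpos u N + zneg u N).
Proof.
apply/funext => N; rewrite /zseries /series /= big_mkord /zpos /zneg.
by rewrite -big_split.
Qed.

(** Both halves of the Fourier series converge. In the nonnegative half the
    Gamma terms are absent, and in the negative half all but finitely many
    holomorphic terms are; hence the holomorphic terms and the Gamma terms can
    be summed separately. *)
Lemma harmonic_expansion k f : smooth f -> x_periodic f ->
  (forall tau, Delta k f tau = 0) -> has_principal_part [set r | r \is a Num.int] f ->
  exists cf, is_expansion k f cf.
Proof.
move=> sf pf D0 hpp; have [c [N0 [hc1 hc2 hc]]] := line_coef_shape sf pf D0 hpp.
exists c; split => //; first by exists N0.
move=> tau; pose x := xcoord tau; pose y := ycoord tau.
have y0 : 0 < y := ycoord_gt0 tau.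
set fp := fun n => _; set fm := fun n => _.
have ftau : at_xy f x y = f tau by rewrite /at_xy /x /y; congr f; apply: uhpP; rewrite to_uhpK ?val_uhp.
have term n : ez n x * line_coef f n y = fp n + fm n.
  rewrite hc // /fp /fm -[e2pi _](_ : ez n x * (expR (- (2 * pi * n%:~R * y)))%:C = _).
    rewrite -/y; generalize (ez n x : R[i]) (c.1 n) (c.2 n); move=> ? ? ?; ring.
  by rewrite -e2pi_line val_uhp.
have [A [hP hM]] := @fourier_pointwise R (fun x => at_xy f x y) (fun x => at_xy (dx f) x y) x
  (fun t => is_cder_dx t y0 sf) (fun t => pf t y y0).
have fm0 n : 0 <= n -> fm n = 0 by move=> n0; rewrite /fm hc2 // !mul0r.
have Pm N : zpos fm N = 0 by rewrite /zpos big1 // => j _; exact: fm0.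
have Pp N : zpos fp N = \sum_(j < N) ez j%:Z x * line_coef f j y.
  by rewrite /zpos; apply: eq_bigr => j _; rewrite term fm0 // addr0.
have Mpm N : zneg fm N = \sum_(j < N) ez (- j.+1%:Z) x * line_coef f (- j.+1%:Z) y - zneg fp N.
  rewrite /zneg -sumrB; apply: eq_bigr => j _; rewrite term; ring.
have Mp (N : nat) : (`|N0| <= N)%N -> zneg fp N = zneg fp `|N0|.
  move=> h; rewrite /zneg -(subnKC h) big_split_ord /= [X in _ + X]big1 ?addr0 //.
  move=> j _; rewrite /fp hc1 ?mul0r //.
  by lia.
pose m := zneg fp `|N0|.
have cMp : zneg fp @ \oo --> (m : R[i]^o).
  apply: cvg_near_cst; exists `|N0|%N => // N /= h; exact: Mp.
have cfp : zseries fp @ \oo --> (at_xy f x y + A + m : R[i]^o).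
  rewrite zseriesE; apply: cvgD cMp.
  by rewrite (funext Pp); exact: hP.
have cfm : zseries fm @ \oo --> (- A - m : R[i]^o).
  rewrite zseriesE (_ : (fun N => _) = (fun N => zneg fm N)); last by apply/funext => N; rewrite Pm add0r.
  by rewrite (funext Mpm); apply: cvgB cMp; exact: hM.
have [k1 e1] := cvgn_lim_num cfp; have [k2 e2] := cvgn_lim_num cfm.
split; [exact k1|exact k2|].
rewrite (_ : zsum fp = at_xy f x y + A + m); last exact e1.
rewrite (_ : zsum fm = - A - m); last exact e2.
by rewrite -ftau; generalize (at_xy f x y) A m => a b d; ring.
Qed.

End Expansion.

(** * Classes of exponents and uniqueness of the coefficients *)


Section SeriesOverZ.
Variable R : realType.
Implicit Types (u v : int -> R[i]) (s t c : R[i]).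

Definition has_zsum u s := zseries u @ \oo --> (s : R[i]^o).

Lemma zsumE u s : has_zsum u s -> zsum u = s.
Proof. by move=> h; have [_ e] := cvgn_lim_num h; exact e. Qed.

Lemma cvgn_has_zsum u : cvgn (zseries u) -> has_zsum u (zsum u).
Proof. by move=> h; exact h. Qed.

Lemma has_zsum_lin c u v s t : has_zsum u s -> has_zsum v t ->
  has_zsum (fun n => c * u n + v n) (c * s + t).
Proof.
rewrite /has_zsum !zseriesE => hu hv.
rewrite (_ : (fun N : nat => _) = fun N => c * (zpos u N + zneg u N) + (zpos v N + zneg v N) : R[i]^o); last first.
  by apply/funext => N; rewrite /zpos /zneg !big_split /= -!mulr_sumr mulrDr addrACA.
by apply: cvgD hv; apply: cvgM hu; exact: cvg_cst.
Qed.

Lemma has_zsum0 : has_zsum (fun=> 0) 0.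
Proof.
rewrite /has_zsum zseriesE (_ : (fun N : nat => _) = fun=> 0 : R[i]^o); first exact: cvg_cst.
by apply/funext => N; rewrite /zpos /zneg !big1 // addr0.
Qed.

Lemma has_zsumD u v s t : has_zsum u s -> has_zsum v t ->
  has_zsum (fun n => u n + v n) (s + t).
Proof.
move=> hu hv; have := @has_zsum_lin 1 _ _ _ _ hu hv; rewrite mul1r.
by rewrite (_ : (fun n : int => _) = fun n => u n + v n) //; apply/funext => n; rewrite mul1r.
Qed.

Lemma has_zsumZ c u s : has_zsum u s -> has_zsum (fun n => c * u n) (c * s).
Proof.
move=> hu; have := @has_zsum_lin c _ _ _ _ hu has_zsum0; rewrite addr0.
by rewrite (_ : (fun n : int => _) = fun n => c * u n) //; apply/funext => n; rewrite addr0.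
Qed.

Lemma has_zsum_sum (I : Type) (r : seq I) (c : I -> R[i]) (u : I -> int -> R[i]) (s : I -> R[i]) :
  (forall i, has_zsum (u i) (s i)) ->
  has_zsum (fun n => \sum_(i <- r) c i * u i n) (\sum_(i <- r) c i * s i).
Proof.
move=> h; elim: r => [|i r IH].
  rewrite big_nil (_ : (fun n : int => _) = fun=> 0); first exact: has_zsum0.
  by apply/funext => n; rewrite big_nil.
rewrite big_cons (_ : (fun n : int => _) = fun n => c i * u i n + \sum_(i <- r) c i * u i n).
  exact: has_zsum_lin (h i) IH.
by apply/funext => n; rewrite big_cons.
Qed.

Lemma eq_has_zsum u v s : u =1 v -> has_zsum u s -> has_zsum v s.
Proof. by move=> /funext ->. Qed.

End SeriesOverZ.

Section ClassProjection.
Variables (R : realType) (p : nat).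
Hypothesis p_prime : prime p.
Hypothesis p_odd : odd p.
Local Notation psi := (@psi R p).
Implicit Types (f : uhp R -> R[i]) (tau : uhp R) (k : int).

(** The function [coef], for an expansion [c] that need not be the chosen one. *)
Definition expansion_coef k (c : (int -> R[i]) * (int -> R[i])) (n : int) (y : R) : R[i] :=
  c.1 n + c.2 n * (upper_gamma (1 - k%:~R) (4 * pi * `|n|%:~R * y))%:C.

Let pR0 : 0 < (p%:R^-1 : R). Proof. by rewrite invr_gt0 ltr0n prime_gt0. Qed.

(** Summing over the translates [(tau + j) / p] with the weights [e(- r j / p)]
    singles out the exponents in the class [r]. *)
Lemma expansion_class k f c (r : 'F_p) tau : is_expansion k f c ->
  has_zsum (fun n : int => if n%:~R == r then
      expansion_coef k c n (ycoord tau / p%:R) * e2pi (n%:~R / p%:R * val tau) else 0)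
    (p%:R^-1 * class_proj f r tau).
Proof.
move=> [_ _ hf]; pose tj (j : 'F_p) := uaff p%:R^-1 ((val j)%:R / p%:R) tau.
pose w n := expansion_coef k c n (ycoord tau / p%:R) * e2pi (n%:~R / p%:R * val tau).
have hj j : has_zsum (fun n => w n * psi (n%:~R * j)) (translate f j tau).
  rewrite /translate -/(tj j); have [h1 h2 ->] := hf (tj j).
  apply: eq_has_zsum (has_zsumD (cvgn_has_zsum h1) (cvgn_has_zsum h2)) => n.
  have -> : e2pi (n%:~R * val (tj j)) = e2pi (n%:~R / p%:R * val tau) * psi (n%:~R * j).
    rewrite -{2}[j]Fp_valK // -rmorphM psi_int // -e2piD; congr e2pi.
    have eP : (p%:R^-1)%:C = p%:R^-1 :> R[i] by rewrite fmorphV rmorph_nat.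
    have ej : ((val j)%:R / p%:R)%:C = (val j)%:R / p%:R :> R[i].
      by rewrite rmorphM fmorphV !rmorph_nat.
    have en : (n * (val j)%:Z)%:~R = n%:~R * (val j)%:R :> R[i] by rewrite intrM -pmulrn.
    rewrite (val_uaff _ _ pR0) eP ej en mulrDr mulrCA mulrA -mulrA.
    by rewrite [X in X + _]mulrA [X in X * _ + _]mulrC !mulrA.
  rewrite /w /expansion_coef (_ : ycoord (tj j) = ycoord tau / p%:R); last first.
    by rewrite ycoord_uaff // mulrC.
  generalize (c.1 n) (c.2 n) (psi (n%:~R * j)) (e2pi (n%:~R / p%:R * val tau)).
  generalize ((upper_gamma (1 - k%:~R) (4 * pi * `|n|%:~R * (ycoord tau / p%:R)))%:C : R[i]).
  by move=> a0 a1 a2 a3 a4; ring.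
have := @has_zsumZ R p%:R^-1 _ _ (@has_zsum_sum R _ (index_enum 'F_p) (fun j => psi (- (r * j))) _ _ hj).
apply: eq_has_zsum => n.
have -> : \sum_(j : 'F_p) psi (- (r * j)) * (w n * psi (n%:~R * j)) =
    w n * (p%:R * (n%:~R - r == 0)%:R).
  rewrite -(sum_char_orth p_prime (psiD R p_prime) (psi0 R p_prime) (psi1 R p_prime p_odd)).
  rewrite mulr_sumr; apply: eq_bigr => j _; rewrite mulrCA -psiD //; congr (_ * psi _).
  by ring.
rewrite subr_eq0 /w; case: eqP => _; last by rewrite !mulr0.
by rewrite mulr1 mulrC mulfK // p_neq0.
Qed.

End ClassProjection.

Section Uniqueness.
Variable R : realType.
Implicit Types (u : nat -> R[i]) (h : int -> R[i]) (k : int).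

Lemma realCM (a b : R) : (a * b)%:C = a%:C * b%:C :> R[i].
Proof. exact: rmorphM. Qed.

Lemma bounded_of_cvg0 u : (u : nat -> R[i]^o) @ \oo --> (0 : R[i]^o) ->
  exists2 M : R, 0 <= M & forall n, `|u n| <= M%:C.
Proof.
move=> /cvgrPdist_lt /(_ 1 ltr01) [J _ hJ].
have hM n : exists2 m : R, 0 <= m & `|u n| = m%:C by exact: normcE_real.
have [M M0 hM'] : exists2 M : R, 0 <= M & forall n, (n < J)%N -> `|u n| <= M%:C.
  elim: J {hJ} => [|J [M M0 IH]]; first by exists 0.
  have [m m0 em] := hM J; exists (M + m); first by rewrite addr_ge0.
  move=> n; rewrite ltnS leq_eqVlt => /orP [/eqP ->|/IH h].
    by rewrite em lecR lerDr.
  by apply: le_trans h _; rewrite lecR lerDl.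
exists (M + 1); first by rewrite addr_ge0.
move=> n; have [nJ|Jn] := ltnP n J.
  by apply: le_trans (hM' n nJ) _; rewrite lecR lerDl.
have := hJ n Jn; rewrite sub0r normrN => /ltW h; apply: le_trans h _.
by rewrite -[1](rmorph1 (real_complex R)) /= lecR lerDr.
Qed.

Lemma bounded_eventually0 u (J : nat) : (forall n, (J <= n)%N -> u n = 0) ->
  exists2 M : R, 0 <= M & forall n, `|u n| <= M%:C.
Proof.
move=> h; apply: bounded_of_cvg0; apply: cvg_near_cst.
by exists J => // n /= Jn; exact: h.
Qed.

(** An absolutely convergent trigonometric series with sum zero has zero
    coefficients: the partial sums tend to zero uniformly, and they have the
    given Fourier coefficients. *)
Lemma trig_series_eq0 h (B q : R) : 0 <= B -> 0 <= q < 1 ->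
  (forall n : int, `|h n| <= (B * q ^+ `|n|)%:C) ->
  (forall x : R, has_zsum (fun n => h n * ez n x) 0) -> forall n, h n = 0.
Proof.
move=> B0 /andP [q0 q1] hB h0 n.
pose g (N : nat) x : R[i] := \sum_(j < N) (h j%:Z * ez j%:Z x + h (- j.+1%:Z) * ez (- j.+1%:Z) x).
have gE N x : zseries (fun n => h n * ez n x) N = g N x.
  by rewrite /zseries /series /= big_mkord.
have q1' : 0 < 1 - q by rewrite subr_gt0.
pose K := 2 * B / (1 - q).
have tail N d x : `|g (N + d)%N x - g N x| <= (K * q ^+ N)%:C.
  suff : `|g (N + d)%N x - g N x| <= (K * (q ^+ N - q ^+ (N + d)))%:C.
    move/le_trans; apply; rewrite lecR ler_wpM2l //.
      by rewrite divr_ge0 ?mulr_ge0 // ltW.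
    by rewrite gerBl exprn_ge0.
  elim: d => [|d IH]; first by rewrite addn0 !subrr normr0 mulr0.
  pose j := (N + d)%N.
  have step : `|h j%:Z * ez j%:Z x + h (- j.+1%:Z) * ez (- j.+1%:Z) x| <= (2 * B * q ^+ j)%:C.
    apply: le_trans (ler_normD _ _) _; rewrite (normrM (h j)) (normrM (h (- j.+1%:Z))).
    rewrite !norm_ez !mulr1.
    apply: le_trans (lerD (hB _) (hB _)) _; rewrite -!rmorphD lecR abszN !absz_nat.
    rewrite -mulrA mulr_natl mulr2n lerD2l ler_wpM2l // exprS.
    by rewrite ler_piMl ?exprn_ge0 // ltW.
  rewrite addnS {1}/g big_ord_recr /= -/(g (N + d)%N x) addrAC -/j.
  apply: le_trans (ler_normD _ _) _; apply: le_trans (lerD IH step) _.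
  rewrite -!rmorphD lecR -/j.
  have -> : K * (q ^+ N - q ^+ j.+1) = K * (q ^+ N - q ^+ j) + 2 * B * q ^+ j.
    by rewrite exprS /K; field; rewrite gt_eqF.
  by [].
have gle N x : `|g N x| <= (K * q ^+ N)%:C.
  have hx : (g N x : R[i]^o) @[N --> \oo] --> (0 : R[i]^o).
    by have := h0 x; rewrite /has_zsum (funext (fun N => gE N x)).
  apply/ler_addgt0Pr => e e0.
  move/cvgrPdist_lt: hx => /(_ e e0) [J _ hJ].
  have := hJ (N + J)%N (leq_addl _ _); rewrite sub0r normrN => /ltW hJ'.
  rewrite (_ : g N x = g (N + J)%N x - (g (N + J)%N x - g N x)); last by rewrite subKr.
  apply: le_trans (ler_normB _ _) _; rewrite addrC; apply: lerD; [exact: tail|exact: hJ'].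
have cg N : contC (g N) /\ forall m : int, (`|m| < N)%N -> fcoef (g N) m = h m.
  pose e (j : int) x := h j * ez j x.
  have ce j : contC (e j) by apply: contCM; [exact: contC_cst|exact: contC_ez].
  have fe j m : fcoef (e j) m = h j * (j == m)%:R.
    by rewrite fcoefZ ?fcoef_ez //; exact: contC_ez.
  have c0 : contC (g 0%N) by rewrite (_ : g 0%N = fun=> 0); [exact: contC_cst|apply/funext => x; rewrite /g big_ord0].
  have gS M : g M.+1 = fun x => g M x + (e M%:Z x + e (- M.+1%:Z) x).
    by apply/funext => x; rewrite /g big_ord_recr.
  have cg M : contC (g M).
    by elim: M => // M IH; rewrite gS; apply: contCD => //; exact: contCD.
  split => // m mN; suff : fcoef (g N) m = h m * ((- N%:Z <= m) && (m < N%:Z))%:R.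
    by move=> ->; rewrite (_ : _ && _ = true) ?mulr1 //; apply/andP; split; lia.
  elim: N {mN} => [|M IH].
    rewrite (_ : _ && _ = false) ?mulr0; last by apply/negP => /andP [h1 h2]; lia.
    rewrite (_ : g 0%N = fun x => 0 * ez 0 x) ?fcoefZ ?mul0r //; first exact: contC_ez.
    by apply/funext => x; rewrite /g big_ord0 mul0r.
  rewrite gS fcoefD //; last exact: contCD.
  rewrite fcoefD // IH !fe.
  have [<-|m1] := eqVneq M%:Z m.
    rewrite (_ : (- M.+1%:Z == M%:Z) = false) ?mulr0 ?addr0; last by apply/eqP => E; lia.
    rewrite (_ : _ && (M%:Z < M%:Z) = false) ?mulr0 ?add0r; last by rewrite ltxx andbF.
    by rewrite (_ : (- M.+1%:Z <= M%:Z < M.+1%:Z) = true) //; apply/andP; split; lia.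
  have [<-|m2] := eqVneq (- M.+1%:Z) m.
    rewrite mulr0 add0r (_ : (- M%:Z <= - M.+1%:Z) = false) ?mulr0 ?add0r; last by apply/negP => E; lia.
    by rewrite (_ : (- M.+1%:Z <= - M.+1%:Z < M.+1%:Z) = true) //; apply/andP; split; lia.
  rewrite !mulr0 !addr0; congr (_ * (nat_of_bool _)%:R).
  by apply/andP/andP => -[h1 h2]; split; lia.
apply/eqP; rewrite -normr_eq0; have [m m0 em] := normcE_real (h n).
rewrite em fmorph_eq0 eq_le m0 andbT.
apply: (cvgr_to_ge (F := \oo) (f := fun N => 2 * (K * q ^+ N))).
  rewrite (_ : 0 = 2 * (K * 0) :> R); last by rewrite !mulr0.
  apply: cvgM; first exact: cvg_cst.
  by apply: cvgM; [exact: cvg_cst|apply: cvg_expr; rewrite ger0_norm].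
exists `|n|.+1 => // N /= nN; have [cgN fN] := cg N.
rewrite -lecR -em -(fN n nN); apply: cint_bound; first exact: contC_fcoef.
by move=> x _; rewrite (normrM (g N x)) norm_ez mulr1.
Qed.

Lemma zseries_term_cvg0 (u : int -> R[i]) : cvgn (zseries u) ->
  (u j%:Z + u (- j.+1%:Z) : R[i]^o) @[j --> \oo] --> (0 : R[i]^o).
Proof.
exact (@cvg_series_cvg_0 R[i] R[i]^o (fun j : nat => u j%:Z + u (- j.+1%:Z) : R[i]^o)).
Qed.

(** The terms of the two convergent series at height [y / 2] are bounded, hence
    those at height [y] decrease geometrically. *)
Lemma expansion_bound k f c (y : R) : is_expansion k f c -> 0 < y ->
  exists B q : R, [/\ 0 <= B, 0 <= q < 1 & forall n : int,
    `|expansion_coef k c n y * (expR (- (2 * pi * n%:~R * y)))%:C| <= (B * q ^+ `|n|)%:C].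
Proof.
move=> [[N0 hN0] hc2 hf] y0; pose y' := y / 2; have y'0 : 0 < y' by rewrite divr_gt0.
pose q := expR (- (pi * y)).
have piy : 0 < pi * y by rewrite mulr_gt0 ?pi_gt0.
have q0 : 0 < q by exact: expR_gt0.
have q1 : q < 1 by rewrite /q -[1](@expR0 R) ltr_expR oppr_lt0.
have qX (j : nat) : q ^+ j = expR (- (j%:R * (pi * y))).
  by rewrite /q -expRM_natl mulrN.
pose tau : uhp R := to_uhp (0 +i* y').
have vt : val tau = 0 +i* y' by rewrite to_uhpK.
have yt : ycoord tau = y' by exact: ycoord_to_uhp.
have [] := hf tau; set fp := fun n => _; set fm := fun n => _ => /zseries_term_cvg0 tp /zseries_term_cvg0 tm _.
have norm_e n : `|e2pi (n%:~R * val tau)| = (expR (- (2 * pi * n%:~R * y')))%:C.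
  rewrite vt e2pi_line (normrM (ez n 0)) norm_ez mul1r ger0_norm //.
  by rewrite lecE /= eqxx expR_ge0.
have norm_exp (t : R) : `|(expR t)%:C| = (expR t)%:C :> R[i].
  by rewrite ger0_norm // lecE /= eqxx expR_ge0.
have neg0 (w : int -> R[i]) : exists2 M : R, 0 <= M &
    forall j : nat, `|c.1 (- j.+1%:Z) * w (- j.+1%:Z)| <= M%:C.
  apply: (@bounded_eventually0 (fun j => c.1 (- j.+1%:Z) * w (- j.+1%:Z)) `|N0|) => j hj.
  by rewrite hN0 ?mul0r //; lia.
have [M M0 hM] := bounded_of_cvg0 tp.
have [M' M'0 hM'] := neg0 (fun n => e2pi (n%:~R * val tau)).
have [M2 M20 hM2] := neg0 (fun n => (expR (- (2 * pi * n%:~R * y)) / q ^+ `|n|)%:C).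
have [M3 M30 hM3] := bounded_of_cvg0 tm.
(* The factor for the incomplete Gamma function when the height is doubled. *)
pose K : R := 2 `^ (1 - k%:~R); have K0 : 0 <= K by exact: powR_ge0.
exists (M + M' + M2 + K * M3), q; split; first by rewrite !addr_ge0 ?mulr_ge0.
  by rewrite ltW.
case=> j.
  have hj : c.2 (Posz j) = 0 by apply: hc2.
  rewrite /expansion_coef hj mul0r addr0 absz_nat.
  have e1 : expR (- (2 * pi * j%:~R * y)) = expR (- (2 * pi * j%:~R * y')) * q ^+ j.
    by rewrite qX -expRD; congr expR; rewrite /y' -pmulrn; field.
  have nfp : `|fp j| = `|c.1 j| * (expR (- (2 * pi * j%:~R * y')))%:C.
    by rewrite /fp (normrM (c.1 j)) norm_e.
  have -> : `|c.1 j * (expR (- (2 * pi * j%:~R * y)))%:C| = `|fp j| * (q ^+ j)%:C.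
    by rewrite (normrM (c.1 j)) norm_exp e1 nfp realCM mulrA.
  have -> : fp j = (fp j + fp (- j.+1%:Z)) - fp (- j.+1%:Z) by rewrite addrK.
  rewrite realCM; apply: ler_wpM2r; first by rewrite lecE /= eqxx exprn_ge0 ?ltW.
  apply: le_trans (ler_normB _ _) _; apply: le_trans (lerD (hM j) (hM' j)) _.
  by rewrite -rmorphD lecR -[leRHS]addrA lerDl addr_ge0 ?mulr_ge0.
have [n en] : exists n : int, n = Negz j by exists (Negz j).
rewrite -en; have en' : n = - j.+1%:Z by rewrite en NegzE.
have an : `|n|%N = j.+1 by rewrite en' abszN absz_nat.
have nR : `|n|%:~R = j.+1%:R :> R by rewrite en' normrN (_ : `|j.+1%:Z| = j.+1%:Z) // -pmulrn.
have nZ : n%:~R = - j.+1%:R :> R by rewrite en' mulrNz -pmulrn.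
have qn0 : 0 < q ^+ j.+1 by rewrite exprn_gt0.
rewrite an /expansion_coef mulrDl; apply: le_trans (ler_normD _ _) _.
have b1 : `|c.1 n * (expR (- (2 * pi * n%:~R * y)))%:C| <= (M2 * q ^+ j.+1)%:C.
  have := hM2 j; rewrite -en' an; set w := expR _ / _ => h.
  have -> : expR (- (2 * pi * n%:~R * y)) = w * q ^+ j.+1 by rewrite divfK // gt_eqF.
  have q0' : 0 <= (q ^+ j.+1)%:C :> R[i] by rewrite lecE /= eqxx ltW.
  rewrite (realCM w) mulrA normrM (realCM M2) (ger0_norm q0').
  exact: ler_wpM2r.
have b2 : `|c.2 n * (upper_gamma (1 - k%:~R) (4 * pi * `|n|%:~R * y))%:C *
    (expR (- (2 * pi * n%:~R * y)))%:C| <= (K * M3 * q ^+ j.+1)%:C.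
  have h := hM3 j; rewrite /fm hc2 // !mul0r add0r -en' yt in h.
  have norm_U (t : R) : `|(upper_gamma (1 - k%:~R) t)%:C| = (upper_gamma (1 - k%:~R) t)%:C :> R[i].
    by rewrite ger0_norm // lecE /= eqxx upper_gamma_ge0.
  have [m m0 em] := normcE_real (c.2 n).
  rewrite !normrM em norm_exp norm_U -!realCM lecR.
  rewrite (normrM (c.2 n * _)) (normrM (c.2 n)) em norm_e norm_U -!realCM lecR in h.
  pose z := 4 * pi * j.+1%:R * y'; have z0 : 0 < z by rewrite !mulr_gt0 ?pi_gt0.
  have sc := @upper_gamma_scale R (1 - k%:~R) 2 z (ltr1n R 2) z0.
  rewrite nR nZ in h *; rewrite -/z in h.
  rewrite (_ : 4 * pi * j.+1%:R * y = 2 * z); last by rewrite /z /y'; field.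
  have eu : expR (- (2 * pi * - j.+1%:R * y)) =
      expR (- (2 * pi * - j.+1%:R * y')) * expR ((2 - 1) * z) * q ^+ j.+1.
    by rewrite qX -!expRD; congr expR; rewrite /z /y'; field.
  have ez : expR (- ((2 - 1) * z)) * expR ((2 - 1) * z) = 1 by rewrite -expRD addNr expR0.
  rewrite eu; apply: (@le_trans _ _ (m * (K * expR (- ((2 - 1) * z)) * upper_gamma (1 - k%:~R) z) *
      (expR (- (2 * pi * - j.+1%:R * y')) * expR ((2 - 1) * z) * q ^+ j.+1))).
    apply: ler_wpM2r; first by rewrite !mulr_ge0 ?expR_ge0 // ltW.
    exact: ler_wpM2l.
  have -> : m * (K * expR (- ((2 - 1) * z)) * upper_gamma (1 - k%:~R) z) *
      (expR (- (2 * pi * - j.+1%:R * y')) * expR ((2 - 1) * z) * q ^+ j.+1) =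
      (expR (- ((2 - 1) * z)) * expR ((2 - 1) * z)) *
      (K * (m * upper_gamma (1 - k%:~R) z * expR (- (2 * pi * - j.+1%:R * y'))) * q ^+ j.+1) by ring.
  rewrite ez mul1r; apply: ler_wpM2r; first exact: ltW.
  exact: ler_wpM2l.
apply: le_trans (lerD b1 b2) _; rewrite -rmorphD lecR -mulrDl.
apply: ler_wpM2r; first exact: ltW.
by rewrite -[leRHS]addrA lerDr addr_ge0.
Qed.

End Uniqueness.

Section ClassVanishing.
Variables (R : realType) (p : nat).
Hypothesis p_prime : prime p.
Hypothesis p_odd : odd p.

(** A vanishing projection has no coefficients: at each height they vanish by
    the uniqueness of Fourier series, and the incomplete Gamma function is not
    constant. *)
Lemma class_proj0_coef k f c (r : 'F_p) : is_expansion k f c ->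
  (forall tau : uhp R, class_proj f r tau = 0) ->
  forall n : int, n%:~R = r -> c.1 n = 0 /\ c.2 n = 0.
Proof.
move=> hc h0 n nr.
have pR : 0 < (p%:R : R) by rewrite ltr0n prime_gt0.
have coef0 (y : R) : 0 < y -> expansion_coef k c n y = 0.
  move=> y0; have [B [q [B0 q01 hB]]] := expansion_bound hc y0.
  pose h (m : int) : R[i] := if m%:~R == r then
    expansion_coef k c m y * (expR (- (2 * pi * m%:~R * y)))%:C else 0.
  have hb m : `|h m| <= (B * q ^+ `|m|)%:C.
    rewrite /h; case: eqP => _; first exact: hB.
    by rewrite normr0 lecE /= eqxx mulr_ge0 ?exprn_ge0 //; case/andP: q01.
  have hs (x : R) : has_zsum (fun m => h m * ez m x) 0.
    pose tau : uhp R := to_uhp ((p%:R * x) +i* (p%:R * y)).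
    have py : 0 < p%:R * y by rewrite mulr_gt0.
    have := @expansion_class R p p_prime p_odd k f c r tau hc; rewrite h0 mulr0.
    apply: eq_has_zsum => m; rewrite /h; case: eqP => _; last by rewrite mul0r.
    rewrite ycoord_to_uhp // mulrAC divff ?gt_eqF // mul1r -[RHS]mulrA; congr (_ * _).
    rewrite [RHS]mulrC -e2pi_line to_uhpK //; congr e2pi.
    have -> : (p%:R * x) +i* (p%:R * y) = p%:R * (x +i* y).
      have -> : p%:R = (p%:R)%:C :> R[i] by rewrite rmorph_nat.
      by apply: complex_eqP; rewrite /=; ring.
    by rewrite mulrA divfK // p_neq0.
  have := trig_series_eq0 B0 q01 hb hs n; rewrite /h nr eqxx => /eqP.
  by rewrite mulf_eq0 fmorph_eq0 [X in _ || X]gt_eqF ?expR_gt0 // orbF => /eqP.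
have [n0|n0] := lerP 0 n.
  have := coef0 1 ltr01; case: hc => _ hc2 _.
  by rewrite /expansion_coef hc2 // mul0r addr0.
have n1 : 0 < (`|n|%:~R : R) by rewrite ltr0z normr_gt0 lt_eqF.
have M0 : 0 < 4 * pi * `|n|%:~R :> R by rewrite !mulr_gt0 ?pi_gt0.
have [e e0 ee] := normcE_real (c.1 n); have [l l0 el] := normcE_real (c.2 n).
have U0 (t : R) : 0 <= upper_gamma (1 - k%:~R) t by exact: upper_gamma_ge0.
have c1 : c.1 n = 0.
  apply/eqP; rewrite -normr_eq0 ee fmorph_eq0 eq_le e0 andbT.
  apply: (cvgr_to_ge (F := +oo) (f := fun y => l * upper_gamma (1 - k%:~R) (4 * pi * `|n|%:~R * y))).
    rewrite (_ : 0 = l * 0 :> R); last by rewrite mulr0.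
    apply: cvgM; first exact: cvg_cst.
    apply: (cvg_comp (fun y : R => 4 * pi * `|n|%:~R * y) (upper_gamma (1 - k%:~R)) _ (@upper_gamma_cvg0 R (1 - k%:~R))).
    by apply: gt0_cvgMry => //; exact: cvg_id.
  near=> y; have y0 : 0 < y by near: y; apply: nbhs_pinfty_gt; exact: num_real.
  have /eqP := coef0 y y0; rewrite /expansion_coef addr_eq0 => /eqP e1.
  rewrite -lecR -ee e1 normrN normrM el rmorphM (_ : `|(upper_gamma _ _)%:C| = (upper_gamma (1 - k%:~R) (4 * pi * `|n|%:~R * y))%:C) //.
  by rewrite ger0_norm // lecE /= eqxx U0.
split => //; have /eqP := coef0 1 ltr01.
rewrite /expansion_coef c1 add0r mulf_eq0 fmorph_eq0 [X in _ || X]gt_eqF ?orbF => [/eqP //|].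
by apply: upper_gamma_gt0; rewrite mulr1.
Unshelve. all: by end_near. Qed.

End ClassVanishing.

(** * The isomorphism *)


Section Isomorphism.
Variables (R : realType) (p : nat).
Hypotheses (p_prime : prime p) (p_odd : odd p).
Local Notation N := (Zp_trunc (pdiv p)).+2.
Local Notation chi := (@legendre p).
Local Notation psi := (@psi R p).
Variables (lambda : 'F_p) (sigma : R[i]) (k : int).
Variable rho : mp2 R -> 'M[R[i]]_N.
Variable E : 'I_N -> set rat.
Hypothesis lambda_neq0 : lambda != 0.
Hypothesis rho_rep : is_mp2_rep rho.
Hypothesis rho_T : forall g : 'F_p, rho (mp2_T R) *m delta_mx g (0 : 'I_1) =
  psi (lambda * g ^+ 2) *: delta_mx g 0.
Hypothesis rho_S : forall g d : 'F_p,
  (rho (mp2_S R) *m delta_mx g (0 : 'I_1)) d 0 =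
  sigma * psi (- (2 * lambda * g * d)).
Hypothesis sigma_k : sigma ^+ 2 * p%:R = (-1) ^ k.
Hypothesis E_class : forall (g : 'F_p) (x : rat),
  E g x <-> x - (val (lambda * g ^+ 2))%:R / p%:R \is a Num.int.

Implicit Types (f g : uhp R -> R[i]^o) (F G : uhp R -> 'cV[R[i]]_N) (tau : uhp R).
Local Notation lift := (@finite_lift R p lambda).
Local Notation down := (descent lambda).
Local Notation vforms := (vector_harmonic_forms k rho E).

Let pR0 : 0 < (p%:R : R). Proof. by rewrite ltr0n prime_gt0. Qed.
Let pi0 : 0 < (p%:R^-1 : R). Proof. by rewrite invr_gt0. Qed.
Let pQ0 : 0 < (p%:R : rat). Proof. by rewrite ltr0n prime_gt0. Qed.
Let pC0 := p_neq0 R p_prime.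

Lemma periodic_x_periodic f : unit_periodic f -> x_periodic f.
Proof.
move=> pf x y y0; rewrite /at_xy -[RHS]pf; congr f; apply: uhpP.
rewrite val_uaff // !to_uhpK //; apply: complex_eqP; rewrite /=; ring.
Qed.

(** The chosen coefficients are those of an expansion, since one exists. *)
Lemma coefsP f : harmonic_forms p k f -> is_expansion k f (coefs k f).
Proof.
move=> [sf lf Df pf _].
have [c hc] := harmonic_expansion sf (periodic_x_periodic (Gamma0_periodic lf)) Df pf.
by apply: xgetPex; exists c.
Qed.

(** On harmonic forms the lift, defined by a series, is a finite combination
    of translates. *)
Lemma lift_formE f : harmonic_forms p k f ->
  lift_form k (fun gamma => lambda * gamma ^+ 2) f = lift f.
Proof.
move=> hf; apply/funext => tau; apply/matrixP => g j; rewrite !mxE -mulrA; congr (_ * _).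
exact (zsumE (@expansion_class R p p_prime p_odd k f _ (lambda * (g : 'F_p) ^+ 2) tau (coefsP hf))).
Qed.

(** A class of exponents is absent from the expansion if and only if the
    projection to it vanishes. *)
Lemma eps_plus_space f : harmonic_forms_eps p k (chi lambda) f <->
  harmonic_forms p k f /\ plus_space lambda f.
Proof.
split=> [[hf h0]|[hf h0]]; split => //.
  move=> r hr tau; have hc := @expansion_class R p p_prime p_odd k f _ r tau (coefsP hf).
  have h1 : has_zsum (fun _ : int => 0) (p%:R^-1 * class_proj f r tau).
    apply: eq_has_zsum hc => n; case: eqP => // nr.
    have [|e1 e2] := h0 n; first by rewrite nr.
    by rewrite /expansion_coef e1 e2 mul0r addr0 mul0r.
  have := zsumE h1; rewrite (zsumE (@has_zsum0 R)) => /esym/eqP.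
  by rewrite mulf_eq0 invr_eq0 (negPf pC0) => /eqP.
move=> n hn; exact: (class_proj0_coef p_prime p_odd (coefsP hf) (h0 _ hn)).
Qed.

Lemma class_proj_lin (a : R[i]) f g r tau : class_proj (a *: f + g : uhp R -> R[i]^o) r tau =
  a * @class_proj R p f r tau + class_proj g r tau.
Proof.
rewrite /class_proj mulr_sumr -big_split /=; apply: eq_bigr => j _.
by rewrite mulrCA -mulrDr.
Qed.

Lemma plus_space_subspace : @is_subspace R[i] (uhp R -> R[i]^o)
  [set f | harmonic_forms p k f /\ plus_space lambda f].
Proof.
split.
  split; last by move=> r _ tau; rewrite /class_proj big1 // => j _; rewrite mulr0.
  split; [exact: smooth0|by move=> *; rewrite mulr0|exact: Delta0|exact: principal_part0|].
  move=> M _; rewrite (_ : slash _ _ _ = fun=> 0); first exact: principal_part0.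
  by apply/funext => tau; rewrite /slash mulr0.
move=> a f g [[sf lf Df pf qf] hf] [[sg lg Dg pg qg] hg]; split; last first.
  by move=> r hr tau; rewrite class_proj_lin hf // hg // mulr0 addr0.
split.
- exact: smooth_lin.
- move=> M sM pM tau; have e t : (a *: f + g : uhp R -> R[i]^o) t = a * f t + g t by [].
  by rewrite !e lf // lg // mulrDr mulrCA.
- by move=> tau; rewrite [LHS](Delta_lin k a tau sf sg) Df Dg mulr0 addr0.
- exact: principal_part_lin.
- move=> M sM; rewrite (_ : slash k M _ = fun tau => a * slash k M f tau + slash k M g tau).
    by apply: principal_part_lin; [exact: qf|exact: qg].
  by apply/funext => tau; rewrite /slash mulrCA -mulrDr.
Qed.

Lemma vforms_subspace : is_subspace vforms.
Proof.
have e a F G tau i : (a *: F + G) tau i 0 = a * F tau i 0 + G tau i 0.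
  by rewrite (_ : (a *: F + G) tau = a *: F tau + G tau) // !mxE.
split.
  have e0 i : (fun tau : uhp R => (0 : uhp R -> 'cV[R[i]]_N) tau i 0) = fun=> 0.
    by apply/funext => tau; rewrite (_ : (0 : uhp R -> 'cV[R[i]]_N) tau = 0) // mxE.
  split=> [i|g _ tau|i tau|i]; rewrite ?e0.
  - exact: smooth0.
  - by rewrite mulmx0 scaler0.
  - exact: Delta0.
  - exact: principal_part0.
move=> a F G [sF lF DF pF] [sG lG DG pG].
have ei i : (fun tau => (a *: F + G) tau i 0) = lincomb a (fun tau => F tau i 0) (fun tau => G tau i 0).
  by apply/funext => tau; rewrite e.
split=> [i|g hg tau|i tau|i]; rewrite ?ei.
- by apply: smooth_lin; [exact: sF|exact: sG].
- rewrite (_ : forall t, (a *: F + G) t = a *: F t + G t) // lF // lG //.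
  by rewrite mulmxDr -scalemxAr scalerDr !scalerA mulrC.
- by rewrite (Delta_lin k a tau (sF i) (sG i)) DF DG mulr0 addr0.
- by apply: principal_part_lin; [exact: pF|exact: pG].
Qed.

Lemma finite_lift_vforms f : harmonic_forms p k f -> plus_space lambda f -> vforms (lift f).
Proof.
move=> [sf lf Df pf _] hf.
have eT (g : 'F_p) : (fun tau => lift f tau g 0) =
    fun tau => (s_factor g)%:R / p%:R * class_proj f (lambda * g ^+ 2) tau.
  by apply/funext => tau; rewrite mxE.
pose tr (j : 'F_p) : uhp R -> R[i] := f \o uaff p%:R^-1 ((val j)%:R / p%:R).
have ep (r : 'F_p) : class_proj f r = fun tau => \sum_(j <- index_enum 'F_p) psi (- (r * j)) * tr j tau by [].
have str j : smooth (tr j) by exact: smooth_uaff.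
have sproj r : smooth (@class_proj R p f r) by rewrite ep; apply: smooth_sum => j _.
split.
- by move=> g; rewrite eT; apply: smooth_scale; exact: sproj.
- apply: mp2_law_all => //.
    by apply/lawTE; apply: finite_lift_T => //; exact: Gamma0_periodic lf.
  by apply/lawSE; exact: (finite_lift_S p_prime p_odd lambda_neq0 rho_rep rho_T rho_S sigma_k lf hf).
- move=> g tau; rewrite eT (Delta_scale k _ tau (sproj _)) ep.
  have Dtr j t : Delta k (tr j) t = 0 by rewrite [LHS](Delta_uaff k _ t pi0 sf) Df.
  have D0 := Delta_sum (fun r : 'F_p => psi (- (lambda * (g : 'F_p) ^+ 2 * r))) (fun j (_ : j \in index_enum 'F_p) => str j) (fun j _ => Dtr j) tau.
  by rewrite [X in _ * X]D0 mulr0.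
- move=> g; rewrite eT; apply: principal_part_scale.
  rewrite (_ : E g = [set x | x - (val (lambda * (g : 'F_p) ^+ 2))%:R / p%:R \is a Num.int]).
    exact: principal_part_proj.
  by apply/seteqP; split=> x /E_class.
Qed.

Lemma principal_part_weaken (A B : set rat) (f : uhp R -> R[i]) : A `<=` B ->
  has_principal_part A f -> has_principal_part B f.
Proof.
move=> AB [P [hP h]]; exists P; split => // rc /hP [r0 Ar]; split => //; exact: AB.
Qed.

Lemma vforms_laws F : vforms F -> lawT rho F /\ lawS k rho F.
Proof.
move=> [_ lF _ _]; split.
  by apply/lawTE; exact (lF _ (Mp2Z_T R)).
exact ((lawSE k rho F).1 (lF _ (Mp2Z_S R))).
Qed.

(** At the cusps equivalent to infinity the slash action only contributes a sign;
    at the others a single component of [F] appears, in the variable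
    [(tau + j) / p]. *)
Lemma descent_harmonic F : vforms F -> harmonic_forms p k (down F).
Proof.
move=> vF; have [hT hS] := vforms_laws vF; case: vF => sF lF DF pF.
pose G (g : 'F_p) : uhp R -> R[i] := (fun tau => F tau g 0) \o uaff p%:R 0.
have eD : down F = fun tau => 2^-1 * \sum_(g <- index_enum 'F_p) psi (0 * (lambda * g ^+ 2)) * G g tau by [].
have sG (g : 'F_p) : smooth (G g) by apply: smooth_uaff => //; exact: sF.
have pI : has_principal_part [set r | r \is a Num.int] (down F).
  rewrite eD; apply: principal_part_scale; apply: principal_part_sum => g.
  have := @principal_part_uaff R (E g) [set r | r \is a Num.int] (fun tau => F tau g 0) p%:R 0 pQ0.
  rewrite ratr_nat; apply; last exact: pF.
  move=> r /E_class /= /(rpredM (natr_int _ p)).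
  rewrite mulrBr mulrCA mulfV ?gt_eqF // mulr1 => h.
  by rewrite -(rpredBr _ (natr_int _ (val (lambda * g ^+ 2)))).
have lD := descent_Gamma0 p_prime p_odd lambda_neq0 rho_rep rho_T rho_S sigma_k hT hS.
split=> //.
- by rewrite eD; apply: smooth_scale; apply: smooth_sum => g _; exact: sG.
- move=> tau; have DG (g : 'F_p) t : Delta k (G g) t = 0 by rewrite [LHS](Delta_uaff k _ t pR0 (sF g)) DF.
  have sS : smooth (fun tau => \sum_(g <- index_enum 'F_p) psi (0 * (lambda * g ^+ 2)) * G g tau).
    by apply: smooth_sum => g _; exact: sG.
  have D0 := Delta_sum (fun g : 'F_p => psi (0 * (lambda * g ^+ 2))) (fun j (_ : j \in index_enum 'F_p) => sG j) (fun j _ => DG j) tau.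
  by rewrite eD (Delta_scale k _ tau sS) [X in _ * X]D0 mulr0.
- move=> M sM; have [pM|pM] := boolP (p %| M 1%R 0%R)%Z.
    rewrite (_ : slash k M _ = fun tau => (chi (M 1 1)%:~R)%:~R * down F tau).
      apply: principal_part_scale; apply: principal_part_weaken pI => x /= xi.
      by apply: rpredM => //; exact: natr_int.
    apply/funext => tau; rewrite /slash lD //.
    have ab : autfac M tau ^ (- k) * autfac M tau ^ k = 1.
      by rewrite -expfzDr ?autfac_neq0 // addNr expr0z.
    have alg (a b c d : R[i]) : a * b = 1 -> a * (d * b * c) = d * c.
      move=> e; have -> : a * (d * b * c) = a * b * (d * c) by ring.
      by rewrite e mul1r.
    exact: alg.
  have [c [j e]] := descent_slash p_prime p_odd lambda_neq0 rho_rep rho_T rho_S sigma_k hT hS sM pM.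
  rewrite (_ : slash k M _ = fun tau => c * ((fun tau => F tau 0 0) \o uaff p%:R^-1 j) tau); last first.
    by apply/funext => tau; rewrite e.
  apply: principal_part_scale.
  have pQ1 : 0 < (p%:R^-1 : rat) by rewrite invr_gt0.
  have := @principal_part_uaff R (E 0) [set r | p%:R * r \is a Num.int] (fun tau => F tau 0 0) p%:R^-1 j pQ1.
  have -> : ratr p%:R^-1 = p%:R^-1 :> R by rewrite fmorphV /= ratr_nat.
  apply; last exact: pF.
  have v0 : val (lambda * (0 : 'F_p) ^+ 2) = 0%N by rewrite expr0n mulr0.
  move=> r /(E_class 0); rewrite v0 mul0r subr0 => ri.
  by rewrite /= mulrA mulfV ?gt_eqF // mul1r.
Qed.

(** The lift and the descent are inverse to each other. *)
Lemma harmonic_lift_iso : linear_iso (@harmonic_forms_eps R p k (chi lambda)) vforms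
  (lift_form k (fun gamma => lambda * gamma ^+ 2)).
Proof.
have -> : @harmonic_forms_eps R p k (chi lambda) =
    [set f | harmonic_forms p k f /\ plus_space lambda f].
  by apply/seteqP; split=> f /eps_plus_space.
have [_ sub] := plus_space_subspace.
split; [exact: plus_space_subspace|exact: vforms_subspace| |].
  move=> a f g hf hg; have [hfg _] := sub a f g hf hg.
  rewrite !lift_formE //; [|exact: hg.1|exact: hf.1].
  apply/funext => tau; apply/matrixP => i j.
  rewrite (_ : (a *: lift f + lift g) tau = a *: lift f tau + lift g tau) // !mxE class_proj_lin.
  by rewrite mulrDr mulrCA.
split.
- by move=> f [hf pf]; rewrite lift_formE //; exact: finite_lift_vforms.
- move=> f g /set_mem [hf pf] /set_mem [hg pg]; rewrite !lift_formE // => e.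
  apply/funext => tau; rewrite -(descent_finite_lift p_prime p_odd lambda_neq0 tau pf) e.
  exact: descent_finite_lift.
- move=> F vF; have [hT hS] := vforms_laws vF.
  have hD := descent_harmonic vF; have pD := plus_space_descent p_prime p_odd lambda_neq0 rho_T hT.
  exists (down F) => //; rewrite lift_formE //; apply/funext => tau.
  exact: (finite_lift_descent p_prime p_odd lambda_neq0 rho_T rho_S sigma_k).
Qed.

End Isomorphism.

(** * The lattice *)


Section LatticeData.
Variables (R : realType) (p : nat).
Hypotheses (p_prime : prime p) (p_odd : odd p).
Local Notation psi := (@psi R p).

Lemma int_div_p (n : int) : (n%:~R : 'F_p) = 0 -> (n%:~R / p%:R : rat) \is a Num.int.
Proof.
move=> /eqP; rewrite intr_Fp_eq0 // => /dvdzP [m ->].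
rewrite intrM -pmulrn mulfK ?intr_int // pnatr_eq0 -lt0n prime_gt0 //.
Qed.

Lemma val_addN_int (a : 'F_p) :
  ((val a)%:R / p%:R + (val (- a))%:R / p%:R : rat) \is a Num.int.
Proof.
rewrite -mulrDl -natrD pmulrn; apply: int_div_p.
by rewrite -pmulrn natrD !natr_Zp subrr.
Qed.

Variables (V : vectType rat) (Q : V -> rat).
Hypothesis Q_quad : quadratic_form Q.
Variables (bp bm : nat) (L : set V) (iota : V -> 'F_p).
Hypothesis iota_iso : discriminant_iso Q L iota.
Variable lambda : 'F_p.
Hypothesis Q_iota : forall x : V, dual_lattice Q L x ->
     Q x - (val (lambda * iota x ^+ 2))%:R / p%:R \is a Num.int.
Variable k : int.
Hypothesis k_sig : (2 * k = bp%:Z - bm%:Z %[mod 4])%Z.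
Variable rho : mp2 R -> 'M[R[i]]_((Zp_trunc (pdiv p)).+2).
Hypothesis rho_weil : is_weil_rep Q L bp bm iota rho.

Definition weil_sigma : R[i] :=
  e2pi ((bm%:R - bp%:R) / 8) / (Num.sqrt (p%:R : R))%:C.

Lemma e2pi_Q x : dual_lattice Q L x -> e2pi (ratr (Q x)) = psi (lambda * iota x ^+ 2).
Proof. by move=> dx; apply: psi_rat; exact: Q_iota. Qed.

Lemma weil_T (g : 'F_p) : rho (mp2_T R) *m delta_mx g (0 : 'I_1) =
  psi (lambda * g ^+ 2) *: delta_mx g 0.
Proof.
have [_ _ sur] := iota_iso; have [x dx <-] := sur g.
by have [_ hT _] := rho_weil; rewrite (hT x dx) e2pi_Q.
Qed.

(** Polarization: [- (x, y) = Q(x) + Q(y) - Q(x + y)]. *)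
Lemma weil_S (g d : 'F_p) : (rho (mp2_S R) *m delta_mx g (0 : 'I_1)) d 0 =
  weil_sigma * psi (- (2 * lambda * g * d)).
Proof.
have [add _ sur] := iota_iso; have [x dx <-] := sur g; have [y dy <-] := sur d.
have [_ _ hS] := rho_weil; rewrite (hS x y dx dy); congr (_ * _).
have dxy : dual_lattice Q L (x + y).
  by move=> z Lz; have [_ ad _] := Q_quad; rewrite ad; apply: rpredD; [exact: dx|exact: dy].
have pD := psiD R p_prime.
have e : psi (lambda * iota (x + y) ^+ 2) * e2pi (ratr (- bil Q x y)) =
    psi (lambda * iota x ^+ 2) * psi (lambda * iota y ^+ 2).
  rewrite -!e2pi_Q // -!e2piD -!rmorphD /bil; congr (e2pi (ratr _)); ring.
have solve (a b c : 'F_p) (z : R[i]) : psi a * z = psi b * psi c -> z = psi (- a + (b + c)).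
  by move=> h; rewrite !pD -h mulrA -pD addNr psi0 // mul1r.
rewrite (solve _ _ _ _ e) add //; congr psi.
by generalize (iota x) (iota y) => a b; ring.
Qed.

Lemma e2pi_neg_half : e2pi (- (1 / 2)) = -1 :> R[i].
Proof.
have -> : - (1 / 2) = (- (1 / 2))%:C :> R[i] by rewrite rmorphN rmorphM fmorphV /= rmorph1 rmorph_nat.
rewrite e2pi_real (_ : 2 * pi * - (1 / 2) = - pi); last by field.
by rewrite cosN sinN cospi sinpi; apply: complex_eqP; rewrite /= ?oppr0.
Qed.

(** The left hand side is [e((b^- - b^+) / 4)], and the weight has the parity of
    [(b^+ - b^-) / 2]. *)
Lemma weil_sigma_k : weil_sigma ^+ 2 * p%:R = (-1) ^ k.
Proof.
have p0 := p_neq0 R p_prime.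
have sq : (Num.sqrt (p%:R : R))%:C ^+ 2 = p%:R :> R[i].
  by rewrite -rmorphXn /= sqr_sqrtr ?ler0n // rmorph_nat.
rewrite /weil_sigma expr_div_n sq divfK // -e2piMn.
have [m em] : exists m : int, bm%:Z - bp%:Z = - (2 * k) + 4 * m.
  move/eqP: k_sig; rewrite eqz_mod_dvd => /dvdzP [m hm].
  by exists m; clear -hm; lia.
have -> : 2 * ((bm%:R - bp%:R) / 8) = k%:~R * - (1 / 2) + m%:~R :> R[i].
  have h : bm%:~R - bp%:~R = - (2 * k%:~R) + 4 * m%:~R :> R[i].
    by rewrite -intrB em intrD intrN !intrM.
  by rewrite [bm%:R]pmulrn [bp%:R]pmulrn h; field.
by rewrite e2piD e2pi_int mulr1 e2piMz e2pi_neg_half.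
Qed.

Lemma exponents_class (g : 'F_p) (x : rat) : exponents Q L iota g x <->
  x - (val (lambda * g ^+ 2))%:R / p%:R \is a Num.int.
Proof.
split=> [[v [dv <- h]]|h].
  rewrite (_ : _ - _ = (x - Q v) + (Q v - (val (lambda * iota v ^+ 2))%:R / p%:R)); last by ring.
  by apply: rpredD => //; exact: Q_iota.
have [_ _ sur] := iota_iso; have [v dv ev] := sur g; exists v; split => //.
rewrite (_ : _ - _ = (x - (val (lambda * g ^+ 2))%:R / p%:R) - (Q v - (val (lambda * g ^+ 2))%:R / p%:R)); last by ring.
by apply: rpredB => //; rewrite -ev; exact: Q_iota.
Qed.

Lemma dual_exponents_class (g : 'F_p) (x : rat) : dual_exponents Q L iota g x <->
  x - (val (- lambda * g ^+ 2))%:R / p%:R \is a Num.int.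
Proof.
have hN := val_addN_int (lambda * g ^+ 2); rewrite -mulNr in hN.
split=> [[v [dv ev h]]|h].
  have := Q_iota dv; rewrite ev => hQ.
  rewrite (_ : _ - _ = (x + Q v) - (Q v - (val (lambda * g ^+ 2))%:R / p%:R) -
    ((val (lambda * g ^+ 2))%:R / p%:R + (val (- lambda * g ^+ 2))%:R / p%:R)); last by ring.
  by apply: rpredB => //; exact: rpredB.
have [_ _ sur] := iota_iso; have [v dv ev] := sur g; exists v; split => //.
have := Q_iota dv; rewrite ev => hQ.
rewrite (_ : _ + _ = (x - (val (- lambda * g ^+ 2))%:R / p%:R) + (Q v - (val (lambda * g ^+ 2))%:R / p%:R) +
    ((val (lambda * g ^+ 2))%:R / p%:R + (val (- lambda * g ^+ 2))%:R / p%:R)); last by ring.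
by apply: rpredD => //; exact: rpredD.
Qed.

Lemma conj_rep_mp2 : is_mp2_rep rho -> is_mp2_rep (conj_rep rho).
Proof.
move=> [h1 hM]; split; first by rewrite /conj_rep h1 map_mx1.
by move=> g h zg zh; rewrite /conj_rep hM // map_mxM.
Qed.

Lemma conj_repE (n : nat) (rho' : mp2 R -> 'M[R[i]]_n) h (g : 'I_n) :
  conj_rep rho' h *m delta_mx g (0 : 'I_1) = map_mx (@conjc R) (rho' h *m delta_mx g 0).
Proof. by rewrite map_mxM map_delta_mx. Qed.

Lemma conj_T (g : 'F_p) : conj_rep rho (mp2_T R) *m delta_mx g (0 : 'I_1) =
  psi (- lambda * g ^+ 2) *: delta_mx g 0.
Proof. by rewrite conj_repE weil_T map_mxZ map_delta_mx mulNr -psi_conj. Qed.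

Lemma conj_S (g d : 'F_p) : (conj_rep rho (mp2_S R) *m delta_mx g (0 : 'I_1)) d 0 =
  conjc weil_sigma * psi (- (2 * - lambda * g * d)).
Proof.
rewrite conj_repE mxE weil_S rmorphM; congr (_ * _).
by rewrite [LHS]psi_conj //; congr psi; ring.
Qed.

Lemma conj_sigma_k : conjc weil_sigma ^+ 2 * p%:R = (-1) ^ k.
Proof.
have := congr1 (@conjc R) weil_sigma_k.
rewrite rmorphM rmorphXn rmorph_nat => ->.
by rewrite fmorphXz rmorphN rmorph1.
Qed.

End LatticeData.

Theorem proposition1p4 (R : realType) (p : nat) (p_prime : prime p)
  (p_odd : odd p)
  (V : vectType rat) (Q : V -> rat) (Q_quad : quadratic_form Q)
  (Q_nondeg : nondegenerate_form Q)
  (bp bm : nat) (Q_sig : has_signature Q bp bm)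
  (L : set V) (L_even : even_lattice Q L)
  (iota : V -> 'F_p) (iota_iso : discriminant_iso Q L iota)
  (lambda : 'F_p) (lambda_neq0 : lambda != 0)
  (Q_iota : forall x : V, dual_lattice Q L x ->
     Q x - (val (lambda * iota x ^+ 2))%:R / p%:R \is a Num.int)
  (k : int) (k_sig : (2 * k = bp%:Z - bm%:Z %[mod 4])%Z)
  (rho : mp2 R -> 'M[R[i]]_((Zp_trunc (pdiv p)).+2))
  (rho_weil : is_weil_rep Q L bp bm iota rho) :
  let eps : int := legendre lambda in
  let delta : int := legendre (-1 : 'F_p) * eps in
  linear_iso (@harmonic_forms_eps R p k eps)
    (vector_harmonic_forms k rho (exponents Q L iota))
    (lift_form k (fun gamma => lambda * gamma ^+ 2)) /\
  linear_iso (@harmonic_forms_eps R p k delta)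
    (vector_harmonic_forms k (conj_rep rho) (dual_exponents Q L iota))
    (lift_form k (fun gamma => - (lambda * gamma ^+ 2))).
Proof.
(* The dual representation is of the same kind: complex conjugation replaces
   [lambda] by [- lambda] and [sigma] by its conjugate. *)
move=> eps delta; have [rep _ _] := rho_weil; split.
  exact (harmonic_lift_iso p_prime p_odd lambda_neq0 rep (weil_T iota_iso Q_iota rho_weil)
    (weil_S p_prime Q_quad iota_iso Q_iota rho_weil) (weil_sigma_k R p_prime k_sig)
    (exponents_class iota_iso Q_iota)).
have -> : delta = legendre (- lambda) by rewrite /delta /eps -legendreM // mulN1r.
have -> : (fun gamma => - (lambda * gamma ^+ 2)) = (fun gamma => - lambda * gamma ^+ 2).
  by apply/funext => gamma; rewrite mulNr.
have l0 : - lambda != 0 by rewrite oppr_eq0.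
exact (harmonic_lift_iso p_prime p_odd l0 (conj_rep_mp2 rep)
  (conj_T p_prime iota_iso Q_iota rho_weil) (conj_S p_prime Q_quad iota_iso Q_iota rho_weil)
  (conj_sigma_k R p_prime k_sig) (dual_exponents_class p_prime iota_iso Q_iota)).
Qed.
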